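(* Let $d\ge 1$, let $c_0>0$ and $\lambda>0$, and let $\tau$ and $\sigma$ satisfy the standing assumptions given in the context. Let $u=\{u_t(x)\}_{t\ge 0,\,x\in\mathbf{Z}^d}$ be the solution of $$\mathrm{d}u_t(x)=(\mathcal{G}u_t)(x)\,\mathrm{d}t+\lambda\,\sigma(u_t(x))\,\mathrm{d}B_t(x)\quad (t>0,\ x\in\mathbf{Z}^d),\qquad u_0(x)=c_0\delta_0(x),$$ and let $m_t(\lambda):=\sum_{x\in\mathbf{Z}^d}|u_t(x)|$. Then $$\limsup_{t\to\infty}\frac1t\log m_t(\lambda)>-\infty\qquad\text{with positive probability.}$$
   Context: $\tau$ is a probability density (mass) function on $\mathbf{Z}^d$ and $\mathcal{G}$ is the operator $(\mathcal{G}h)(x)=\sum_{y\in\mathbf{Z}^d}[h(x+y)-h(x)]\tau(y)$; it is the generator of the rate-one continuous-time random walk (compound Poisson process) $X$ on $\mathbf{Z}^d$ with $X_0=0$ and jump distribution $\tau$. Standing assumptions on $\tau$: it has mean zero, $\sum_{x}x_j\tau(x)=0$ for all $1\le j\le d$; it has finite support, i.e. there is $R_0\in(1,\infty)$ with $\tau(x)=0$ whenever $\|x\|>R_0$; $\tau(0)<1$; and $X$ is genuinely $d$-dimensional, i.e. the support of $\tau$ is not contained in a proper linear subspace of $\mathbf{R}^d$. $\{B(x)\}_{x\in\mathbf{Z}^d}$ is a field of independent standard Brownian motions indexed by $\mathbf{Z}^d$, and the equation is understood as a system of It\^o stochastic differential equations. $\delta_0(x)=1$ if $x=0$ and $0$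 otherwise. Standing assumptions on $\sigma$: $\sigma:\mathbf{R}\to\mathbf{R}$ is deterministic and Lipschitz continuous, $\sigma(0)=0$, and $\mathrm{L}_\sigma:=\inf_{z\in\mathbf{R},\,z\neq 0}|\sigma(z)/z|>0$. Under these assumptions the system has a unique strong solution (Shiga and Shimizu), which satisfies $\sum_{y\in\mathbf{Z}^d}\int_0^t\mathrm{E}(|u_s(y)|^2)\,\mathrm{d}s<\infty$ for all $t>0$; this is the solution meant. Almost surely, $u_t(x)>0$ for all $t>0$ and $x\in\mathbf{Z}^d$, and $t\mapsto m_t(\lambda)$ is a continuous nonnegative $L^2(\mathrm{P})$-martingale with mean $c_0$. *)

(* Defs.v *)
From HB Require Import structures.
From mathcomp Require Import all_boot all_order all_algebra finmap.
From mathcomp Require Import all_classical all_reals all_analysis.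
Set Implicit Arguments.
Unset Strict Implicit.
Unset Printing Implicit Defensive.
Import Order.TTheory GRing.Theory Num.Theory.
Import numFieldNormedType.Exports.
Local Open Scope classical_set_scope.
Local Open Scope ring_scope.

Section lattice_walk.
Context {R : realType} {n : nat}.
Implicit Types (tau h : 'rV[int]_n -> R) (x : 'rV[int]_n).

Definition lattice_vec x : 'rV[R]_n := map_mx intr x.

Definition lattice_norm x : R :=
  Num.sqrt (\sum_(j < n) (x ord0 j)%:~R ^+ 2).

(* The sums over the lattice below are finitely supported sums: they are the
   intended ones as soon as tau vanishes outside a ball. *)
Record jump_law tau : Prop := JumpLaw {
  jump_ge0 : forall x, 0 <= tau x ;
  jump_mass : (\esum_(x in [set: 'rV[int]_n]) (tau x)%:E = 1)%E ;
  jump_finite_range :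
    exists2 R0 : R, 1 < R0 & forall x, R0 < lattice_norm x -> tau x = 0 ;
  jump_centered : forall j : 'I_n,
    \sum_(x \in [set: 'rV[int]_n]) (x ord0 j)%:~R * tau x = 0 ;
  jump_nontrivial : tau 0 < 1 ;
  jump_spanning : forall V : {vspace 'rV[R]_n},
    (forall x, tau x != 0 -> lattice_vec x \in V) -> V = fullv }.

Definition generator tau h x : R :=
  \sum_(y \in [set: 'rV[int]_n]) (h (x + y) - h x) * tau y.

End lattice_walk.

Record noise_coefficient {R : realType} (sigma : R -> R) : Prop :=
  NoiseCoefficient {
    noise_lipschitz : exists k : R, k.-lipschitz sigma ;
    noise0 : sigma 0 = 0 ;
    noise_inf_gt0 : 0 < inf [set `|sigma z / z| | z in [set z : R | z != 0]] }.

Section stochastic_calculus.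
Context {R : realType} {d : measure_display} {T : measurableType d}.
Variable P : probability T R.
(* A process is a function of time, then of the sample point; only its values
   at nonnegative times matter. *)
Implicit Types (W H : R -> T -> R) (F : R -> set_system T) (X : T -> R).

Definition sub_measurable (G : set_system T) X :=
  forall C : set R, measurable C -> G (X @^-1` C).

Definition independent_family {I : choiceType} (G : I -> set_system T) :=
  forall (J : {fset I}) (A : I -> set T),
    (forall i, i \in J -> G i (A i)) ->
    P (\bigcap_(i in [set` J]) A i) = (\prod_(i <- J) fine (P (A i)))%:E.

(* sigma(W_s : s in D) *)
Definition sigma_process (D : set R) W : set_system T :=
  <<s \bigcup_(s in D) preimage_set_system setT (W s) measurable >>.

Definition continuous_paths W :=
  {ae P, forall w, {within `[0, +oo[, continuous (fun t => W t w)}}.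

Definition increment W (s t : R) (w : T) : R := W t w - W s w.

Record standard_BM W : Prop := StandardBM {
  BM_measurable : forall t, 0 <= t -> measurable_fun setT (W t) ;
  BM_start : {ae P, forall w, W 0 w = 0} ;
  BM_gaussian : forall s t, 0 <= s -> s < t ->
    forall C : set R, measurable C ->
    P (increment W s t @^-1` C) = normal_prob 0 (Num.sqrt (t - s)) C ;
  BM_independent_increments : forall s t, 0 <= s -> s < t ->
    forall A, sigma_process `[0, s] W A ->
    forall C : set R, measurable C ->
    P (A `&` increment W s t @^-1` C) = (P A * P (increment W s t @^-1` C))%E ;
  BM_continuous : continuous_paths W }.

Definition brownian_field {I : choiceType} (B : I -> R -> T -> R) :=
  (forall x, standard_BM (B x)) /\
  independent_family (fun x => sigma_process `[0, +oo[ (B x)).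

(* the filtration generated by the whole field, augmented with null sets *)
Definition brownian_filtration {I : choiceType} (B : I -> R -> T -> R)
    (t : R) : set_system T :=
  <<s \bigcup_x sigma_process `[0, t] (B x) `|`
      [set N | measurable N /\ P N = 0] >>.

(* the process equal to [coef i] on ]knot i, knot i.+1], i < steps *)
Record simple_process := SimpleProcess {
  steps : nat ;
  knot : nat -> R ;
  coef : nat -> T -> R }.

Definition simple_on F (t : R) (S : simple_process) :=
  [/\ 0 <= knot S 0, knot S (steps S) <= t &
      forall i, (i < steps S)%N ->
        [/\ knot S i <= knot S i.+1,
            sub_measurable (F (knot S i)) (coef S i) &
            exists M : R, forall w, `|coef S i w| <= M]].

Definition simple_val (S : simple_process) (s : R) (w : T) : R :=
  \sum_(i < steps S) coef S i w * \1_`]knot S i, knot S i.+1] s.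

Definition simple_integral W (S : simple_process) (w : T) : R :=
  \sum_(i < steps S) coef S i w * (W (knot S i.+1) w - W (knot S i) w).

(* I is a version of the Ito integral of H against W over [0, t]: the L^2(P)
   limit of the integrals of simple F-adapted processes that converge to H in
   L^2(ds x P). The norm of that space is an iterated integral; when H is
   adapted with almost surely continuous paths, as below, H has a jointly
   measurable modification and s |-> E[(S_s - H_s)^2] is measurable. *)
Definition is_ito_integral F W H (t : R) (I : T -> R) :=
  measurable_fun setT I /\
  (forall s, 0 <= s <= t -> sub_measurable (F s) (H s)) /\
  exists S : nat -> simple_process,
    [/\ forall k, simple_on F t (S k),
        (\int[lebesgue_measure]_(s in `[0%R, t])
           \int[P]_w ((simple_val (S k) s w - H s w) ^+ 2)%:E)%E
          @[k --> \oo] --> 0%E &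
        (\int[P]_w ((simple_integral W (S k) w - I w) ^+ 2)%:E)%E
          @[k --> \oo] --> 0%E].

End stochastic_calculus.

Section interacting_diffusion.
Context {R : realType} {d : measure_display} {T : measurableType d}.
Variables (P : probability T R) (n : nat).
Implicit Types (B u : 'rV[int]_n -> R -> T -> R).

(* u is the strong solution (adapted to the Brownian filtration, with
   continuous paths and summable second moments) of
     du_t(x) = (G u_t)(x) dt + lambda sigma(u_t(x)) dB_t(x),
     u_0 = c0 delta_0. *)
Record is_solution (tau : 'rV[int]_n -> R) (sigma : R -> R) (c0 lambda : R)
    B u : Prop := IsSolution {
  sol_adapted : forall x t, 0 <= t ->
    sub_measurable (brownian_filtration P B t) (u x t) ;
  sol_continuous : forall x, continuous_paths P (u x) ;
  sol_moment : forall t, 0 < t ->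
    (\esum_(y in [set: 'rV[int]_n])
       \int[lebesgue_measure]_(s in `[0%R, t])
         \int[P]_w (`|u y s w| ^+ 2)%:E < +oo)%E ;
  sol_initial : forall x, {ae P, forall w, u x 0 w = c0 * (x == 0)%:R} ;
  sol_equation : forall x t, 0 < t ->
    exists2 I : T -> R,
      is_ito_integral P (brownian_filtration P B) (B x)
        (fun s w => sigma (u x s w)) t I &
      {ae P, forall w, u x t w = u x 0 w
        + \int[lebesgue_measure]_(s in `[0%R, t])
            generator tau (fun y => u y s w) x
        + lambda * I w} }.

Definition total_mass u (t : R) (w : T) : \bar R :=
  \esum_(x in [set: 'rV[int]_n]) (`|u x t w|)%:E.

End interacting_diffusion.

(* Main.v *)
From HB Require Import structures.
Require Import Defs.
From mathcomp Require Import all_boot all_order all_algebra finmap.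
From mathcomp Require Import all_classical all_reals all_analysis.
From mathcomp Require Import measurable_realfun.
From mathcomp Require Import ring lra zify.
Set Implicit Arguments.
Unset Strict Implicit.
Unset Printing Implicit Defensive.
Import Order.TTheory GRing.Theory Num.Theory.
Import numFieldNormedType.Exports.
Local Open Scope classical_set_scope.
Local Open Scope ring_scope.

(** Let S_t be the sum over a finite set Lam of sites of the squares of u_t(x).
The total mass is at least the square root of S_t, and S_t does not become small
faster than exponentially. The reason is an estimate of a negative moment. By
Ito's formula the mean of 1 / (eps + S_t) changes through two effects:

- the drift: the generator has a bounded quadratic form on square summable
  functions, so that it contributes at most 4 / (eps + S_t), up to the jumps that
  leave Lam (generator_energy);
- the noise: the martingale part has mean zero, and since |sigma(z)| <= K |z| the
  quadratic variation contributes at most a constant times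
  S_t / (eps + S_t)^2 <= 1 / (eps + S_t).

So this mean satisfies a linear differential inequality whose rate depends neither
on Lam nor on eps, and whose error term is small when Lam is large, because the
second moments are summable over the sites, locally uniformly in time
(moment_bound, boundary_sum_small). By Gronwall's lemma the mean at time T is at
most 2 exp(rate * T) / c0^2 (mean_weight_le). Chebyshev's inequality, with eps equal
to c0^2 exp(- rate * T) / 8, shows that S_T exceeds eps with probability at least
1/2 (energy_small_probability); here Lam depends on T, which is harmless as the
total mass does not. Hence with probability at least 1/2 the bound holds for
infinitely many integers T, and along them the logarithm of the mass divided by T
is bounded from below.

In place of Ito's formula, time is cut into steps. Over a step of length h the
inverse energy is bounded by a second order expansion that holds for every
displacement (inverse_step). The displacement is, up to an error whose second
moment is of order h^2, a bounded function of the past times a Brownian increment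
(step_approx), and its mean against the past is h times the drift (step_mean).
This gives the bound for one step with an error of order h^2 (one_step), and the
errors add up to order h (gronwall_steps). The stochastic integrals enter through
the isometry (ito_isometry) and the vanishing of their means against the past
(ito_limit_mean); both rest on the independence of a Brownian increment from the
past of the whole field (increment_indep). *)

(** * Moments of centered normal laws *)

Section normal_moments.
Context {R : realType}.
Notation mu := (@lebesgue_measure R).

(** The density of the law with respect to Lebesgue measure is a Radon-Nikodym
derivative only up to a null set, which the integral does not see. *)
Lemma ge0_integral_normal_prob (s : R) (f : R -> \bar R) :
  measurable_fun setT f -> (forall x, 0 <= f x)%E ->
  (\int[normal_prob 0 s]_x f x = \int[mu]_x (f x * (normal_pdf 0 s x)%:E))%E.
Proof.
move=> mf f0.
have dom := normal_prob_dominates 0 s.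
rewrite -(Radon_Nikodym_SigmaFinite.change_of_variables dom)//.
have mpdf : measurable_fun setT (fun x : R => (normal_pdf 0 s x)%:E).
  by apply/measurable_EFinP; exact: measurable_normal_pdf.
apply: ae_eq_integral => //.
- apply: emeasurable_funM => //.
  exact: measurable_int (Radon_Nikodym_SigmaFinite.f_integrable dom).
- exact: emeasurable_funM.
- apply: ae_eqe_mul2l.
  apply: integral_ae_eq => //.
  + exact: Radon_Nikodym_SigmaFinite.f_integrable.
  + by move=> A _ mA; rewrite -(Radon_Nikodym_SigmaFinite.f_integral dom).
Qed.

Lemma normal_pdf_scale (s x : R) : 0 < s ->
  normal_pdf 0 s x = s^-1 * normal_pdf 0 1 (s^-1 * x).
Proof.
move=> s0; rewrite !normal_pdfE ?gt_eqF// /= /normal_peak /normal_fun.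
rewrite !subr0 !expr1n mul1r mulrA; congr (_ * expR _).
  rewrite -mulrnAr sqrtrM ?sqr_ge0// sqrtr_sqr gtr0_norm// invfM.
  by [].
by rewrite exprMn exprVn !mulNr -mulr_natr; congr (- _); field; rewrite gt_eqF.
Qed.

Lemma derive1_mull (c : R) : (fun x : R => c * x)^`()%classic = cst c.
Proof.
apply/funext => x; rewrite derive1E deriveM//= derive_cst derive_id scaler0.
by rewrite addr0 /= scaler1.
Qed.

(** The change of variables x = y / s in the integral against the density. *)
Lemma normal_scaling (s : R) (G : R -> R) : 0 < s -> continuous G ->
  (forall x, 0 <= G x) ->
  (\int[normal_prob 0 1]_x (G x)%:E =
   \int[normal_prob 0 s]_x (G (s^-1 * x))%:E)%E.
Proof.
move=> s0 cG G0.
have mG : measurable_fun setT G by exact: continuous_measurable_fun.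
rewrite [LHS]ge0_integral_normal_prob; [|exact/measurable_EFinP|]; last first.
  by move=> x; rewrite lee_fin.
rewrite [RHS]ge0_integral_normal_prob; last 2 first.
- apply/measurable_EFinP; apply: (measurableT_comp mG).
  exact: measurable_funM.
- by move=> x; rewrite lee_fin.
under eq_integral do rewrite -EFinM.
under [RHS]eq_integral => x _.
  rewrite -EFinM (normal_pdf_scale _ s0) (mulrC s^-1) mulrA.
  over.
rewrite (increasing_ge0_integration_by_substitutionT
  (F := fun x : R => s^-1 * x) (G := fun x => G x * normal_pdf 0 1 x))//.
- apply: eq_integral => x _; have := congr1 (fun h => h x) (derive1_mull s^-1).
  rewrite !fctE /= => ->.
  by rewrite (mulrC s^-1 x) mulrAC.
- by move=> x y xy; rewrite ltr_pM2l ?invr_gt0.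
- by rewrite derive1_mull => ?; exact: cvg_cst.
- by rewrite derive1_mull; exact: is_cvg_cst.
- by rewrite derive1_mull; exact: is_cvg_cst.
- by apply: gt0_cvgMrNy; rewrite ?invr_gt0.
- by apply: gt0_cvgMry; rewrite ?invr_gt0.
- move=> x; apply: cvgM; first exact: cG.
  by apply: continuous_normal_pdf; rewrite oner_eq0.
- by move=> x; rewrite mulr_ge0// normal_pdf_ge0.
Qed.

Lemma continuous_normX (k : nat) : continuous (fun x : R => `|x| ^+ k).
Proof.
move=> x; apply: (@continuous_comp _ _ _ (fun y : R => `|y|)
  (fun y : R => y ^+ k)); [exact: norm_continuous|exact: exprn_continuous].
Qed.

Lemma measurable_normX (k : nat) : measurable_fun setT (fun x : R => `|x| ^+ k).
Proof. by apply: continuous_measurable_fun; exact: continuous_normX. Qed.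

Definition normal_moment (k : nat) : \bar R :=
  (\int[normal_prob 0 1]_x (`|x| ^+ k)%:E)%E.

Lemma normal_moment_ge0 k : (0 <= normal_moment k)%E.
Proof. by apply: integral_ge0 => x _; rewrite lee_fin exprn_ge0. Qed.

Lemma normal_moment_scale (s : R) k : 0 < s ->
  (\int[normal_prob 0 s]_x (`|x| ^+ k)%:E = (s ^+ k)%:E * normal_moment k)%E.
Proof.
move=> s0; rewrite /normal_moment (normal_scaling s0 (G := fun x => `|x| ^+ k)).
- rewrite -ge0_integralZl ?lee_fin ?exprn_ge0 ?(ltW s0)//; last first.
    apply/measurable_EFinP; apply: (measurableT_comp (measurable_normX k)).
    exact: measurable_funM.
  apply: eq_integral => x _; rewrite -EFinM -exprMn; congr (_ ^+ _)%:E.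
  by rewrite normrM gtr0_norm ?invr_gt0// mulrA divff ?mul1r// gt_eqF.
- exact: continuous_normX.
- by move=> x; rewrite exprn_ge0.
Qed.

(** The powers up to 4 are absorbed by widening the Gaussian: as
|x|^4 <= 33 exp(x^2 / 4), up to a constant the integrand is at most the density
of variance 2. *)
Lemma normal_moment_lty k : (k <= 4)%N -> (normal_moment k < +oo)%E.
Proof.
move=> k4; rewrite /normal_moment ge0_integral_normal_prob; last 2 first.
- by apply/measurable_EFinP; exact: measurable_normX.
- by move=> x; rewrite lee_fin exprn_ge0.
have s0 : Num.sqrt 2 != 0 :> R by rewrite gt_eqF// sqrtr_gt0.
pose c : R := 33 * normal_peak 1 * (normal_peak (Num.sqrt 2))^-1.
apply: (@le_lt_trans _ _ (\int[mu]_x (c%:E * (normal_pdf 0 (Num.sqrt 2) x)%:E))%E).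
  apply: ge0_le_integral => //.
  - by move=> x _; rewrite -EFinM lee_fin mulr_ge0 ?exprn_ge0 ?normal_pdf_ge0.
  - apply: emeasurable_funM; apply/measurable_EFinP.
      exact: measurable_normX.
    exact: measurable_normal_pdf.
  - apply: emeasurable_funM => //; apply/measurable_EFinP.
    exact: measurable_normal_pdf.
  move=> x _; rewrite -!EFinM lee_fin !normal_pdfE ?oner_eq0// /= /c.
  have p0 : normal_peak (Num.sqrt 2) != 0 :> R by rewrite gt_eqF// normal_peak_gt0.
  rewrite (mulrC (33 * _)) -mulrA (mulrCA _ (normal_peak (Num.sqrt 2))) mulKf//.
  rewrite (mulrCA (`|x| ^+ k)) -[leRHS]mulrA [leRHS]mulrCA.
  rewrite ler_wpM2l ?normal_peak_ge0//.
  rewrite /normal_fun !subr0 expr1n sqr_sqrtr//.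
  have -> : - x ^+ 2 / (1 *+ 2) = x ^+ 2 / 4 * -1 + x ^+ 2 / 4 * -1 by field.
  have -> : - x ^+ 2 / (2 *+ 2) = x ^+ 2 / 4 * -1 :> R by rewrite -mulr_natr; field.
  rewrite expRD mulrA ler_wpM2r ?expR_ge0// mulrN1 expRN ler_pdivrMr ?expR_gt0//.
  apply: (@le_trans _ _ (1 + `|x| ^+ 4)).
    have [x1|x1] := leP `|x| 1.
      by apply: (@le_trans _ _ 1); rewrite ?lerDl ?exprn_ge0// exprn_ile1.
    by rewrite (le_trans (ler_weXn2l (ltW x1) k4))// lerDr.
  set y := x ^+ 2 / 4.
  have y0 : 0 <= y by rewrite divr_ge0// sqr_ge0.
  have -> : `|x| ^+ 4 = 16 * y ^+ 2.
    by rewrite /y (exprM _ 2 2) real_normK ?num_real//; field.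
  have := expR_ge1Dxn 1 y0; have := expR_ge1Dx y.
  rewrite (_ : 2`!%:R = 2 :> R)//; lra.
rewrite ge0_integralZl//; last 3 first.
- by apply/measurable_EFinP; exact: measurable_normal_pdf.
- by move=> x _; rewrite lee_fin normal_pdf_ge0.
- by rewrite lee_fin !mulr_ge0 ?invr_ge0 ?normal_peak_ge0.
by rewrite integral_normal_pdf mule1 ltry.
Qed.

(** The positive and the negative part of the integrand are exchanged by the
reflection x |-> - x. *)
Lemma normal_mean0 (s : R) : 0 < s ->
  (\int[normal_prob 0 s]_x x%:E = 0)%E.
Proof.
move=> s0; rewrite integralE.
have mE : measurable_fun setT (fun x : R => x%:E).
  by apply/measurable_EFinP; exact: measurable_id.
have fin : (\int[normal_prob 0 s]_x (fun x => x%:E)^\+ x < +oo)%E.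
  apply: (@le_lt_trans _ _ (\int[normal_prob 0 s]_x (`|x| ^+ 1)%:E)%E).
    apply: ge0_le_integral => //.
    - exact: (measurable_funepos mE).
    - by apply/measurable_EFinP; exact: measurable_normX.
    - by move=> x _; rewrite funeposE -EFin_max lee_fin ge_max ler_norm normr_ge0.
  rewrite normal_moment_scale//.
  by rewrite lte_mul_pinfty ?lee_fin ?exprn_ge0 ?(ltW s0)// normal_moment_lty.
have p0 (x : R) : 0 <= normal_pdf 0 s x by exact: normal_pdf_ge0.
have posE : (\int[normal_prob 0 s]_x (fun x => x%:E)^\+ x =
   \int[mu]_(x in `[0%R, +oo[) (x * normal_pdf 0 s x)%:E)%E.
  rewrite ge0_integral_normal_prob.
  - rewrite [RHS]integral_mkcond; apply: eq_integral => x _.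
    rewrite patchE mem_setE in_itv/= andbT funeposE.
    rewrite -EFin_max; case: (leP 0 x) => x0.
      by rewrite -EFinM.
    exact: mul0e.
  - exact: (measurable_funepos mE).
  - by move=> x; exact: funepos_ge0.
have negE : (\int[normal_prob 0 s]_x (fun x => x%:E)^\- x =
   \int[mu]_(x in `]-oo, (- 0)%R]) (- x * normal_pdf 0 s x)%:E)%E.
  rewrite ge0_integral_normal_prob.
  - rewrite [RHS]integral_mkcond; apply: eq_integral => x _.
    rewrite patchE mem_setE in_itv/= oppr0 funenegE.
    rewrite -EFinN -EFin_max; case: (leP x 0) => x0.
      have -> : Num.max (- x) 0 = - x by apply: max_l; rewrite oppr_ge0.
      by rewrite -EFinM.
    have -> : Num.max (- x) 0 = 0 by apply: max_r; rewrite oppr_le0 ltW.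
    exact: mul0e.
  - exact: (measurable_funeneg mE).
  - by move=> x; exact: funeneg_ge0.
have -> : (\int[normal_prob 0 s]_x (fun x => x%:E)^\- x =
    \int[normal_prob 0 s]_x (fun x => x%:E)^\+ x)%E.
  rewrite negE posE (ge0_integration_by_substitutionNy (a := 0)).
  - apply: eq_integral => x _; rewrite /= opprK !normal_pdfE ?gt_eqF//=.
    by rewrite /normal_fun !subr0 sqrrN.
  - apply: continuous_subspaceT => x; apply: cvgM; first exact: cvgN.
    by apply: continuous_normal_pdf; rewrite gt_eqF.
  - move=> x; rewrite in_itv/= oppr0 => x0.
    by rewrite mulr_ge0// lerNr oppr0 ltW.
by rewrite subee// ge0_fin_numE// integral_ge0// => x _; exact: funepos_ge0.
Qed.

End normal_moments.

(** * Expectation and second moments *)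

Lemma young_abs {R : realType} (a y : R) : 0 < a -> `|y| <= a + a^-1 * y ^+ 2.
Proof.
move=> a0; rewrite -(ler_pM2l a0) mulrDr mulrA divff ?gt_eqF// mul1r.
rewrite -(real_normK (num_real y)).
by have := sqr_ge0 (a - `|y|); have := normr_ge0 y; nra.
Qed.

Section expectation.
Context {R : realType} {d : measure_display} {T : measurableType d}.
Variable P : probability T R.
Implicit Types X Y Z : T -> R.

Definition intg X := P.-integrable setT (EFin \o X).
Definition Ex X : R := \int[P]_w X w.
(** The second moment is extended-real valued, so that it can be bounded before
X is known to be square integrable. *)
Definition E2 X : \bar R := (\int[P]_w ((X w) ^+ 2)%:E)%E.

Lemma intg_measurable X : intg X -> measurable_fun setT X.
Proof. by move=> /measurable_int /measurable_EFinP. Qed.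

Lemma intgP X : measurable_fun setT X -> (\int[P]_w `|X w|%:E < +oo)%E -> intg X.
Proof.
move=> mX fX; apply/integrableP; split; first exact/measurable_EFinP.
by under eq_integral do rewrite /= .
Qed.

Lemma intg_abs X : intg X -> (\int[P]_w `|X w|%:E < +oo)%E.
Proof. by move=> /integrableP[_]; under eq_integral do rewrite /=. Qed.

Lemma intgE X : intg X -> (\int[P]_w (X w)%:E)%E = (Ex X)%:E.
Proof. by move=> iX; rewrite /Ex /Rintegral fineK// integrable_fin_num. Qed.

Lemma integral_P_cst (c : \bar R) : (\int[P]_w c = c)%E.
Proof.
have := @integral_cst _ _ _ P setT measurableT c.
move=> /= ->; rewrite [X in (c * X)%E](_ : _ = 1%E) ?mule1//.
exact: probability_setT.
Qed.

Lemma intg_cst (c : R) : intg (cst c).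
Proof.
by apply: intgP => //; rewrite /= integral_P_cst ltry.
Qed.

Lemma Ex_cst (c : R) : Ex (cst c) = c.
Proof. by rewrite /Ex /Rintegral /= integral_P_cst. Qed.

Lemma intgD X Y : intg X -> intg Y -> intg (fun w => X w + Y w).
Proof. by move=> iX iY; exact: (integrableD measurableT iX iY). Qed.

Lemma intgB X Y : intg X -> intg Y -> intg (fun w => X w - Y w).
Proof. by move=> iX iY; exact: (integrableB measurableT iX iY). Qed.

Lemma intgZ (c : R) X : intg X -> intg (fun w => c * X w).
Proof. by move=> iX; exact: (integrableZl measurableT c iX). Qed.

Lemma ExD X Y : intg X -> intg Y -> Ex (fun w => X w + Y w) = Ex X + Ex Y.
Proof. by move=> iX iY; exact: RintegralD. Qed.

Lemma ExB X Y : intg X -> intg Y -> Ex (fun w => X w - Y w) = Ex X - Ex Y.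
Proof. by move=> iX iY; exact: RintegralB. Qed.

Lemma ExZ (c : R) X : intg X -> Ex (fun w => c * X w) = c * Ex X.
Proof. by move=> iX; exact: RintegralZl. Qed.

Lemma le_Ex X Y : intg X -> intg Y -> (forall w, X w <= Y w) -> Ex X <= Ex Y.
Proof. by move=> iX iY XY; apply: le_Rintegral. Qed.

Lemma intg_sum (I : Type) (s : seq I) (X : I -> T -> R) :
  (forall i, intg (X i)) -> intg (fun w => \sum_(i <- s) X i w).
Proof.
move=> iX; elim: s => [|i s IH].
  by under eq_fun do rewrite big_nil; exact: (intg_cst 0).
by under eq_fun do rewrite big_cons; exact: intgD.
Qed.

Lemma Ex_sum (I : Type) (s : seq I) (X : I -> T -> R) :
  (forall i, intg (X i)) ->
  Ex (fun w => \sum_(i <- s) X i w) = \sum_(i <- s) Ex (X i).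
Proof.
move=> iX; elim: s => [|i s IH].
  by under eq_fun do rewrite big_nil; rewrite big_nil; exact: (Ex_cst 0).
under eq_fun do rewrite big_cons.
by rewrite ExD// ?big_cons ?IH//; exact: intg_sum.
Qed.

Lemma le_intg X Y : measurable_fun setT X -> intg Y ->
  (forall w, `|X w| <= Y w) -> intg X.
Proof.
move=> mX iY XY; apply: (le_integrable measurableT _ _ iY).
  exact/measurable_EFinP.
by move=> w _; rewrite /= lee_fin (le_trans (XY w))// ler_norm.
Qed.

Lemma intg_bounded X (M : R) : measurable_fun setT X ->
  (forall w, `|X w| <= M) -> intg X.
Proof. by move=> mX bX; exact: (le_intg mX (intg_cst M)). Qed.

Lemma intgM_bounded X Y (M : R) : measurable_fun setT X ->
  (forall w, `|X w| <= M) -> intg Y -> intg (fun w => X w * Y w).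
Proof.
move=> mX bX iY; have mY := intg_measurable iY.
apply: (@le_intg _ (fun w => M * `|Y w|)); first exact: measurable_funM.
  apply: intgZ; apply: intgP; first exact: measurableT_comp.
  by under eq_integral do rewrite normr_id; exact: intg_abs.
by move=> w; rewrite normrM ler_wpM2r.
Qed.

Lemma bound_ge0 X (M : R) : (forall w, `|X w| <= M) -> 0 <= M.
Proof.
move=> bX; have [w _] : [set: T] !=set0.
  apply/set0P/eqP => T0; have := probability_setT P.
  by rewrite T0 measure0 => /esym/eqP; rewrite onee_eq0.
exact: le_trans (bX w).
Qed.

Lemma E2_ge0 X : (0 <= E2 X)%E.
Proof. by apply: integral_ge0 => w _; rewrite lee_fin sqr_ge0. Qed.

Lemma measurable_EFin_sqr X : measurable_fun setT X ->
  measurable_fun setT (fun w => ((X w) ^+ 2)%:E).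
Proof. by move=> mX; apply/measurable_EFinP; exact: measurable_funX. Qed.

Lemma E2_cst (c : R) : E2 (cst c) = (c ^+ 2)%:E.
Proof. by rewrite /E2 /= integral_P_cst. Qed.

Lemma le_E2 X Y : measurable_fun setT X -> measurable_fun setT Y ->
  (forall w, `|X w| <= `|Y w|) -> (E2 X <= E2 Y)%E.
Proof.
move=> mX mY XY; apply: ge0_le_integral => //.
- by move=> w _; rewrite lee_fin sqr_ge0.
- exact: measurable_EFin_sqr.
- exact: measurable_EFin_sqr.
- move=> w _; rewrite lee_fin -(real_normK (num_real (X w))).
  by rewrite -(real_normK (num_real (Y w))) lerXn2r// nnegrE.
Qed.

Lemma E2Z (c : R) X : measurable_fun setT X ->
  E2 (fun w => c * X w) = ((c ^+ 2)%:E * E2 X)%E.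
Proof.
move=> mX; rewrite /E2 -ge0_integralZl//.
- by apply: eq_integral => w _; rewrite -EFinM exprMn.
- exact: measurable_EFin_sqr.
- by move=> w _; rewrite lee_fin sqr_ge0.
- by rewrite lee_fin sqr_ge0.
Qed.

Lemma E2N X : E2 (fun w => - X w) = E2 X.
Proof. by apply: eq_integral => w _; rewrite sqrrN. Qed.

Lemma E2D X Y : measurable_fun setT X -> measurable_fun setT Y ->
  (E2 (fun w => X w + Y w)%R <= 2%:E * E2 X + 2%:E * E2 Y)%E.
Proof.
have twice Z : measurable_fun setT Z ->
    (2%:E * E2 Z = \int[P]_w (2%:E * (Z w ^+ 2)%:E))%E.
  move=> mZ; rewrite ge0_integralZl//; first exact: measurable_EFin_sqr.
  by move=> w _; rewrite lee_fin sqr_ge0.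
move=> mX mY; rewrite !twice//.
rewrite -ge0_integralD//; last 4 first.
- by move=> w _; rewrite -EFinM lee_fin mulr_ge0 ?sqr_ge0.
- by apply: emeasurable_funM => //; exact: measurable_EFin_sqr.
- by move=> w _; rewrite -EFinM lee_fin mulr_ge0 ?sqr_ge0.
- by apply: emeasurable_funM => //; exact: measurable_EFin_sqr.
apply: ge0_le_integral => //.
- by move=> w _; rewrite lee_fin sqr_ge0.
- by apply: measurable_EFin_sqr; exact: measurable_funD.
- by apply: emeasurable_funD; apply: emeasurable_funM => //;
    exact: measurable_EFin_sqr.
- move=> w _; rewrite -!EFinM -EFinD lee_fin.
  by have := sqr_ge0 (X w - Y w); nra.
Qed.

Lemma E2B X Y : measurable_fun setT X -> measurable_fun setT Y ->
  (E2 (fun w => X w - Y w)%R <= 2%:E * E2 X + 2%:E * E2 Y)%E.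
Proof.
move=> mX mY; rewrite -(E2N Y); apply: E2D => //.
exact: measurableT_comp.
Qed.

Lemma intg_sqr X : measurable_fun setT X -> (E2 X < +oo)%E ->
  intg (fun w => X w ^+ 2).
Proof.
move=> mX fX; apply: intgP; first exact: measurable_funX.
rewrite [ltLHS](_ : _ = E2 X)//; apply: eq_integral => w _.
by rewrite ger0_norm// sqr_ge0.
Qed.

Lemma E2E X : intg (fun w => X w ^+ 2) -> E2 X = (Ex (fun w => X w ^+ 2))%:E.
Proof. by move=> iX; rewrite -intgE. Qed.

Lemma E2_lty X : intg (fun w => X w ^+ 2) -> (E2 X < +oo)%E.
Proof. by move=> iX; rewrite E2E// ltry. Qed.

Lemma intg_of_sqr X : measurable_fun setT X -> (E2 X < +oo)%E -> intg X.
Proof.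
move=> mX fX.
apply: (le_intg mX (intgD (intg_cst 1) (intg_sqr mX fX))) => w /=.
rewrite -(real_normK (num_real (X w))).
by have := normr_ge0 (X w); nra.
Qed.

(** The joint law of X and Y agrees with the product of their laws on rectangles,
hence everywhere, and Fubini's theorem factors the expectation. *)
Lemma indep_mul X Y : intg X -> intg Y ->
  (forall C D : set R, measurable C -> measurable D ->
    P (X @^-1` C `&` Y @^-1` D) = (P (X @^-1` C) * P (Y @^-1` D))%E) ->
  intg (fun w => X w * Y w) /\ Ex (fun w => X w * Y w) = Ex X * Ex Y.
Proof.
move=> iX iY indep.
have mX := intg_measurable iX; have mY := intg_measurable iY.
pose XM : {mfun T >-> R} := HB.pack X (isMeasurableFun.Build _ _ _ _ _ mX).
pose YM : {mfun T >-> R} := HB.pack Y (isMeasurableFun.Build _ _ _ _ _ mY).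
pose Z w := (X w, Y w).
have mZ : measurable_fun setT Z by exact: measurable_fun_pair.
pose ZM : {mfun T >-> (R * R)%type} := HB.pack Z (isMeasurableFun.Build _ _ _ _ _ mZ).
pose mu1 := distribution P XM; pose mu2 := distribution P YM.
have law (A : set (R * R)) : measurable A -> (mu1 \x mu2)%E A = distribution P ZM A.
  move=> mA; apply: product_measure_unique => // C D mC mD /=.
pose f (z : R * R) := (z.1 * z.2)%:E.
have mf : measurable_fun setT f.
  by apply/measurable_EFinP; apply: measurable_funM;
    [exact: measurable_fst|exact: measurable_snd].
have intf : (mu1 \x mu2)%E.-integrable setT f.
  apply/integrable12ltyP => //.
  rewrite (eq_integral (fun x : R => `|x|%:E * (\int[mu2]_y `|y|%:E))%E); last first.
    move=> x _; rewrite -ge0_integralZl//; last 1 first.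
    - by apply/measurable_EFinP; exact: (measurable_normX 1).
    by apply: eq_integral => y _; rewrite /f /= normrM EFinM.
  have i2 : (\int[mu2]_y `|y|%:E < +oo)%E.
    rewrite ge0_integral_distribution//; first exact: intg_abs.
    by apply/measurable_EFinP; exact: (measurable_normX 1).
  rewrite ge0_integralZr//; last 2 first.
  - by apply/measurable_EFinP; exact: (measurable_normX 1).
  - by apply: integral_ge0.
  rewrite lte_mul_pinfty ?integral_ge0//.
  - rewrite ge0_fin_numE ?integral_ge0//.
    rewrite ge0_integral_distribution//; first exact: intg_abs.
    by apply/measurable_EFinP; exact: (measurable_normX 1).
have iXY : intg (fun w => X w * Y w).
  apply: intgP; first exact: measurable_funM.
  have -> : (\int[P]_w `|X w * Y w|%:E)%E = (\int[distribution P ZM]_z `|f z|)%E.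
    by rewrite ge0_integral_distribution//; exact: measurableT_comp.
  rewrite (eq_measure_integral (mu1 \x mu2)%E); last first.
    by move=> A mA _ /=; rewrite law.
  by have /integrableP[] := intf.
split => //.
apply: EFin_inj; rewrite -intgE// EFinM -!intgE//.
have -> : (\int[P]_w (X w * Y w)%:E)%E = (\int[distribution P ZM]_z f z)%E.
  by rewrite integral_distribution.
rewrite (eq_measure_integral (mu1 \x mu2)%E); last first.
  by move=> A mA _ /=; rewrite law.
rewrite -integral12_prod_meas1//.
have -> : (\int[P]_w (X w)%:E)%E = (\int[mu1]_x x%:E)%E.
  by rewrite integral_distribution//; exact/measurable_EFinP.
have -> : (\int[P]_w (Y w)%:E)%E = (\int[mu2]_x x%:E)%E.
  by rewrite integral_distribution//; exact/measurable_EFinP.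
have i1 : mu1.-integrable setT (fun x : R => x%:E).
  by apply: integrable_pushforward => //; exact/measurable_EFinP.
have i2 : mu2.-integrable setT (fun x : R => x%:E).
  by apply: integrable_pushforward => //; exact/measurable_EFinP.
rewrite -[X in (_ * X)%E]fineK; last exact: integrable_fin_num.
rewrite -integralZr//; apply: eq_integral => x _.
rewrite /fubini_F fineK; last exact: integrable_fin_num.
by rewrite -integralZl.
Qed.

End expectation.

Section gaussian_law.
Context {R : realType} {d : measure_display} {T : measurableType d}.
Variable P : probability T R.
Variables (X : T -> R) (s : R).
Hypothesis s0 : 0 < s.
Hypothesis mX : measurable_fun setT X.
Hypothesis lawX : forall C : set R, measurable C ->
  P (X @^-1` C) = normal_prob 0 s C.

Lemma gaussian_normr k :
  (\int[P]_w (`|X w| ^+ k)%:E = (s ^+ k)%:E * @normal_moment R k)%E.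
Proof.
have mX' : measurable_fun setT (X : T -> measurableTypeR R) := mX.
pose XM : {mfun T >-> measurableTypeR R} :=
  HB.pack (X : T -> measurableTypeR R) (isMeasurableFun.Build _ _ _ _ _ mX').
rewrite -normal_moment_scale//.
transitivity (\int[distribution P XM]_x (`|x| ^+ k)%:E)%E.
  rewrite ge0_integral_distribution//.
  by apply/measurable_EFinP; exact: measurable_normX.
refine (@eq_measure_integral _ (measurableTypeR R) R setT
  (normal_prob 0 s) (distribution P XM) _ _) => A mA _; exact: lawX.
Qed.

Lemma gaussian_intgX k : (k <= 4)%N -> intg P (fun w => X w ^+ k).
Proof.
move=> k4; apply: intgP; first exact: measurable_funX.
under eq_integral do rewrite normrX.
by rewrite gaussian_normr lte_mul_pinfty ?lee_fin ?exprn_ge0 ?(ltW s0)//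
  normal_moment_lty.
Qed.

Lemma gaussian_even k : (k <= 2)%N ->
  Ex P (fun w => X w ^+ k.*2) = s ^+ k.*2 * fine (@normal_moment R k.*2).
Proof.
move=> k2; have k4 : (k.*2 <= 4)%N by rewrite -(leq_double k 2) in k2.
apply: EFin_inj; rewrite -intgE; last exact: gaussian_intgX.
rewrite EFinM fineK; last first.
  by rewrite ge0_fin_numE ?normal_moment_ge0// normal_moment_lty.
rewrite -gaussian_normr; apply: eq_integral => w _; congr EFin.
by rewrite -normrX ger0_norm// -mul2n exprM exprn_ge0// sqr_ge0.
Qed.

Lemma gaussian_mean : Ex P X = 0.
Proof.
apply: EFin_inj; rewrite -intgE; last exact: (@gaussian_intgX 1).
have mX' : measurable_fun setT (X : T -> measurableTypeR R) := mX.
pose XM : {mfun T >-> measurableTypeR R} :=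
  HB.pack (X : T -> measurableTypeR R) (isMeasurableFun.Build _ _ _ _ _ mX').
transitivity (\int[distribution P XM]_x x%:E)%E.
  by rewrite integral_distribution//; exact: (@gaussian_intgX 1).
transitivity (\int[normal_prob 0 s]_x x%:E)%E; last exact: normal_mean0.
refine (@eq_measure_integral _ (measurableTypeR R) R setT
  (normal_prob 0 s) (distribution P XM) _ _) => A mA _; exact: lawX.
Qed.

End gaussian_law.

(** * The Brownian filtration *)

Section brownian_filtration_theory.
Context {R : realType} {d : measure_display} {T : measurableType d}.
Variable P : probability T R.

Lemma sigma_process_sub (D D' : set R) (W : R -> T -> R) : D `<=` D' ->
  sigma_process D W `<=` sigma_process D' W.
Proof.
move=> DD'; apply: sub_smallest2r; first exact: smallest_sigma_algebra.
exact: bigcup_subset.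
Qed.

Lemma sigma_process_preimage (D : set R) (W : R -> T -> R) s (C : set R) :
  D s -> measurable C -> sigma_process D W (W s @^-1` C).
Proof.
move=> Ds mC; apply: sub_sigma_algebra; exists s => //.
by exists C => //; rewrite setTI.
Qed.

Lemma sigma_process_measurable (D : set R) (W : R -> T -> R) :
  (forall s, D s -> measurable_fun setT (W s)) ->
  sigma_process D W `<=` measurable.
Proof.
move=> mW; apply: smallest_sub; first exact: sigma_algebra_measurable.
by move=> _ [s Ds [C mC <-]]; exact: mW.
Qed.

Context {I : choiceType}.
Variable B : I -> R -> T -> R.
Hypothesis HB : brownian_field P B.
Local Notation F := (brownian_filtration P B).

Definition filtration_generator (t : R) : set_system T :=
  \bigcup_x sigma_process `[0, t] (B x) `|` [set N | measurable N /\ P N = 0].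

(** Adaptedness is measurability for the sigma-algebra of the past taken as the
structure of a type, which gives it the closure properties of measurable
functions. *)
Lemma sub_measurableP t (X : T -> R) : sub_measurable (F t) X <->
  measurable_fun setT (X : g_sigma_algebraType (filtration_generator t) -> R).
Proof.
split=> [FX _ C mC|mX C mC]; first by rewrite setTI; exact: FX.
by rewrite -[X in F t X]setTI; apply: mX.
Qed.

Lemma brownian_filtration_sub s t : s <= t -> F s `<=` F t.
Proof.
move=> st; apply: sub_smallest2r; first exact: smallest_sigma_algebra.
move=> A [[x _ FA]|nA]; [left|by right].
by exists x => //; apply: sigma_process_sub FA; exact: subset_itvl.
Qed.

Lemma sub_measurable_mono s t (X : T -> R) : s <= t -> sub_measurable (F s) X ->
  sub_measurable (F t) X.
Proof. by move=> st FX C mC; apply: (brownian_filtration_sub st); exact: FX. Qed.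

Lemma brownian_measurable x t : 0 <= t -> measurable_fun setT (B x t).
Proof. by move=> t0; exact: (BM_measurable (HB.1 x)). Qed.

Lemma brownian_past_measurable x t : sigma_process `[0, t] (B x) `<=` measurable.
Proof.
apply: sigma_process_measurable => s /=; rewrite in_itv/= => /andP[s0 _].
exact: brownian_measurable.
Qed.

Lemma filtration_generator_measurable t : filtration_generator t `<=` measurable.
Proof. by move=> A [[x _]|[]//]; exact: brownian_past_measurable. Qed.

Lemma brownian_filtration_measurable t : F t `<=` measurable.
Proof.
apply: smallest_sub; first exact: sigma_algebra_measurable.
exact: filtration_generator_measurable.
Qed.

Lemma sub_measurable_measurable t (X : T -> R) : sub_measurable (F t) X ->
  measurable_fun setT X.
Proof.
by move=> FX _ C mC; rewrite setTI; apply: brownian_filtration_measurable;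
  exact: FX.
Qed.

Lemma brownian_adapted x s t : 0 <= s <= t -> sub_measurable (F t) (B x s).
Proof.
move=> st C mC; apply: sub_sigma_algebra; left; exists x => //.
exact: sigma_process_preimage.
Qed.

Lemma increment_measurable x (s t : R) : 0 <= s -> s <= t ->
  measurable_fun setT (increment (B x) s t).
Proof.
move=> s0 st; apply: measurable_funB; apply: brownian_measurable => //.
exact: le_trans st.
Qed.

(** The events of the past that are finite intersections of events, each about a
single Brownian motion. *)
Let cylinder (s : R) : set_system T := [set A | exists (J : {fset I}) (C : I -> set T),
  (forall i, i \in J -> sigma_process `[0, s] (B i) (C i)) /\
  A = \bigcap_(i in [set` J]) C i].

Let cylinder_setI s : setI_closed (cylinder s).
Proof.
move=> _ _ [J [C [FC ->]]] [J' [C' [FC' ->]]].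
pose D i := (if i \in J then C i else setT) `&` (if i \in J' then C' i else setT).
exists (J `|` J')%fset, D; split.
  move=> i _; rewrite /D.
  pose S := g_sigma_algebraType (\bigcup_(r in `[0, s])
    preimage_set_system setT (B i r) measurable).
  apply: (@measurableI _ S).
    by case: ifPn => [/FC//|_]; exact: (@measurableT _ S).
  by case: ifPn => [/FC'//|_]; exact: (@measurableT _ S).
apply/seteqP; split => w.
  move=> [Cw C'w] i _; split; case: ifPn => // iJ; [exact: Cw|exact: C'w].
move=> Dw; split => i /= iJ.
  by have [] := Dw i; rewrite ?iJ //= in_fsetU iJ.
by have [] := Dw i; rewrite ?iJ //= in_fsetU iJ orbT.
Qed.

Let cylinder_measurable s : cylinder s `<=` measurable.
Proof.
move=> _ [J [C [FC ->]]]; apply: fin_bigcap_measurable => // i iJ.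
by apply: brownian_past_measurable; exact: FC.
Qed.

(** The factor about B x, if there is one, absorbs the increment; the independence
of the field is applied with and without the increment. *)
Let cylinder_indep (s t : R) x A (C : set R) : 0 <= s -> s < t -> cylinder s A -> measurable C ->
  P (A `&` increment (B x) s t @^-1` C) =
  (P A * P (increment (B x) s t @^-1` C))%E.
Proof.
move=> s0 st [J [D [FD ->]]] mC; set E := increment _ _ _ @^-1` C.
have [HBM ind] := HB.
pose D' i := if i \in J then D i else setT.
have FD' i : sigma_process `[0, s] (B i) (D' i).
  rewrite /D'; case: ifPn => [/FD//|_].
  exact: (@measurableT _ (g_sigma_algebraType (\bigcup_(r in `[0, s])
    preimage_set_system setT (B i r) measurable))).
pose J' := (x |` J)%fset.
have toJ' : \bigcap_(i in [set` J]) D i = \bigcap_(i in [set` J']) D' i.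
  apply/seteqP; split => w Dw i /= iJ.
    by rewrite /D'; case: ifPn => // /Dw.
  by have := Dw i; rewrite /D' /= in_fsetU iJ orbT; exact.
have future i : sigma_process `[0, s] (B i) `<=` sigma_process `[0, +oo[ (B i).
  by apply: sigma_process_sub; exact: subset_itvl.
have xJ' : x \in J' by rewrite in_fsetU in_fset1 eqxx.
pose D2 i := if i == x then D' x `&` E else D' i.
have FE : sigma_process `[0, +oo[ (B x) E.
  pose S := g_sigma_algebraType (\bigcup_(r in `[0, +oo[)
    preimage_set_system setT (B x r) measurable).
  have mB r : 0 <= r -> measurable_fun setT (B x r : S -> R).
    by move=> r0 _ G mG; rewrite setTI; apply: sigma_process_preimage => //=;
      rewrite in_itv/= r0.
  have mI : measurable_fun setT (increment (B x) s t : S -> R).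
    by apply: measurable_funB; apply: mB => //; rewrite (le_trans s0)// ltW.
  by have := mI measurableT _ mC; rewrite setTI.
have -> : \bigcap_(i in [set` J]) D i `&` E = \bigcap_(i in [set` J']) D2 i.
  rewrite toJ'; apply/seteqP; split => w.
    move=> [Dw Ew] i iJ; rewrite /D2; case: eqP => [_|_]; last exact: Dw.
    by split => //; exact: Dw.
  move=> Dw; split => [i iJ|].
    by have := Dw i iJ; rewrite /D2; case: eqP => [->|//] [].
  by have := Dw x xJ'; rewrite /D2 eqxx => -[].
rewrite toJ' ind => [|i _]; last first.
  rewrite /D2; case: eqP => [->|_]; last exact: future.
  apply: (@measurableI _ (g_sigma_algebraType (\bigcup_(r in `[0, +oo[)
    preimage_set_system setT (B x r) measurable))) => //.
  exact: future.
rewrite ind => [|i _]; last exact: future.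
rewrite (big_fsetD1 x)//= [in RHS](big_fsetD1 x)//= /D2 eqxx.
rewrite (BM_independent_increments (HBM x))//.
have fin A' : measurable A' -> P A' \is a fin_num by move=> ?; exact: fin_num_measure.
have mE : measurable E.
  by have := increment_measurable x s0 (ltW st) measurableT mC; rewrite setTI.
have mD' : measurable (D' x) by apply: brownian_past_measurable; exact: FD'.
rewrite fineM ?fin// -[P E in RHS]fineK ?fin// -EFinM; congr EFin.
rewrite mulrAC; congr (_ * _ * _).
by apply: eq_fbigr => i; rewrite !inE => /andP[/negbTE ->].
Qed.

Definition indep_of (G : set_system T) (X : T -> R) :=
  forall A C, G A -> measurable C -> P (A `&` X @^-1` C) = (P A * P (X @^-1` C))%E.

(** The cylinder events and the null sets form a pi-system that generates F s. On
cylinder events the claim combines the independence of the field with the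
independence of the increments of B x; both sides are finite measures in the
past event, so that they agree on all of F s. *)
Lemma increment_indep x (s t : R) : 0 <= s -> s < t ->
  indep_of (F s) (increment (B x) s t).
Proof.
move=> s0 st A C FA mC; set E := increment _ _ _ @^-1` C.
have mE : measurable E.
  by have := increment_measurable x s0 (ltW st) measurableT mC; rewrite setTI.
pose G : set_system T := cylinder s `|` [set N | measurable N /\ P N = 0%E].
have FG : F s = <<s G >>.
  apply/seteqP; split.
    apply: smallest_sub; first exact: smallest_sigma_algebra.
    move=> D [[y _ FD]|nD]; apply: sub_sigma_algebra; [left|by right].
    exists [fset y]%fset, (fun=> D); split.
      by move=> i; rewrite in_fset1 => /eqP ->.
    apply/seteqP; split => [w Dw i _ //|w Dw]; apply: (Dw y) => /=.
    by rewrite in_fset1 eqxx.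
  apply: smallest_sub; first exact: smallest_sigma_algebra.
  move=> D [[J [D' [FD' ->]]]|nD]; last by apply: sub_sigma_algebra; right.
  apply: (@fin_bigcap_measurable _ (g_sigma_algebraType (filtration_generator s))).
    exact: finite_fset.
  by move=> i /= iJ; apply: sub_sigma_algebra; left; exists i => //; exact: FD'.
have Gm : G `<=` measurable by move=> D [/cylinder_measurable|[]].
have null D N : measurable D -> measurable N -> P N = 0%E -> P (N `&` D) = 0%E.
  move=> mD mN N0; apply/eqP; rewrite eq_le measure_ge0 andbT -N0.
  by rewrite le_measure// ?inE//; exact: measurableI.
pose pE := fine (P E).
have pE0 : 0 <= pE by rewrite fine_ge0.
have PE : P E = pE%:E by rewrite /pE fineK// fin_num_measure.
pose m1 := mrestr P mE.
pose m2 := mscale (NngNum pE0) P.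
suff -> : P (A `&` E) = m1 A.
  suff -> : m1 A = m2 A by rewrite /m2 /mscale/= PE muleC.
  apply: (g_sigma_algebra_measure_unique G Gm (fun=> setT)) => //.
  - by move=> _; left; exists fset0, (fun=> setT); split => //;
      apply/seteqP; split.
  - by apply/seteqP; split => // w _; exists 0%N.
  - move=> D D' [cD|[mD D0]] [cD'|[mD' D'0]].
    + by left; exact: cylinder_setI.
    + right; split; first by apply: measurableI => //; exact: cylinder_measurable cD.
      by rewrite setIC; apply: null => //; exact: cylinder_measurable cD.
    + right; split; first by apply: measurableI => //; exact: cylinder_measurable cD'.
      by apply: null => //; exact: cylinder_measurable cD'.
    + by right; split; [exact: measurableI|exact: null].
  - move=> D [cD|[mD D0]].
      rewrite -[LHS]/(P (D `&` E)) -[RHS]/(pE%:E * P D)%E -PE muleC.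
      exact: cylinder_indep.
    rewrite -[LHS]/(P (D `&` E)) -[RHS]/(pE%:E * P D)%E D0 mule0.
    exact: null.
  - by move=> _; rewrite -[ltLHS]/(P (setT `&` E)) setTI PE ltry.
  - by rewrite -FG.
by [].
Qed.

End brownian_filtration_theory.

(** * The Ito isometry for step processes *)

Section ito_isometry.
Context {R : realType} {d : measure_display} {T : measurableType d}.
Variable P : probability T R.
Context {I : choiceType}.
Variable B : I -> R -> T -> R.
Hypothesis HB : brownian_field P B.
Local Notation F := (brownian_filtration P B).
Local Notation intg := (intg P).
Local Notation Ex := (Ex P).
Local Notation E2 := (E2 P).
Local Notation dB x := (increment (B x)).

(** The constant in the isometry: the variance of the standard normal law. *)
Definition normal_second : R := fine (@normal_moment R 2).
Definition normal_fourth : R := fine (@normal_moment R 4).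
Local Notation kappa := normal_second.

Lemma normal_second_ge0 : 0 <= kappa.
Proof. by rewrite fine_ge0// normal_moment_ge0. Qed.

Lemma normal_fourth_ge0 : 0 <= normal_fourth.
Proof. by rewrite fine_ge0// normal_moment_ge0. Qed.

Lemma sub_measurableM t (X Y : T -> R) : sub_measurable (F t) X ->
  sub_measurable (F t) Y -> sub_measurable (F t) (fun w => X w * Y w).
Proof.
move=> /sub_measurableP mX /sub_measurableP mY; apply/sub_measurableP.
exact: measurable_funM.
Qed.

Lemma sub_measurableB t (X Y : T -> R) : sub_measurable (F t) X ->
  sub_measurable (F t) Y -> sub_measurable (F t) (fun w => X w - Y w).
Proof.
move=> /sub_measurableP mX /sub_measurableP mY; apply/sub_measurableP.
exact: measurable_funB.
Qed.

Lemma sub_measurable_cst t (c : R) : sub_measurable (F t) (cst c).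
Proof. by apply/sub_measurableP; exact: measurable_cst. Qed.

Lemma increment_adapted x (s t u : R) : 0 <= s -> s <= t -> t <= u ->
  sub_measurable (F u) (dB x s t).
Proof.
move=> s0 st tu; apply: sub_measurableB; apply: brownian_adapted.
  by rewrite (le_trans s0 st).
by rewrite s0 (le_trans st tu).
Qed.

Lemma increment0 x s : dB x s s = cst 0.
Proof. by apply/funext => w; rewrite /increment subrr. Qed.

Let law x (s t : R) : 0 <= s -> s < t -> forall C : set R, measurable C ->
  P (dB x s t @^-1` C) = normal_prob 0 (Num.sqrt (t - s)) C.
Proof. by move=> s0 st C mC; apply: (BM_gaussian (HB.1 x)). Qed.

Let sq_gt0 (s t : R) : s < t -> 0 < Num.sqrt (t - s).
Proof. by move=> st; rewrite sqrtr_gt0 subr_gt0. Qed.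

Lemma increment_intgX x (s t : R) k : 0 <= s -> s <= t -> (k <= 4)%N ->
  intg (fun w => dB x s t w ^+ k).
Proof.
move=> s0; rewrite le_eqVlt => /predU1P[<-|st] k4.
  by rewrite increment0; exact: (intg_cst P (0 ^+ k)).
apply: (gaussian_intgX (sq_gt0 st)) => //.
  by apply: (increment_measurable HB) => //; exact: ltW.
exact: law.
Qed.

Lemma increment_mulX x (s t : R) k (Z : T -> R) : 0 <= s -> s < t -> (k <= 4)%N ->
  sub_measurable (F s) Z -> intg Z ->
  intg (fun w => Z w * dB x s t w ^+ k) /\
  Ex (fun w => Z w * dB x s t w ^+ k) = Ex Z * Ex (fun w => dB x s t w ^+ k).
Proof.
move=> s0 st k4 FZ iZ; apply: indep_mul => //.
  by apply: increment_intgX => //; exact: ltW.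
move=> C D mC mD.
have mX : measurable_fun setT (fun y : R => y ^+ k).
  by apply: continuous_measurable_fun; exact: exprn_continuous.
have mD' : measurable ((fun y : R => y ^+ k) @^-1` D).
  by rewrite -[X in measurable X]setTI; exact: mX.
have := increment_indep HB x s0 st (FZ _ mC) mD'.
by apply.
Qed.

Lemma increment_mean x (s t : R) (Z : T -> R) : 0 <= s -> s <= t ->
  sub_measurable (F s) Z -> intg Z ->
  intg (fun w => Z w * dB x s t w) /\ Ex (fun w => Z w * dB x s t w) = 0.
Proof.
move=> s0; rewrite le_eqVlt => /predU1P[<-|st] FZ iZ.
  have -> : (fun w => Z w * dB x s s w) = cst 0.
    by apply/funext => w; rewrite increment0 mulr0.
  by split; [exact: intg_cst|rewrite Ex_cst].
have [iZB EZB] := @increment_mulX x s t 1 Z s0 st isT FZ iZ.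
split; first exact: iZB.
rewrite [LHS]EZB; have := gaussian_mean (sq_gt0 st) _ (law x s0 st).
move=> -> //; first by rewrite mulr0.
by apply: (increment_measurable HB) => //; exact: ltW.
Qed.

Lemma increment_even x (s t : R) k (Z : T -> R) : 0 <= s -> s <= t ->
  (0 < k <= 2)%N -> sub_measurable (F s) Z -> intg Z ->
  intg (fun w => Z w * dB x s t w ^+ k.*2) /\
  Ex (fun w => Z w * dB x s t w ^+ k.*2) =
    fine (@normal_moment R k.*2) * (t - s) ^+ k * Ex Z.
Proof.
move=> s0 + /andP[k0 k2]; rewrite le_eqVlt => /predU1P[<-|st] FZ iZ.
  have -> : (fun w => Z w * dB x s s w ^+ k.*2) = cst 0.
    apply/funext => w; rewrite increment0 expr0n double_eq0 (gtn_eqF k0).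
    by rewrite mulr0.
  rewrite subrr expr0n (gtn_eqF k0) mulr0 mul0r.
  by split; [exact: intg_cst|rewrite Ex_cst].
have k4 : (k.*2 <= 4)%N by rewrite -(leq_double k 2) in k2.
have [iZB EZB] := @increment_mulX x s t k.*2 Z s0 st k4 FZ iZ.
split => //; rewrite EZB (gaussian_even (sq_gt0 st) _ (law x s0 st))//.
  rewrite -mul2n exprM sqr_sqrtr; first by rewrite mulrC (mulrC (_ ^+ _)).
  by rewrite subr_ge0 ltW.
by apply: (increment_measurable HB) => //; exact: ltW.
Qed.

Lemma increment_sq x (s t : R) (Z : T -> R) : 0 <= s -> s <= t ->
  sub_measurable (F s) Z -> intg Z ->
  intg (fun w => Z w * dB x s t w ^+ 2) /\
  Ex (fun w => Z w * dB x s t w ^+ 2) = kappa * (t - s) * Ex Z.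
Proof. by move=> s0 st FZ iZ; exact: (@increment_even x s t 1 Z). Qed.

(** The process equal to height on ]left, right]; a simple process is a sum
of such pieces, and so is the difference of two simple processes, whatever
their partitions. *)
Record piece (lo hi : R) := Piece {
  left_end : R ;
  right_end : R ;
  height : T -> R ;
  piece_lo : lo <= left_end ;
  piece_ends : left_end <= right_end ;
  piece_hi : right_end <= hi ;
  piece_adapted : sub_measurable (F left_end) height ;
  piece_bounded : exists M : R, forall w, `|height w| <= M }.

Definition piece_integral x lo hi (e : piece lo hi) (w : T) : R :=
  height e w * dB x (left_end e) (right_end e) w.

Definition piece_set lo hi (e : piece lo hi) : set R :=
  `]left_end e, right_end e].

Definition piece_val lo hi (e : piece lo hi) (r : R) (w : T) : R :=
  height e w * \1_(piece_set e) r.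

Definition sum_integral x lo hi (L : seq (piece lo hi)) (w : T) : R :=
  \sum_(e <- L) piece_integral x e w.

Definition sum_val lo hi (L : seq (piece lo hi)) (r : R) (w : T) : R :=
  \sum_(e <- L) piece_val e r w.

(** The length of the intersection of the two time intervals. *)
Definition overlap lo hi (e f : piece lo hi) : R :=
  Num.max 0 (Num.min (right_end e) (right_end f) -
             Num.max (left_end e) (left_end f)).

Section pieces.
Variables (lo hi : R).
Hypothesis lo0 : 0 <= lo.
Implicit Types (e f : piece lo hi) (L : seq (piece lo hi)).

Lemma height_measurable e : measurable_fun setT (height e).
Proof. by apply: (sub_measurable_measurable HB); exact: piece_adapted. Qed.

Lemma height_intg e : intg (height e).
Proof.
by have [M hM] := piece_bounded e; apply: (intg_bounded P _ hM);
  exact: height_measurable.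
Qed.

Lemma height_mul_intg e (Z : T -> R) : intg Z -> intg (fun w => height e w * Z w).
Proof.
move=> iZ; have [M hM] := piece_bounded e.
exact: (intgM_bounded (height_measurable e) hM).
Qed.

Lemma left_ge0 e : 0 <= left_end e.
Proof. exact: le_trans (piece_lo e). Qed.

Lemma piece_integral_measurable x e : measurable_fun setT (piece_integral x e).
Proof.
apply: measurable_funM; first exact: height_measurable.
by apply: (increment_measurable HB); [exact: left_ge0|exact: piece_ends].
Qed.

Lemma sum_integral_measurable x L : measurable_fun setT (sum_integral x L).
Proof. by apply: measurable_sum => e; exact: piece_integral_measurable. Qed.

(** The increments are cut at the ends of the two intervals. Only the square of
the increment over the common part has a mean; every other product has a factor
that is an increment after the times at which its other factors are known. *)
Let pair_le x e f : left_end e <= left_end f ->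
  intg (fun w => piece_integral x e w * piece_integral x f w) /\
  Ex (fun w => piece_integral x e w * piece_integral x f w) =
    kappa * overlap e f * Ex (fun w => height e w * height f w).
Proof.
move=> ef; rewrite /overlap (max_r ef) /piece_integral.
have e0 := left_ge0 e; have f0 := left_ge0 f.
have eab := piece_ends e; have fab := piece_ends f.
have Fe t : left_end e <= t -> sub_measurable (F t) (height e).
  by move=> et; apply: (sub_measurable_mono et); exact: piece_adapted.
have Ff t : left_end f <= t -> sub_measurable (F t) (height f).
  by move=> et; apply: (sub_measurable_mono et); exact: piece_adapted.
have iX t s : 0 <= t -> t <= s -> intg (dB x t s).
  by move=> t0 ts; exact: (@increment_intgX x t s 1 t0 ts isT).
set a := left_end e in ef e0 eab Fe *; set b := right_end e in eab *.
set a' := left_end f in ef f0 fab Ff *; set b' := right_end f in fab *.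
have iZ u v : 0 <= u -> u <= v ->
    intg (fun w => height e w * height f w * dB x u v w).
  move=> u0 uv; under eq_fun do rewrite -mulrA.
  by apply: height_mul_intg; apply: height_mul_intg; exact: iX.
have [ba'|a'b] := leP b a'.
  rewrite (_ : Num.max _ _ = 0); last first.
    by apply: max_l; rewrite subr_le0 ge_min ba'.
  have -> : (fun w => height e w * dB x a b w * (height f w * dB x a' b' w)) =
      (fun w => height e w * height f w * dB x a b w * dB x a' b' w).
    by apply/funext => w; ring.
  rewrite mulr0 mul0r; apply: increment_mean => //; last exact: iZ.
  apply: sub_measurableM; last exact: increment_adapted.
  by apply: sub_measurableM; [exact: Fe|exact: Ff].
pose m := Num.min b b'; pose M := Num.max b b'.
have a'm : a' <= m by rewrite le_min (ltW a'b) fab.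
have mM : m <= M by rewrite ge_min /M le_max lexx.
rewrite -/m (_ : Num.max _ _ = m - a'); last by apply: max_r; rewrite subr_ge0.
have split_eq w : height e w * dB x a b w * (height f w * dB x a' b' w) =
   height e w * height f w * dB x a a' w * dB x a' b' w +
   (height e w * height f w * dB x a' m w ^+ 2 +
    height e w * height f w * dB x a' m w * dB x m M w).
  rewrite /m /M /increment; case: (leP b b') => _; ring.
have Fef t : a' <= t -> sub_measurable (F t) (fun w => height e w * height f w).
  move=> a't; apply: sub_measurableM; last exact: Ff.
  by apply: Fe; exact: le_trans a't.
have [i1 E1] : intg (fun w => height e w * height f w * dB x a a' w * dB x a' b' w)
    /\ Ex (fun w => height e w * height f w * dB x a a' w * dB x a' b' w) = 0.
  apply: increment_mean => //; last exact: iZ.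
  by apply: sub_measurableM; [exact: Fef|exact: increment_adapted].
have [i3 E3] : intg (fun w => height e w * height f w * dB x a' m w * dB x m M w)
    /\ Ex (fun w => height e w * height f w * dB x a' m w * dB x m M w) = 0.
  apply: increment_mean => //; first exact: le_trans a'm.
    by apply: sub_measurableM; [exact: Fef|exact: increment_adapted].
  exact: iZ.
have [i2 E2'] : intg (fun w => height e w * height f w * dB x a' m w ^+ 2)
    /\ Ex (fun w => height e w * height f w * dB x a' m w ^+ 2) =
       kappa * (m - a') * Ex (fun w => height e w * height f w).
  apply: increment_sq => //; first exact: Fef.
  by apply: height_mul_intg; exact: height_intg.
under eq_fun do rewrite split_eq.
split; first by apply: intgD => //; exact: intgD.
by rewrite ExD ?ExD ?E1 ?E2' ?E3 ?add0r ?addr0//; exact: intgD.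
Qed.

Lemma piece_integral_mul x e f :
  intg (fun w => piece_integral x e w * piece_integral x f w) /\
  Ex (fun w => piece_integral x e w * piece_integral x f w) =
    kappa * overlap e f * Ex (fun w => height e w * height f w).
Proof.
have [ef|/ltW fe] := leP (left_end e) (left_end f); first exact: pair_le.
have [i E] := pair_le x fe.
under eq_fun do rewrite mulrC.
split => //; rewrite E /overlap maxC minC maxC.
by rewrite (maxC (left_end f)); congr (_ * Ex _); apply/funext => w; rewrite mulrC.
Qed.

Lemma sum_integral_sqr x L :
  intg (fun w => sum_integral x L w ^+ 2) /\
  Ex (fun w => sum_integral x L w ^+ 2) =
    \sum_(e <- L) \sum_(f <- L)
      kappa * overlap e f * Ex (fun w => height e w * height f w).
Proof.
have sqE : (fun w => sum_integral x L w ^+ 2) = (fun w =>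
    \sum_(e <- L) \sum_(f <- L) piece_integral x e w * piece_integral x f w).
  by apply/funext => w; rewrite expr2 /sum_integral big_distrlr.
have ij e f : intg (fun w => piece_integral x e w * piece_integral x f w).
  by have [] := piece_integral_mul x e f.
rewrite sqE; split; first by apply: intg_sum => e; exact: intg_sum.
rewrite Ex_sum => [|e]; last exact: intg_sum.
apply: eq_bigr => e _; rewrite Ex_sum//; apply: eq_bigr => f _.
by have [] := piece_integral_mul x e f.
Qed.

Lemma sum_val_sqr L r :
  E2 (sum_val L r) = (\sum_(e <- L) \sum_(f <- L)
    Ex (fun w => height e w * height f w) *
      (\1_(piece_set e) r * \1_(piece_set f) r))%:E.
Proof.
have sqE : (fun w => sum_val L r w ^+ 2) = (fun w =>
    \sum_(e <- L) \sum_(f <- L) (\1_(piece_set e) r * \1_(piece_set f) r) *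
      (height e w * height f w)).
  apply/funext => w; rewrite expr2 /sum_val big_distrlr/=.
  by apply: eq_bigr => e _; apply: eq_bigr => f _; rewrite /piece_val; ring.
have ij e f : intg (fun w => (\1_(piece_set e) r * \1_(piece_set f) r) *
      (height e w * height f w)).
  by apply: intgZ; apply: height_mul_intg; exact: height_intg.
rewrite E2E sqE; last by apply: intg_sum => e; exact: intg_sum.
congr EFin; rewrite Ex_sum => [|e]; last exact: intg_sum.
apply: eq_bigr => e _; rewrite Ex_sum//; apply: eq_bigr => f _.
rewrite ExZ 1?mulrC//; apply: height_mul_intg; exact: height_intg.
Qed.

Lemma piece_set_overlap e f :
  (\int[lebesgue_measure]_(r in `[0%R, hi])
    (\1_(piece_set e) r * \1_(piece_set f) r)%:E = (overlap e f)%:E)%E.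
Proof.
pose J : set R := [set` `]Num.max (left_end e) (left_end f),
                    Num.min (right_end e) (right_end f)]].
have -> : (fun r => (\1_(piece_set e) r * \1_(piece_set f) r)%:E) =
    (fun r => (\1_J r)%:E) :> (R -> \bar R).
  apply/funext => r; congr EFin; rewrite !indicE -natrM mulnb -in_setI.
  congr (_ \in _)%:R; apply/seteqP; split => q /=.
    rewrite /piece_set /J /= !in_itv/= => -[/andP[? ?] /andP[? ?]].
    by rewrite gt_max le_min; apply/andP; split; apply/andP.
  rewrite /piece_set /J /= !in_itv/= gt_max le_min => /andP[/andP[? ?] /andP[? ?]].
  by split; apply/andP.
have mJ : measurable J by exact: measurable_itv.
rewrite integral_indic// setIidl; last first.
  move=> q; rewrite /J /= !in_itv/= gt_max le_min => /andP[/andP[q1 _] /andP[q2 _]].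
  by rewrite (le_trans (left_ge0 e) (ltW q1)) (le_trans q2)// piece_hi.
transitivity (lebesgue_measure J); first by [].
rewrite /J lebesgue_measure_itv /= lte_fin /overlap.
set M := Num.max (left_end e) _; set m := Num.min (right_end e) _.
have [Mm|mM] := ltP M m; rewrite -?EFinD; congr EFin; apply/esym.
  by apply: max_r; rewrite subr_ge0 ltW.
by apply: max_l; rewrite subr_le0.
Qed.

Lemma ito_isometry x L :
  (E2 (sum_integral x L) = kappa%:E *
    \int[lebesgue_measure]_(r in `[0%R, hi]) E2 (sum_val L r))%E.
Proof.
have [i E] := sum_integral_sqr x L.
have mI e : measurable_fun setT (\1_(piece_set e) : R -> R).
  by apply: measurable_indic; exact: measurable_itv.
have i1 e f : (@lebesgue_measure R).-integrable `[0, hi] (fun r =>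
    (\1_(piece_set e) r * \1_(piece_set f) r)%:E).
  apply/integrableP; split.
    apply/measurable_EFinP; apply: measurable_funTS.
    exact: (measurable_funM (mI e) (mI f)).
  under eq_integral => r _ do
    rewrite gee0_abs ?lee_fin ?mulr_ge0 ?indicE ?ler0n//.
  by under eq_integral => r _ do rewrite -!indicE; rewrite piece_set_overlap ltry.
have ib (c : R) e f : (@lebesgue_measure R).-integrable `[0, hi] (fun r =>
    (c * (\1_(piece_set e) r * \1_(piece_set f) r))%:E).
  exact: (@integrableZl _ _ _ (@lebesgue_measure R) _ _ c
    (fun r => (\1_(piece_set e) r * \1_(piece_set f) r)%:E)).
pose q e f := Ex (fun w => height e w * height f w).
have qE e f : (\int[lebesgue_measure]_(r in `[0%R, hi])
    (q e f * (\1_(piece_set e) r * \1_(piece_set f) r))%:E =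
    (q e f * overlap e f)%:E)%E.
  under eq_integral do rewrite EFinM.
  by rewrite integralZl// piece_set_overlap.
rewrite E2E// E.
rewrite (eq_integral (fun r : measurableTypeR R => \sum_(e <- L) \sum_(f <- L)
    (q e f * (\1_(piece_set e) r * \1_(piece_set f) r))%:E)%E); last first.
  move=> r _; rewrite sum_val_sqr -sumEFin; apply: eq_bigr => e _.
  by rewrite sumEFin.
rewrite integral_sum//; last by move=> e; exact: integrable_sum.
under [X in (_ * X)%E]eq_bigr => e _.
  rewrite integral_sum//.
  under eq_bigr do rewrite qE.
  rewrite sumEFin; over.
rewrite sumEFin -EFinM mulr_sumr; congr EFin; apply: eq_bigr => e _.
by rewrite mulr_sumr; apply: eq_bigr => f _; rewrite /q; ring.
Qed.

End pieces.

End ito_isometry.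

(** * Processes and their mean square over a time interval *)

Section processes.
Context {R : realType} {d : measure_display} {T : measurableType d}.
Variable P : probability T R.
Local Notation leb := (@lebesgue_measure R).
Local Notation E2 := (E2 P).
Implicit Types X Y : R -> T -> R.

Definition jointly_measurable X :=
  measurable_fun setT (fun z : measurableTypeR R * T => X z.1 z.2).

Definition time_E2 (lo hi : R) X : \bar R :=
  (\int[leb]_(r in `]lo, hi]) E2 (X r))%E.

Lemma jointly_measurable_section X r : jointly_measurable X ->
  measurable_fun setT (X r).
Proof.
move=> mX; exact: (measurable_fun_pair2 (f := fun z => X z.1 z.2) r mX).
Qed.

Lemma measurable_E2 X : jointly_measurable X ->
  measurable_fun setT (fun r : measurableTypeR R => E2 (X r)).
Proof.
move=> mX; apply: (@measurable_fun_fubini_tonelli_F _ _ (measurableTypeR R) T R P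
  (fun z => (X z.1 z.2 ^+ 2)%:E)).
  by apply/measurable_EFinP; exact: measurable_funX.
by move=> z; rewrite lee_fin sqr_ge0.
Qed.

Lemma jointly_measurableD X Y : jointly_measurable X -> jointly_measurable Y ->
  jointly_measurable (fun r w => X r w + Y r w).
Proof. by move=> mX mY; exact: measurable_funD. Qed.

Lemma jointly_measurableB X Y : jointly_measurable X -> jointly_measurable Y ->
  jointly_measurable (fun r w => X r w - Y r w).
Proof. by move=> mX mY; exact: measurable_funB. Qed.

Lemma jointly_measurable_const (Z : T -> R) : measurable_fun setT Z ->
  jointly_measurable (fun=> Z).
Proof. by move=> mZ; exact: measurableT_comp. Qed.

Lemma time_E2_ge0 lo hi X : (0 <= time_E2 lo hi X)%E.
Proof. by apply: integral_ge0 => r _; exact: E2_ge0. Qed.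

Lemma le_time_E2 lo hi X Y : jointly_measurable X -> jointly_measurable Y ->
  (forall r, lo < r <= hi -> (E2 (X r) <= E2 (Y r))%E) ->
  (time_E2 lo hi X <= time_E2 lo hi Y)%E.
Proof.
move=> mX mY XY; apply: ge0_le_integral => //.
- by move=> r _; exact: E2_ge0.
- by apply: measurable_funTS; exact: measurable_E2.
- by apply: measurable_funTS; exact: measurable_E2.
Qed.

Lemma time_E2_le_cst lo hi X (c : R) : lo <= hi -> jointly_measurable X ->
  (forall r, lo < r <= hi -> (E2 (X r) <= c%:E)%E) ->
  (time_E2 lo hi X <= (c * (hi - lo))%:E)%E.
Proof.
move=> lohi mX Xc.
have [c0|c0] := leP 0 c; last first.
  suff -> : hi = lo.
    by rewrite /time_E2 set_itvoc0 integral_set0 subrr mulr0.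
  apply/eqP; rewrite eq_le lohi andbT leNgt; apply/negP => lh.
  have := Xc hi; rewrite lh lexx => /(_ isT) /(le_trans (E2_ge0 _ _)).
  by rewrite lee_fin leNgt c0.
apply: (@le_trans _ _ (\int[leb]_(r in `]lo, hi]) c%:E)%E).
  apply: ge0_le_integral => //.
  - by move=> r _; exact: E2_ge0.
  - by apply: measurable_funTS; exact: measurable_E2.
have -> : (\int[leb]_(r in `]lo, hi]) c%:E = c%:E * leb `]lo, hi]%classic)%E.
  exact: integral_cst.
rewrite lebesgue_measure_itv/= lte_fin EFinM.
have [h|h] := ltP lo hi; first by rewrite -EFinD.
by rewrite mule0 -EFinM lee_fin mulr_ge0// subr_ge0.
Qed.

Lemma subset_time_E2 lo hi lo' hi' X : lo' <= lo -> hi <= hi' ->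
  jointly_measurable X -> (time_E2 lo hi X <= time_E2 lo' hi' X)%E.
Proof.
move=> lolo hihi mX; apply: ge0_subset_integral => //.
- by apply: measurable_funTS; exact: measurable_E2.
- by move=> r _; exact: E2_ge0.
- move=> r; rewrite /= !in_itv/= => /andP[lor rhi].
  by rewrite (le_lt_trans lolo lor) (le_trans rhi hihi).
Qed.

Lemma time_E2_support lo hi lo' hi' X : lo' <= lo -> hi <= hi' ->
  (forall r, lo' < r <= hi' -> ~~ (lo < r <= hi) -> E2 (X r) = 0%E) ->
  time_E2 lo' hi' X = time_E2 lo hi X.
Proof.
move=> lolo hihi X0; rewrite /time_E2 integral_mkcond [RHS]integral_mkcond.
apply: eq_integral => r _; rewrite !patchE !mem_setE !in_itv/=.
case: ifPn => r'; case: ifPn => // rN.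
  by rewrite X0.
case/negP: r'; move: rN => /andP[lor rhi].
by rewrite (le_lt_trans lolo lor) (le_trans rhi hihi).
Qed.

Lemma time_E2D lo hi X Y : jointly_measurable X -> jointly_measurable Y ->
  (time_E2 lo hi (fun r w => X r w + Y r w)%R <=
   2%:E * time_E2 lo hi X + 2%:E * time_E2 lo hi Y)%E.
Proof.
move=> mX mY; rewrite /time_E2.
have mI Z : jointly_measurable Z ->
    measurable_fun (`]lo, hi] : set (measurableTypeR R)) (fun r => E2 (Z r)).
  by move=> mZ; apply: measurable_funTS; exact: measurable_E2.
have twice Z : jointly_measurable Z ->
    (2%:E * \int[leb]_(r in `]lo, hi]) E2 (Z r) =
     \int[leb]_(r in `]lo, hi]) (2%:E * E2 (Z r)))%E.
  move=> mZ; rewrite ge0_integralZl//; first exact: mI.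
  by move=> r _; exact: E2_ge0.
have m2 Z : jointly_measurable Z -> measurable_fun
    (`]lo, hi] : set (measurableTypeR R)) (fun r => 2%:E * E2 (Z r))%E.
  by move=> mZ; apply: emeasurable_funM => //; exact: mI.
rewrite !twice// -ge0_integralD//; last 4 first.
- by move=> r _; rewrite mule_ge0 ?E2_ge0.
- exact: m2.
- by move=> r _; rewrite mule_ge0 ?E2_ge0.
- exact: m2.
apply: ge0_le_integral => //.
- by move=> r _; exact: E2_ge0.
- by apply: mI; exact: jointly_measurableD.
- by apply: emeasurable_funD; exact: m2.
- by move=> r _; apply: E2D; exact: jointly_measurable_section.
Qed.

Lemma time_E2N lo hi X : time_E2 lo hi (fun r w => - X r w) = time_E2 lo hi X.
Proof. by apply: eq_integral => r _; exact: E2N. Qed.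

Lemma time_E2B lo hi X Y : jointly_measurable X -> jointly_measurable Y ->
  (time_E2 lo hi (fun r w => X r w - Y r w)%R <=
   2%:E * time_E2 lo hi X + 2%:E * time_E2 lo hi Y)%E.
Proof.
move=> mX mY; rewrite -(time_E2N _ _ Y); apply: time_E2D => //.
exact: measurableT_comp.
Qed.

End processes.

Section continuous_process.
Context {R : realType} {d : measure_display} {T : measurableType d}.

Let grid (k : nat) (r : R) : R := (Num.floor (k.+1%:R * r))%:~R / k.+1%:R.

Let cvg_grid (r : R) : grid ^~ r @ \oo --> r.
Proof.
apply/cvgrPdist_le => e e0.
near=> k.
have k0 : 0 < k.+1%:R :> R by rewrite ltr0n.
have -> : r - grid k r = (k.+1%:R * r - (Num.floor (k.+1%:R * r))%:~R) / k.+1%:R.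
  by rewrite /grid; field; rewrite gt_eqF.
have /andP[f1 f2] := mem_rg1_floor (k.+1%:R * r).
rewrite ger0_norm; last by rewrite divr_ge0 ?subr_ge0// ltW.
rewrite ler_pdivrMr//.
have : e^-1 <= k.+1%:R.
  apply: (@le_trans _ _ k%:R); last by rewrite ler_nat.
  by near: k; apply: filterS (nbhs_infty_gtr e^-1) => j /ltW.
by rewrite -(ler_pM2l e0) divff ?gt_eqF//; lra.
Unshelve. all: by end_near. Qed.

Let cvg_grid_path (f : R -> R) (r : R) : continuous f ->
  (fun k => f (grid k r)) @ \oo --> f r.
Proof. by move=> cf; apply: continuous_cvg; [exact: cf|exact: cvg_grid]. Qed.

(** A process with continuous paths is the limit of the processes that freeze it
on intervals of length 1 / (k + 1), which are jointly measurable as countable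
unions of rectangles. *)
Lemma continuous_jointly_measurable (X : R -> T -> R) :
  (forall r, measurable_fun setT (X r)) ->
  (forall w, continuous (X ^~ w)) -> jointly_measurable X.
Proof.
move=> mX cX.
apply: (@measurable_fun_cvg _ _ _ _
  (fun k (z : measurableTypeR R * T) => X (grid k z.1) z.2)); last first.
  move=> [r w] _.
  exact: (cvg_grid_path (cX w)).
move=> k _ C mC; rewrite setTI.
pose A (j : int) : set (measurableTypeR R) :=
  [set r | Num.floor (k.+1%:R * r) = j].
have -> : (fun z : measurableTypeR R * T => X (grid k z.1) z.2) @^-1` C =
   \bigcup_(j in [set: int]) (A j `*` (X (j%:~R / k.+1%:R) @^-1` C)).
  apply/seteqP; split => [[r w] /= Cw|[r w] [j _ [/= <- //]]].
  by exists (Num.floor (k.+1%:R * r)).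
apply: countable_bigcupT_measurable => [|j]; first exact: countableP.
apply: measurableX; last first.
  by rewrite -[X in measurable X]setTI; exact: mX.
have -> : A j = `[j%:~R / k.+1%:R, (j + 1)%:~R / k.+1%:R[%classic.
  have k0 : 0 < k.+1%:R :> R by rewrite ltr0n.
  apply/seteqP; split => r; rewrite /A /= in_itv/=.
    move=> <-; have /andP[f1 f2] := mem_rg1_floor (k.+1%:R * r).
    by rewrite ler_pdivrMr// ltr_pdivlMr// (mulrC r) f1 intrD f2.
  by rewrite ler_pdivrMr// ltr_pdivlMr// (mulrC r); exact: floor_def.
exact: measurable_itv.
Qed.

End continuous_process.

(** * Stochastic integrals as limits of step integrals *)

Section ito_limit.
Context {R : realType} {d : measure_display} {T : measurableType d}.
Variable P : probability T R.
Context {I : choiceType}.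
Variable B : I -> R -> T -> R.
Hypothesis HB : brownian_field P B.
Local Notation F := (brownian_filtration P B).
Local Notation intg := (intg P).
Local Notation Ex := (Ex P).
Local Notation E2 := (E2 P).
Local Notation time_E2 := (time_E2 P).
Local Notation dB x := (increment (B x)).
Local Notation kappa := (@normal_second R).
Local Notation piece := (piece P B).

Lemma sum_val_out lo hi (L : seq (piece lo hi)) r w :
  ~~ (lo < r <= hi) -> sum_val L r w = 0.
Proof.
move=> rN; rewrite /sum_val big1// => e _; rewrite /piece_val indicE.
rewrite memNset ?mulr0//= /piece_set /= in_itv/= => /andP[er re].
case/negP: rN; rewrite (le_lt_trans (piece_lo e) er).
by rewrite (le_trans re (piece_hi e)).
Qed.

Lemma sum_val_measurable lo hi (L : seq (piece lo hi)) :
  jointly_measurable (sum_val L).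
Proof.
apply: measurable_sum => e; apply: measurable_funM.
  by apply: (measurableT_comp (height_measurable HB e)); exact: measurable_snd.
have mI : measurable_fun setT (\1_(piece_set e) : measurableTypeR R -> R).
  by apply: measurable_indic; exact: measurable_itv.
by apply: (measurableT_comp mI); exact: measurable_fst.
Qed.

Let lee_twice (a b a' b' : \bar R) : (a <= a' -> b <= b' ->
  2%:E * a + 2%:E * b <= 2%:E * a' + 2%:E * b')%E.
Proof. by move=> aa bb; apply: leeD; rewrite lee_pmul2l. Qed.

Lemma E2_zero (X : T -> R) : (forall w, X w = 0) -> E2 X = 0%E.
Proof. by move=> X0; rewrite /E2; apply: integral0_eq => w _; rewrite X0 expr0n. Qed.

Lemma isometry_time x lo hi (L : seq (piece lo hi)) : 0 <= lo ->
  E2 (sum_integral x L) = (kappa%:E * time_E2 lo hi (sum_val L))%E.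
Proof.
move=> lo0; rewrite (ito_isometry HB lo0); congr (_ * _)%E.
rewrite -(@time_E2_support _ _ _ P lo hi 0 hi)// => [|r _ rN]; last first.
  by apply: E2_zero => w; exact: sum_val_out.
rewrite /time_E2 integral_itv_obnd_cbnd//.
apply: measurable_funTS; apply: measurable_E2; exact: sum_val_measurable.
Qed.

Definition piece_opp lo hi (e : piece lo hi) : piece lo hi.
Proof.
refine (@Piece _ _ _ P _ B lo hi (left_end e) (right_end e)
  (fun w => - height e w) (piece_lo e) (piece_ends e) (piece_hi e) _ _).
- apply/sub_measurableP; apply: measurableT_comp => //.
  by apply/sub_measurableP; exact: piece_adapted.
- by have [M hM] := piece_bounded e; exists M => w; rewrite normrN.
Defined.

Definition piece_widen lo hi lo' hi' (lolo : lo' <= lo) (hihi : hi <= hi')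
    (e : piece lo hi) : piece lo' hi' :=
  @Piece _ _ _ P _ B lo' hi' (left_end e) (right_end e) (height e)
    (le_trans lolo (piece_lo e)) (piece_ends e) (le_trans (piece_hi e) hihi)
    (@piece_adapted _ _ _ P _ B lo hi e) (piece_bounded e).

Definition piece_after lo hi s (shi : s <= hi) (e : piece lo hi) : piece s hi.
Proof.
refine (@Piece _ _ _ P _ B s hi (Num.max s (left_end e))
  (Num.max s (right_end e)) (height e) _ _ _ _ (piece_bounded e)).
- by rewrite le_max lexx.
- by rewrite ge_max !le_max lexx (piece_ends e) orbT.
- by rewrite ge_max shi piece_hi.
- by apply: sub_measurable_mono (@piece_adapted _ _ _ P _ B lo hi e);
    rewrite le_max lexx orbT.
Defined.

Lemma sum_integral_opp x lo hi (L : seq (piece lo hi)) w :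
  sum_integral x (map (@piece_opp lo hi) L) w = - sum_integral x L w.
Proof.
rewrite /sum_integral big_map -sumrN; apply: eq_bigr => e _.
by rewrite /piece_integral /= mulNr.
Qed.

Lemma sum_val_opp lo hi (L : seq (piece lo hi)) r w :
  sum_val (map (@piece_opp lo hi) L) r w = - sum_val L r w.
Proof.
rewrite /sum_val big_map -sumrN; apply: eq_bigr => e _.
by rewrite /piece_val /= mulNr.
Qed.

Lemma sum_integral_widen x lo hi lo' hi' (lolo : lo' <= lo) (hihi : hi <= hi')
    (L : seq (piece lo hi)) w :
  sum_integral x (map (piece_widen lolo hihi) L) w = sum_integral x L w.
Proof. by rewrite /sum_integral big_map. Qed.

Lemma sum_val_widen lo hi lo' hi' (lolo : lo' <= lo) (hihi : hi <= hi')
    (L : seq (piece lo hi)) r w :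
  sum_val (map (piece_widen lolo hihi) L) r w = sum_val L r w.
Proof. by rewrite /sum_val big_map. Qed.

Lemma sum_val_after lo hi s (shi : s <= hi) (L : seq (piece lo hi)) r w :
  sum_val (map (piece_after shi) L) r w = if s < r then sum_val L r w else 0.
Proof.
case: ltP => sr; last first.
  by rewrite sum_val_out// negb_and -leNgt sr.
rewrite /sum_val big_map; apply: eq_bigr => e _; rewrite /piece_val /=.
rewrite /piece_set /= !indicE !mem_setE !in_itv/= gt_max sr/=.
by rewrite le_max (leNgt r s) sr.
Qed.

Lemma sum_integral_cat x lo hi (L M : seq (piece lo hi)) w :
  sum_integral x (L ++ M) w = sum_integral x L w + sum_integral x M w.
Proof. by rewrite /sum_integral big_cat. Qed.

Lemma sum_val_cat lo hi (L M : seq (piece lo hi)) r w :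
  sum_val (L ++ M) r w = sum_val L r w + sum_val M r w.
Proof. by rewrite /sum_val big_cat. Qed.

(** N is a stochastic integral of H over ]s, t]. The approximants are indexed by
their error, and they start at time s, so that the definition restricts to later
intervals. *)
Definition ito_limit x (H : R -> T -> R) (s t : R) (N : T -> R) :=
  forall eta : R, 0 < eta -> exists L : seq (piece s t),
    (E2 (fun w => (sum_integral x L w - N w)%R) <= eta%:E)%E /\
    (time_E2 s t (fun r w => (sum_val L r w - H r w)%R) <= eta%:E)%E.

(** Approximants over [0, t] and over [0, s] are close to each other on [0, s];
by the isometry, so are their integrals there, and the part after time s of the
former approximates the integral over [s, t]. *)
Lemma ito_limitB x H s t Ns Nt : 0 <= s -> s <= t -> jointly_measurable H ->
  measurable_fun setT Ns -> measurable_fun setT Nt ->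
  ito_limit x H 0 s Ns -> ito_limit x H 0 t Nt ->
  ito_limit x H s t (fun w => Nt w - Ns w).
Proof.
move=> s0 st mH mNs mNt lims limt eta eta0.
have k0 := @normal_second_ge0 R.
pose e := eta / (8 * kappa + 8).
have den : 0 < 8 * kappa + 8 by rewrite ltr_wpDl// mulr_ge0.
have e0 : 0 < e by rewrite divr_gt0.
have eE : (8 * kappa + 8) * e = eta by rewrite /e mulrC divfK// gt_eqF.
have [L [L1 L2]] := limt e e0; have [M [M1 M2]] := lims e e0.
pose C := map (piece_after st) L; exists C.
pose Q := L ++ map (@piece_opp 0 t) (map (piece_widen s0 (lexx t)) C ++
  map (piece_widen (lexx 0) st) M).
have QE w : sum_integral x Q w =
    sum_integral x L w - (sum_integral x C w + sum_integral x M w).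
  by rewrite sum_integral_cat sum_integral_opp sum_integral_cat
    !sum_integral_widen.
have mL := sum_val_measurable L; have mM := sum_val_measurable M.
have mC := sum_val_measurable C; have mQ := sum_val_measurable Q.
have QV r w : sum_val Q r w =
    if s < r then 0 else sum_val L r w - sum_val M r w.
  rewrite sum_val_cat sum_val_opp sum_val_cat !sum_val_widen sum_val_after.
  case: ltP => sr; last by rewrite add0r.
  by rewrite (sum_val_out M) ?addr0 ?subrr// negb_and -ltNge sr orbT.
have Q2 : (time_E2 0 t (sum_val Q) <= (4 * e)%:E)%E.
  rewrite (@time_E2_support _ _ _ P 0 s 0 t)//; last first.
    move=> r /andP[r0 rt]; rewrite r0/= -ltNge => sr.
    by apply: E2_zero => w; rewrite QV sr.
  pose X r w := sum_val L r w - H r w; pose Y r w := sum_val M r w - H r w.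
  have mX : jointly_measurable X by exact: jointly_measurableB.
  have mY : jointly_measurable Y by exact: jointly_measurableB.
  apply: (@le_trans _ _ (time_E2 0 s (fun r w => X r w - Y r w)%R)).
    apply: le_time_E2 => //; first exact: jointly_measurableB.
    move=> r /andP[r0 rs]; rewrite le_eqVlt; apply/orP; left; apply/eqP.
    by congr E2; apply/funext => w; rewrite QV ltNge rs/= /X /Y; ring.
  apply: (le_trans (time_E2B P 0 s mX mY)).
  have -> : (4 * e)%:E = (2%:E * e%:E + 2%:E * e%:E)%E.
    by rewrite -!EFinM -EFinD; congr EFin; ring.
  apply: lee_twice; last exact: M2.
  apply: (le_trans _ L2); exact: subset_time_E2.
have JQ : (E2 (sum_integral x Q) <= (4 * kappa * e)%:E)%E.
  rewrite isometry_time// (le_trans (lee_wpmul2l _ Q2)) ?lee_fin//.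
  by rewrite mulrA (mulrC kappa).
have mI lo hi (K : seq (piece lo hi)) : 0 <= lo ->
  measurable_fun setT (sum_integral x K).
  by move=> lo0; exact: sum_integral_measurable.
split.
  pose X w := sum_integral x L w - Nt w; pose Y w := sum_integral x M w - Ns w.
  have mX : measurable_fun setT X by apply: measurable_funB => //; exact: mI.
  have mY : measurable_fun setT Y by apply: measurable_funB => //; exact: mI.
  have -> : (fun w => sum_integral x C w - (Nt w - Ns w)) =
      (fun w => (X w - Y w) - sum_integral x Q w).
    by apply/funext => w; rewrite QE /X /Y; ring.
  apply: (le_trans (E2B P _ _)); [exact: measurable_funB|exact: mI|].
  have -> : eta%:E = (2%:E * (2%:E * e%:E + 2%:E * e%:E) +
                      2%:E * (4 * kappa * e)%:E)%E.
    have -> : eta = 2 * (2 * e + 2 * e) + 2 * (4 * kappa * e) by rewrite -eE; ring.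
    by rewrite !(EFinD, EFinM).
  apply: lee_twice; last exact: JQ.
  by apply: (le_trans (E2B P mX mY)); apply: lee_twice; [exact: L1|exact: M1].
have -> : time_E2 s t (fun r w => sum_val C r w - H r w) =
    time_E2 s t (fun r w => sum_val L r w - H r w).
  apply: eq_integral => r; rewrite inE/= in_itv/= => /andP[sr _].
  by congr E2; apply/funext => w; rewrite sum_val_after sr.
apply: (@le_trans _ _ e%:E).
  by apply: le_trans L2; apply: subset_time_E2 => //; exact: jointly_measurableB.
by rewrite lee_fin -[leRHS]eE ler_peMl ?ltW//; lra.
Qed.

Section consequences.
Variables (x : I) (H : R -> T -> R) (s t : R) (N : T -> R).
Hypotheses (s0 : 0 <= s) (st : s <= t) (mH : jointly_measurable H).
Hypotheses (mN : measurable_fun setT N) (limN : ito_limit x H s t N).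

Lemma ito_limit_lty : (E2 N < +oo)%E.
Proof.
have [L [L1 _]] := limN ltr01.
have mL := sum_integral_measurable HB s0 x L.
have -> : N = (fun w => sum_integral x L w - (sum_integral x L w - N w)).
  by apply/funext => w; ring.
apply: (le_lt_trans (E2B P mL _)); first exact: measurable_funB.
have [i _] := sum_integral_sqr HB s0 x L.
rewrite lte_add_pinfty// lte_mul_pinfty//; first exact: E2_lty.
exact: le_lt_trans L1 (ltry _).
Qed.

Lemma ito_limit_intg : intg N.
Proof. exact: (intg_of_sqr mN ito_limit_lty). Qed.

(** Subtracting the constant process xi from H subtracts xi times the increment of
B x from the integral, since xi is a step process; then the isometry applies,
with a factor lost to the triangle inequality. *)
Lemma ito_limit_increment_le (xi : T -> R) (M : R) : sub_measurable (F s) xi ->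
  (forall w, `|xi w| <= M) ->
  (E2 (fun w => (N w - xi w * dB x s t w)%R) <=
   (4 * kappa)%:E * time_E2 s t (fun r w => (H r w - xi w)%R))%E.
Proof.
move=> Fxi bxi.
have k0 := @normal_second_ge0 R.
have mxi := sub_measurable_measurable HB Fxi.
pose p : piece s t := @Piece _ _ _ P _ B s t s t xi (lexx s) st (lexx t) Fxi
  (ex_intro _ M bxi).
have bound (eta : R) : 0 < eta ->
  (E2 (fun w => (N w - xi w * dB x s t w)%R) <=
   (4 * kappa)%:E * time_E2 s t (fun r w => (H r w - xi w)%R) +
   ((2 + 4 * kappa) * eta)%:E)%E.
  move=> eta0; have [L [L1 L2]] := limN eta0.
  pose Q := L ++ [:: piece_opp p].
  have QE w : sum_integral x Q w = sum_integral x L w - xi w * dB x s t w.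
    rewrite sum_integral_cat; congr (_ + _).
    by rewrite /sum_integral big_seq1 /piece_integral/= mulNr.
  have QV r w : s < r <= t -> sum_val Q r w = sum_val L r w - xi w.
    move=> srt; rewrite sum_val_cat; congr (_ + _).
    rewrite /sum_val big_seq1 /piece_val/= /piece_set/= indicE mem_setE in_itv/=.
    by rewrite srt mulr1.
  have mL := sum_val_measurable L; have mQ := sum_val_measurable Q.
  pose X r w := sum_val L r w - H r w; pose Y r w := H r w - xi w.
  have mX : jointly_measurable X by exact: jointly_measurableB.
  have mY : jointly_measurable Y.
    by apply: jointly_measurableB => //; exact: jointly_measurable_const.
  have TQ : (time_E2 s t (sum_val Q) <= 2%:E * eta%:E + 2%:E * time_E2 s t Y)%E.
    apply: (@le_trans _ _ (time_E2 s t (fun r w => X r w + Y r w)%R)).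
      apply: le_time_E2 => //; first exact: jointly_measurableD.
      move=> r srt; rewrite le_eqVlt; apply/orP; left; apply/eqP.
      by congr E2; apply/funext => w; rewrite QV// /X /Y; ring.
    by apply: (le_trans (time_E2D P s t mX mY)); apply: lee_twice; first exact: L2.
  have mI : measurable_fun setT (sum_integral x L).
    exact: (sum_integral_measurable HB s0).
  have mJ : measurable_fun setT (sum_integral x Q).
    exact: (sum_integral_measurable HB s0).
  have -> : (fun w => N w - xi w * dB x s t w) =
     (fun w => sum_integral x Q w - (sum_integral x L w - N w)).
    by apply/funext => w; rewrite QE; ring.
  apply: (le_trans (E2B P mJ _)); first exact: measurable_funB.
  apply: (@le_trans _ _ (2%:E * (kappa%:E * (2%:E * eta%:E +
    2%:E * time_E2 s t Y)) + 2%:E * eta%:E)%E).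
    apply: lee_twice; last exact: L1.
    rewrite isometry_time//.
    by apply: lee_wpmul2l; rewrite ?lee_fin.
  have T0 : (0 <= time_E2 s t Y)%E by exact: time_E2_ge0.
  rewrite le_eqVlt; apply/orP; left; apply/eqP.
  move: (time_E2 s t Y) T0 => W W0.
  have eta0' := ltW eta0.
  rewrite ge0_muleDr ?ge0_muleDr ?mule_ge0 ?lee_fin//.
  rewrite addeC addeA addeC !muleA -!EFinM -EFinD.
  by congr (_%:E * _ + _%:E)%E; ring.
apply/lee_addgt0Pr => e e0.
have den : 0 < 2 + 4 * kappa by rewrite ltr_pwDl// mulr_ge0.
have := bound (e / (2 + 4 * kappa)) (divr_gt0 e0 den).
by rewrite (_ : (2 + 4 * kappa) * _ = e)// mulrC divfK// gt_eqF.
Qed.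

Lemma ito_limit_le : (E2 N <= (4 * kappa)%:E * time_E2 s t H)%E.
Proof.
have := @ito_limit_increment_le (cst 0) 0 (@sub_measurable_cst _ _ _ P _ B s 0).
have -> : (fun w => N w - cst 0 w * dB x s t w) = N.
  by apply/funext => w; rewrite mul0r subr0.
have -> : (fun r w => H r w - cst 0 w) = H.
  by apply/funext => r; apply/funext => w; rewrite subr0.
by apply => w; rewrite normr0.
Qed.

(** The martingale property of the integral, inherited from the step integrals. *)
Lemma ito_limit_mean (Z : T -> R) (M : R) : sub_measurable (F s) Z ->
  (forall w, `|Z w| <= M) -> Ex (fun w => Z w * N w) = 0.
Proof.
move=> FZ bZ.
have mZ := sub_measurable_measurable HB FZ.
have M0 := bound_ge0 P bZ.
have iN := ito_limit_intg.
have bound (e : R) : 0 < e -> `|Ex (fun w => Z w * N w)| <= M * (2 * e).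
  move=> e0; have [L [L1 _]] := limN (exprn_gt0 2 e0).
  have mI : measurable_fun setT (sum_integral x L).
    exact: (sum_integral_measurable HB s0).
  pose Y w := N w - sum_integral x L w.
  have mY : measurable_fun setT Y by exact: measurable_funB.
  have EY : (E2 Y <= (e ^+ 2)%:E)%E.
    by rewrite -E2N; under eq_fun do rewrite opprB.
  have iY2 := intg_sqr mY (le_lt_trans EY (ltry _)).
  have iY := intg_of_sqr mY (le_lt_trans EY (ltry _)).
  have ZJ e' : intg (fun w => Z w * piece_integral x e' w) /\
      Ex (fun w => Z w * piece_integral x (e' : piece s t) w) = 0.
    under eq_fun do rewrite /piece_integral mulrA.
    apply: (increment_mean HB); first exact: left_ge0 s0 e'.
    - exact: piece_ends.
    - apply: sub_measurableM; last exact: piece_adapted.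
      exact: sub_measurable_mono (piece_lo e') FZ.
    - by apply: (intgM_bounded mZ bZ); exact: height_intg.
  have EJ : intg (fun w => Z w * sum_integral x L w) /\
      Ex (fun w => Z w * sum_integral x L w) = 0.
    under eq_fun do rewrite /sum_integral mulr_sumr.
    split; first by apply: intg_sum => e'; have [] := ZJ e'.
    by rewrite Ex_sum ?big1// => e'; have [] := ZJ e'.
  have -> : Ex (fun w => Z w * N w) = Ex (fun w => Z w * Y w).
    transitivity (Ex (fun w => Z w * Y w + Z w * sum_integral x L w)).
      by congr Ex; apply/funext => w; rewrite /Y; ring.
    by rewrite ExD ?EJ.2 ?addr0 ?EJ.1//; exact: (intgM_bounded mZ bZ).
  have iZY : intg (fun w => Z w * Y w) by exact: (intgM_bounded mZ bZ).
  pose G w := M * (e + e^-1 * Y w ^+ 2).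
  have iG : intg G by apply: intgZ; apply: intgD; [exact: intg_cst|exact: intgZ].
  have ZG w : `|Z w * Y w| <= G w.
    by rewrite normrM /G ler_pM// young_abs.
  have EG : Ex G <= M * (2 * e).
    rewrite /G ExZ; last by apply: intgD; [exact: intg_cst|exact: intgZ].
    rewrite ler_wpM2l// ExD; [|exact: intg_cst|exact: intgZ].
    rewrite Ex_cst ExZ//.
    suff : Ex (fun w => Y w ^+ 2) <= e ^+ 2.
      move=> h; have : e^-1 * Ex (fun w => Y w ^+ 2) <= e.
        by rewrite ler_pdivrMl// -expr2.
      by lra.
    by rewrite -lee_fin -E2E.
  rewrite ler_norml; apply/andP; split.
    rewrite lerNl; apply: le_trans EG.
    rewrite -[leLHS]mulN1r -ExZ//; apply: le_Ex => //; first exact: intgZ.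
    by move=> w; rewrite mulN1r; apply: le_trans (ZG w); rewrite ler_normr lexx orbT.
  apply: le_trans EG; apply: le_Ex => // w.
  by apply: le_trans (ZG w); exact: ler_norm.
apply/eqP; rewrite -normr_le0; apply/ler_addgt0Pr => e e0; rewrite add0r.
have d0 : 0 < 2 * (M + 1) by lra.
apply: (le_trans (bound (e / (2 * (M + 1))) _)); first by rewrite divr_gt0.
have -> : M * (2 * (e / (2 * (M + 1)))) = e * (M / (M + 1)) by field; lra.
by rewrite ler_piMr ?(ltW e0)// ler_pdivrMr; lra.
Qed.

End consequences.

End ito_limit.

(** * Consequences of the assumptions on the coefficients *)

Section lattice.
Context {R : realType} {n : nat}.
Implicit Types (tau h : 'rV[int]_n -> R) (x : 'rV[int]_n).

Lemma finite_lattice_ball (r : R) :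
  finite_set [set x : 'rV[int]_n | lattice_norm x <= r].
Proof.
pose N := (Num.truncn `|r|).+1.
pose f (y : 'rV['I_(N.*2.+1)]_n) : 'rV[int]_n := \row_j ((y ord0 j)%:Z - N%:Z).
apply: (@sub_finite_set _ _ (f @` setT)); last first.
  by apply: finite_image; exact: finite_finset.
move=> x /= xr.
have rN : `|r| < N%:R by apply: truncnS_gt.
have bnd j : (`|x ord0 j| <= N%:Z)%R.
  have xj : `|(x ord0 j)%:~R : R| <= lattice_norm x.
    rewrite -sqrtr_sqr /lattice_norm ler_wsqrtr// (bigD1 j)//= lerDl sumr_ge0// => i _.
    exact: sqr_ge0.
  rewrite -(ler_int R) intr_norm (le_trans xj)// (le_trans xr)//.
  by rewrite (le_trans (ler_norm r))// ltW.
have lt j : (absz (x ord0 j + N%:Z)%R < N.*2.+1)%N.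
  have := bnd j; rewrite ler_norml; lia.
exists (\row_j Ordinal (lt j)) => //; apply/rowP => j; rewrite !mxE /=.
rewrite -[RHS]/(x ord0 j).
have := bnd j; rewrite ler_norml; lia.
Qed.

(** As the jumps are bounded, the generator is a finite sum. *)
Lemma jump_support tau : jump_law tau -> exists Y : seq 'rV[int]_n,
  [/\ forall y, y \notin Y -> tau y = 0,
      \sum_(y <- Y) tau y <= 1 &
      forall h x, generator tau h x = \sum_(y <- Y) (h (x + y) - h x) * tau y].
Proof.
move=> [tau0 mass [R0 _ out] _ _ _].
have [Y0 YE] : exists s : seq 'rV[int]_n,
    [set x : 'rV[int]_n | lattice_norm x <= R0] = [set` s].
  by apply/finite_seqP; exact: finite_lattice_ball.
pose Y := undup Y0; exists Y.
have outY y : y \notin Y -> tau y = 0.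
  rewrite mem_undup => yY; apply: out; rewrite ltNge; apply: contra yY => yR.
  by have : [set` Y0] y by rewrite -YE.
split=> //.
  rewrite -lee_fin -mass -sumEFin.
  apply: esum_ge; exists [set` Y].
    by split; [exact: finite_seq|].
  by rewrite fsbig_seq// undup_uniq.
move=> h x; rewrite /generator (fsbigE Y) ?undup_uniq//.
  by apply: eq_bigl => y; rewrite in_setT.
by move=> y _ yY; rewrite outY// mulr0.
Qed.

End lattice.

Section lipschitz_noise.
Context {R : realType}.

(** The linear growth of sigma is the Lipschitz bound at 0. *)
Lemma noise_bounds (sigma : R -> R) : noise_coefficient sigma ->
  exists2 K : R, 0 <= K &
    (forall a b, `|sigma a - sigma b| <= K * `|a - b|) /\
    (forall a, `|sigma a| <= K * `|a|).
Proof.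
move=> [[k lip] s0 _]; exists (Num.max k 0); first by rewrite le_max lexx orbT.
have L a b : `|sigma a - sigma b| <= Num.max k 0 * `|a - b|.
  apply: (@le_trans _ _ (k * `|a - b|)); first exact: (lip (a, b)).
  by rewrite ler_wpM2r// le_max lexx.
by split=> // a; have := L a 0; rewrite s0 !subr0.
Qed.

Lemma noise_continuous (sigma : R -> R) : noise_coefficient sigma ->
  continuous sigma.
Proof.
move=> /noise_bounds[K K0 [L _]] a; apply/cvgrPdist_le => e e0.
have [K00|Kn0] := eqVneq K 0.
  by near=> b; rewrite (le_trans (L a b))// K00 mul0r ltW.
have Kpos : 0 < K by rewrite lt_neqAle eq_sym Kn0.
have /cvgrPdist_le/(_ _ (divr_gt0 e0 Kpos)) := @cvg_id _ (nbhs a).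
by apply: filterS => b ab; rewrite (le_trans (L a b))// mulrC -ler_pdivlMr.
Unshelve. all: by end_near. Qed.

End lipschitz_noise.

Section ito_integral_limit.
Context {R : realType} {d : measure_display} {T : measurableType d}.
Variable P : probability T R.
Context {I : choiceType}.
Variable B : I -> R -> T -> R.
Hypothesis HB : brownian_field P B.
Local Notation F := (brownian_filtration P B).
Local Notation E2 := (E2 P).

Lemma simple_pieces t (S : simple_process) : simple_on F t S ->
  exists L : seq (piece P B 0 t),
    (forall x, sum_integral x L = simple_integral (B x) S) /\
    (forall r, sum_val L r = simple_val S r).
Proof.
move=> [k0 kt Sstep].
have kmono i j : (i <= j)%N -> (j <= steps S)%N -> knot S i <= knot S j.
  elim: j => [|j IH]; first by rewrite leqn0 => /eqP ->.
  rewrite leq_eqVlt => /predU1P[->//|]; rewrite ltnS => ij jS.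
  apply: (le_trans (IH ij (ltnW jS))).
  by have [] := Sstep j jS.
have lo (i : 'I_(steps S)) : 0 <= knot S i.
  by apply: (le_trans k0); apply: kmono => //; exact: ltnW.
have hi (i : 'I_(steps S)) : knot S i.+1 <= t.
  by apply: le_trans kt; apply: kmono.
have ends (i : 'I_(steps S)) : knot S i <= knot S i.+1.
  by have [] := Sstep i (ltn_ord i).
have ad (i : 'I_(steps S)) : sub_measurable (F (knot S i)) (coef S i).
  by have [] := Sstep i (ltn_ord i).
have bd (i : 'I_(steps S)) : exists M : R, forall w, `|coef S i w| <= M.
  by have [] := Sstep i (ltn_ord i).
pose p i := @Piece _ _ _ P _ B 0 t _ _ _ (lo i) (ends i) (hi i) (ad i) (bd i).
exists (map p (enum 'I_(steps S))); split => [x|r]; apply/funext => w.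
  by rewrite /sum_integral big_map big_enum.
by rewrite /sum_val big_map big_enum.
Qed.

(** The integrand may be replaced by a modification: at each time it is almost
surely the same random variable, hence at the same mean square distance to the
approximants. *)
Lemma ito_integral_limit x (H' H : R -> T -> R) t N : 0 <= t ->
  jointly_measurable H ->
  (forall r, 0 <= r <= t -> {ae P, forall w, H' r w = H r w}) ->
  is_ito_integral P F (B x) H' t N ->
  ito_limit P B x H 0 t N.
Proof.
move=> t0 mH H'H [mN [FH' [S [Son cvgS cvgI]]]] eta eta0.
have eta0' : (0 < eta%:E)%E by rewrite lte_fin.
have [k1 _ near1] := cvgS _ (open_ereal_lt' eta0').
have [k2 _ near2] := cvgI _ (open_ereal_lt' eta0').
pose k := maxn k1 k2.
have Sk := near1 k (leq_maxl _ _); have Ik := near2 k (leq_maxr _ _).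
have [L [LI LV]] := simple_pieces (Son k).
exists L; split; first by rewrite LI; exact: ltW.
apply: le_trans (ltW Sk).
rewrite /time_E2 (_ : \int[lebesgue_measure]_(r in `[0%R, t]) _ =
  \int[lebesgue_measure]_(r in `[0%R, t])
    E2 (fun w => (sum_val L r w - H r w)%R))%E; last first.
  apply: eq_integral => r; rewrite inE/= in_itv/= => rt.
  have mS : measurable_fun setT (simple_val (S k) r).
    rewrite -LV; apply: jointly_measurable_section.
    exact: (sum_val_measurable HB).
  have mH' := sub_measurable_measurable HB (FH' r rt).
  have mHr := jointly_measurable_section r mH.
  rewrite LV; apply: ae_eq_integral => //.
  - by apply: measurable_EFin_sqr; exact: measurable_funB.
  - by apply: measurable_EFin_sqr; exact: measurable_funB.
  - by apply: filterS (H'H r rt) => w HE _; rewrite HE.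
apply: ge0_subset_integral => //.
- apply: measurable_funTS; apply: measurable_E2; apply: jointly_measurableB => //.
  exact: (sum_val_measurable HB).
- by move=> r _; exact: E2_ge0.
- by move=> r; rewrite /= !in_itv/= => /andP[/ltW -> ->].
Qed.

End ito_integral_limit.

(** * Integrals over time *)

Section time_integral.
Context {R : realType} {d : measure_display} {T : measurableType d}.
Variable P : probability T R.
Local Notation leb := (@lebesgue_measure R).
Local Notation E2 := (E2 P).
Implicit Types f g : R -> T -> R.

Let measurable_restrict_time (D : set (measurableTypeR R)) f : measurable D ->
  jointly_measurable f -> measurable_fun setT
    (fun z : measurableTypeR R * T => (f z.1 z.2 * \1_D z.1)%:E).
Proof.
move=> mD mf; apply/measurable_EFinP; apply: measurable_funM => //.
have mI : measurable_fun setT (\1_D : measurableTypeR R -> R).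
  exact: measurable_indic.
by apply: (measurableT_comp mI); exact: measurable_fst.
Qed.

Let restrict_time (D : set (measurableTypeR R)) f w :
  (\int[leb]_(r in D) (f r w)%:E = \int[leb]_r (f r w * \1_D r)%:E)%E.
Proof.
rewrite integral_mkcond; apply: eq_integral => r _; rewrite patchE indicE.
by case: (r \in D); rewrite ?mulr1 ?mulr0.
Qed.

Lemma measurable_time_integral (D : set (measurableTypeR R)) f : measurable D ->
  jointly_measurable f ->
  measurable_fun setT (fun w => \int[leb]_(r in D) f r w).
Proof.
move=> mD mf; apply: measurableT_comp => //.
under eq_fun do rewrite restrict_time.
pose F (z : measurableTypeR R * T) := (f z.1 z.2 * \1_D z.1)%:E.
have mF : measurable_fun setT F by exact: measurable_restrict_time.
rewrite (_ : (fun w => _) = (fun w => \int[leb]_r (F^\+%E (r, w)) -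
    \int[leb]_r (F^\-%E (r, w)))%E); last first.
  apply/funext => w; rewrite integralE; congr (_ - _)%E.
    by apply: eq_integral => r _; rewrite !funeposE.
  by apply: eq_integral => r _; rewrite !funenegE.
apply: emeasurable_funB.
  apply: (@measurable_fun_fubini_tonelli_G _ _ (measurableTypeR R) T R leb (F^\+)%E) => //.
  exact: measurable_funepos.
apply: (@measurable_fun_fubini_tonelli_G _ _ (measurableTypeR R) T R leb (F^\-)%E) => //.
exact: measurable_funeneg.
Qed.

Lemma measurable_ge0_time_integral (D : set (measurableTypeR R)) f :
  measurable D -> jointly_measurable f -> (forall r w, 0 <= f r w) ->
  measurable_fun setT (fun w => \int[leb]_(r in D) (f r w)%:E)%E.
Proof.
move=> mD mf f0; under eq_fun do rewrite restrict_time.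
apply: (@measurable_fun_fubini_tonelli_G _ _ (measurableTypeR R) T R leb
  (fun z => (f z.1 z.2 * \1_D z.1)%:E)); last by move=> z; rewrite lee_fin mulr_ge0.
exact: measurable_restrict_time.
Qed.

Lemma tonelli_time (D : set (measurableTypeR R)) f : measurable D ->
  jointly_measurable f -> (forall r w, 0 <= f r w) ->
  (\int[P]_w \int[leb]_(r in D) (f r w)%:E =
   \int[leb]_(r in D) \int[P]_w (f r w)%:E)%E.
Proof.
move=> mD mf f0.
under eq_integral do rewrite restrict_time.
pose F (z : measurableTypeR R * T) := (f z.1 z.2 * \1_D z.1)%:E.
have mF : measurable_fun setT F by exact: measurable_restrict_time.
have F0 z : (0 <= F z)%E by rewrite lee_fin mulr_ge0.
transitivity (\int[leb]_r \int[P]_w F (r, w))%E; first exact/esym/fubini_tonelli.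
rewrite [RHS]integral_mkcond; apply: eq_integral => r _.
rewrite patchE /F /= indicE; case: (r \in D).
  by apply: eq_integral => w _; rewrite mulr1.
by apply: integral0_eq => w _; rewrite mulr0.
Qed.

Lemma continuous_integrable_itv (s t : R) (phi : R -> R) : continuous phi ->
  leb.-integrable `[s, t] (EFin \o phi).
Proof.
move=> cphi; apply: continuous_compact_integrable; first exact: segment_compact.
exact: continuous_subspaceT.
Qed.

Lemma Rintegral_itv_cst (s t c : R) : s <= t ->
  \int[leb]_(r in `[s, t]) c = c * (t - s).
Proof.
move=> st; rewrite Rintegral_cst//= lebesgue_measure_itv/= lte_fin.
case: ltP => [_ //|ts]; congr (_ * _); rewrite /=.
by apply/esym/eqP; rewrite subr_eq0 eq_le ts st.
Qed.

(** The integral of the square of phi minus its mean is nonnegative. *)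
Lemma sqr_Rintegral_le (s t : R) (phi : R -> R) : s <= t -> continuous phi ->
  (\int[leb]_(r in `[s, t]) phi r) ^+ 2 <=
  (t - s) * \int[leb]_(r in `[s, t]) (phi r ^+ 2).
Proof.
move=> st cphi.
have cphi2 : continuous (fun r => phi r ^+ 2).
  by move=> r; apply: cvgM; exact: cphi.
move: st; rewrite le_eqVlt => /predU1P[<-|st].
  by rewrite set_itv1 !Rintegral_set1 expr0n mulr0.
set A := \int[leb]_(r in _) phi r; set Q := \int[leb]_(r in _) (phi r ^+ 2).
pose c := A / (t - s).
have h0 : 0 < t - s by rewrite subr_gt0.
have i1 := @continuous_integrable_itv s t phi cphi.
have i2 := @continuous_integrable_itv s t _ cphi2.
have i3 : leb.-integrable `[s, t] (EFin \o cst (c ^+ 2)).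
  by apply: continuous_integrable_itv => r; exact: cvg_cst.
have i4 : leb.-integrable `[s, t] (EFin \o (fun r => (- (2 * c)) * phi r)).
  exact: (integrableZl _ _ i1).
have : 0 <= \int[leb]_(r in `[s, t]) ((phi r - c) ^+ 2).
  by apply: Rintegral_ge0 => r _; exact: sqr_ge0.
have -> : \int[leb]_(r in `[s, t]) ((phi r - c) ^+ 2) =
    \int[leb]_(r in `[s, t]) (phi r ^+ 2 + ((- (2 * c)) * phi r + c ^+ 2)).
  by apply: eq_Rintegral => r _; ring.
have i34 : leb.-integrable `[s, t]
    (EFin \o (fun r => (- (2 * c)) * phi r + c ^+ 2)).
  exact: (integrableD _ i4 i3).
rewrite RintegralD// RintegralD// RintegralZl// Rintegral_itv_cst ?(ltW st)//.
rewrite -/A -/Q => q0.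
have cE : c * (t - s) = A by rewrite /c divfK// gt_eqF.
have -> : A ^+ 2 = (t - s) * (2 * c * A - c ^+ 2 * (t - s)).
  by rewrite -cE; ring.
by rewrite ler_wpM2l ?(ltW h0)//; lra.
Qed.

Lemma E2_time_integral (s t : R) f : s <= t -> jointly_measurable f ->
  (forall w, continuous (f ^~ w)) ->
  (E2 (fun w => (\int[leb]_(r in `[s, t]) f r w)%R) <=
   (t - s)%:E * time_E2 P s t f)%E.
Proof.
move=> st mf cf.
have cf2 w : continuous (fun r => f r w ^+ 2).
  by move=> r; apply: cvgM; exact: cf.
have mf2 : jointly_measurable (fun r w => f r w ^+ 2) by exact: measurable_funX.
have mitv : measurable (`[s, t]%classic : set (measurableTypeR R)).
  exact: measurable_itv.
have ge0i w : (0 <= \int[leb]_(r in `[s, t]) (f r w ^+ 2)%:E)%E.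
  by apply: integral_ge0 => r _; rewrite lee_fin sqr_ge0.
apply: (@le_trans _ _ (\int[P]_w ((t - s)%:E *
    \int[leb]_(r in `[s, t]) (f r w ^+ 2)%:E))%E).
  apply: ge0_le_integral => //.
  - by move=> w _; rewrite lee_fin sqr_ge0.
  - by apply: measurable_EFin_sqr; exact: measurable_time_integral.
  - apply: emeasurable_funM => //.
    by apply: (measurable_ge0_time_integral mitv mf2) => r w; exact: sqr_ge0.
  - move=> w _; have := sqr_Rintegral_le st (cf w).
    rewrite -lee_fin => /le_trans; apply.
    rewrite EFinM /Rintegral fineK//; apply: integrable_fin_num => //.
    exact: continuous_integrable_itv.
rewrite ge0_integralZl//; last 2 first.
- by apply: (measurable_ge0_time_integral mitv mf2) => r w; exact: sqr_ge0.
- by rewrite lee_fin subr_ge0.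
rewrite lee_wpmul2l ?lee_fin ?subr_ge0//.
rewrite (tonelli_time mitv mf2); last by move=> r w; exact: sqr_ge0.
rewrite /time_E2 integral_itv_obnd_cbnd//.
by apply: measurable_funTS; exact: measurable_E2.
Qed.

End time_integral.

(** * A regular version of the solution *)

Section regular_solution.
Context {R : realType} {d : measure_display} {T : measurableType d}.
Variables (P : probability T R) (n : nat).
Local Notation site := 'rV[int]_n.
Local Notation leb := (@lebesgue_measure R).
Variable B : site -> R -> T -> R.
Local Notation F := (brownian_filtration P B).
Variables (Y : seq site) (tau : site -> R) (sigma : R -> R) (c0 lambda : R).

Definition generator_sum (h : site -> R) (x : site) : R :=
  \sum_(y <- Y) (h (x + y) - h x) * tau y.

(** A solution all of whose paths are continuous, extended to negative times so
that it is jointly measurable, together with the stochastic integrals of its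
equation. *)
Record regular_solution (v N : site -> R -> T -> R) : Prop := RegularSolution {
  rs_continuous : forall x w, continuous (v x ^~ w) ;
  rs_measurable : forall x r, measurable_fun setT (v x r) ;
  rs_adapted : forall x t, 0 <= t -> sub_measurable (F t) (v x t) ;
  rs_initial : forall x, {ae P, forall w, v x 0 w = c0 * (x == 0)%:R} ;
  rs_noise_measurable : forall x t, 0 <= t -> measurable_fun setT (N x t) ;
  rs_noise : forall x t, 0 <= t ->
    ito_limit P B x (fun r w => sigma (v x r w)) 0 t (N x t) ;
  rs_equation : forall x t, 0 <= t -> {ae P, forall w, v x t w = v x 0 w +
    \int[leb]_(r in `[0, t]) generator_sum (fun z => v z r w) x +
    lambda * N x t w} ;
  rs_moment : forall t, 0 < t ->
    (\esum_(x in [set: site]) time_E2 P 0 t (v x) < +oo)%E }.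

End regular_solution.

Lemma ae_forall_countable {R : realType} (d : measure_display)
    (T : measurableType d) (P : probability T R) (I : countType)
    (Q : I -> T -> Prop) :
  (forall i, {ae P, forall w, Q i w}) -> {ae P, forall w, forall i, Q i w}.
Proof.
move=> Qi; pose Q' (k : nat) w := if choice.unpickle k is Some i then Q i w else True.
have : {ae P, forall w, forall k, Q' k w}.
  apply/ae_foralln => k; rewrite /Q'.
  by case: (choice.unpickle k) => [i|]; [exact: Qi|exact: aeW].
apply: filterS => w Qw i.
by have := Qw (choice.pickle i); rewrite /Q' choice.pickleK.
Qed.

Section regularization.
Context {R : realType} {d : measure_display} {T : measurableType d}.
Variables (P : probability T R) (n : nat).
Local Notation site := 'rV[int]_n.
Local Notation leb := (@lebesgue_measure R).
Variable B : site -> R -> T -> R.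
Local Notation F := (brownian_filtration P B).
Hypothesis HB : brownian_field P B.
Variables (Y : seq site) (tau : site -> R) (sigma : R -> R) (c0 lambda : R).
Hypothesis Htau : forall h x, generator tau h x = generator_sum Y tau h x.
Hypothesis sigma_cont : continuous sigma.
Variable u : site -> R -> T -> R.
Hypothesis Hu : is_solution P tau sigma c0 lambda B u.

Lemma continuous_stopped_path (f : R -> R) : {within `[0, +oo[, continuous f} ->
  continuous (fun t : R => f (Num.max t 0)).
Proof.
move=> /subspace_continuousP cf t.
have max0 (s : R) : (`[0, +oo[%classic : set R) (Num.max s 0).
  by rewrite /= in_itv/= andbT le_max lexx orbT.
have cmax : continuous (fun s : R => Num.max s 0).
  by move=> s; apply: continuous_max; [exact: cvg_id|exact: cvg_cst].
apply: (@cvg_comp _ _ _ (fun s : R => Num.max s 0) f _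
  (within `[0, +oo[ (nbhs (Num.max t 0)))); last exact: cf.
move=> U nU; have H : nbhs t (fun s => (`[0, +oo[%classic : set R) (Num.max s 0) ->
    U (Num.max s 0)) := cmax t _ nU.
have : nbhs t (fun s => U (Num.max s 0)).
  by apply: (filterS _ H) => s h; exact: h (max0 s).
by [].
Qed.

Lemma solution_null_set : exists M : set T, [/\ measurable M, P M = 0%E &
  forall w, ~ M w -> forall x,
    {within `[0, +oo[, continuous (fun t => u x t w)} /\
    u x 0 w = c0 * (x == 0)%:R].
Proof.
have [M [mM M0 subM]] : {ae P, forall w, forall x,
    {within `[0, +oo[, continuous (fun t => u x t w)} /\
    u x 0 w = c0 * (x == 0)%:R}.
  apply: ae_forall_countable => x.
  by near=> w; split; near: w; [exact: (sol_continuous Hu)|exact: (sol_initial Hu)].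
by exists M; split => // w Mw; apply: contrapT => nQ; apply: Mw; exact: subM.
Unshelve. all: by end_near. Qed.

Lemma ito_limit0 x H : ito_limit P B x H 0 0 (cst 0).
Proof.
move=> eta eta0; exists [::]; split.
  rewrite E2_zero ?lee_fin ?ltW// => w.
  by rewrite /sum_integral big_nil subrr.
by rewrite /time_E2 set_itvoc0 integral_set0 lee_fin ltW.
Qed.

(** The paths are set to zero on the null set where some path is discontinuous or
starts at the wrong value; the augmented filtration contains that set. *)
Lemma regular_solution_exists : exists v N,
  regular_solution P B Y tau sigma c0 lambda v N /\
  (forall x (t : R), 0 <= t -> {ae P, forall w, v x t w = u x t w}).
Proof.
have [M [mM M0 good]] := solution_null_set.
pose v x (t : R) w := u x (Num.max t 0) w * \1_(~` M) w.
have mC : measurable (~` M) by exact: measurableC.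
have max_ge0 (t : R) : 0 <= Num.max t 0 by rewrite le_max lexx orbT.
have vu x t w : 0 <= t -> ~ M w -> v x t w = u x t w.
  by move=> t0 Mw; rewrite /v max_l// indicE mem_set// mulr1.
have aevu x t : 0 <= t -> {ae P, forall w, v x t w = u x t w}.
  move=> t0; exists M; split => // w /= vuw; apply: contrapT => Mw.
  by apply: vuw; exact: vu.
have Fv x t : 0 <= t -> sub_measurable (F t) (v x t).
  move=> t0; apply: sub_measurableM; first by rewrite max_l//; exact: (sol_adapted Hu).
  apply/sub_measurableP; apply: measurable_indic.
  rewrite -setTD; apply: measurableD => //.
  by apply: sub_sigma_algebra; right.
have mv x r : measurable_fun setT (v x r).
  apply: measurable_funM; last exact: measurable_indic.
  by apply: (sub_measurable_measurable HB); apply: (sol_adapted Hu) => //.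
have cv x w : continuous (v x ^~ w).
  have [Mw|Mw] := pselect (M w).
    rewrite (_ : v x ^~ w = cst 0); first by move=> r; exact: cvg_cst.
    by apply/funext => r; rewrite /v indicE memNset ?mulr0//=; apply.
  rewrite (_ : v x ^~ w = (fun t => u x (Num.max t 0) w)).
    by apply: (@continuous_stopped_path (fun t => u x t w)); have [] := good w Mw x.
  by apply/funext => r; rewrite /v indicE mem_set// mulr1.
have mjv x : jointly_measurable (v x) by exact: continuous_jointly_measurable.
have mjs x : jointly_measurable (fun r w => sigma (v x r w)).
  apply: (measurableT_comp _ (mjv x)); exact: continuous_measurable_fun.
have gen x t w : 0 <= t -> ~ M w ->
    \int[leb]_(r in `[0, t]) generator tau (fun y => u y r w) x =
    \int[leb]_(r in `[0, t]) generator_sum Y tau (fun z => v z r w) x.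
  move=> t0 Mw; apply: eq_Rintegral => r; rewrite inE/= in_itv/= => /andP[r0 _].
  by rewrite Htau; apply: eq_bigr => y _; rewrite !vu.
have noise (xt : site * R) : exists N : T -> R, 0 <= xt.2 ->
  [/\ measurable_fun setT N,
    ito_limit P B xt.1 (fun r w => sigma (v xt.1 r w)) 0 xt.2 N &
    {ae P, forall w, v xt.1 xt.2 w = v xt.1 0 w +
      \int[leb]_(r in `[0, xt.2]) generator_sum Y tau (fun z => v z r w) xt.1 +
      lambda * N w}].
  case: xt => x t /=; have [t0|t0] := leP 0 t; last by exists (cst 0).
  move: t0; rewrite le_eqVlt => /predU1P[<-|t0].
    exists (cst 0) => _; split; [exact: measurable_cst|exact: ito_limit0|].
    by apply: aeW => w; rewrite set_itv1 Rintegral_set1 mulr0 !addr0.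
  have [I itoI eqI] := sol_equation Hu x t0.
  exists I => _; split; first by case: itoI.
    apply: (ito_integral_limit HB (ltW t0) (mjs x) _ itoI) => r /andP[r0 _].
    by apply: filterS (aevu x r r0) => w ->.
  have [E [mE E0 subE]] := eqI; exists (E `|` M); split.
  - exact: measurableU.
  - by apply: null_set_setU.
  - move=> w /= vw; apply: contrapT => /not_orP[Ew Mw]; apply: vw.
    have -> : v x t w = u x t w by apply: vu => //; exact: ltW.
    rewrite -(gen x t w (ltW t0) Mw) vu//.
    by apply: contrapT => uw; apply: Ew; exact: subE.
have [N HN] := choice noise.
exists v, (fun x t => N (x, t)); split; last exact: aevu.
split => //.
- move=> x; apply: filterS2 (aevu x 0 (lexx 0)) (sol_initial Hu x) => w -> //.
- by move=> x t t0; have [] := HN (x, t) t0.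
- by move=> x t t0; have [] := HN (x, t) t0.
- by move=> x t t0; have [] := HN (x, t) t0.
move=> t t0; apply: le_lt_trans (sol_moment Hu t0); apply: le_esum => x _.
rewrite [leRHS](_ : _ = \int[leb]_(r in `[0%R, t]) E2 P (v x r))%E; last first.
  apply: eq_integral => r; rewrite inE/= in_itv/= => /andP[r0 _].
  have mu : measurable_fun setT (u x r).
    by apply: (sub_measurable_measurable HB); exact: (sol_adapted Hu).
  apply: ae_eq_integral => //.
  - by apply: measurable_EFin_sqr; exact: measurableT_comp.
  - exact: measurable_EFin_sqr.
  - by apply: filterS (aevu x r r0) => w -> _; rewrite real_normK ?num_real.
apply: ge0_subset_integral => //.
- by apply: measurable_funTS; exact: measurable_E2.
- by move=> r _; exact: E2_ge0.
- by move=> r; rewrite /= !in_itv/= => /andP[/ltW -> ->].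
Qed.

End regularization.

(** * Moment bounds for the solution *)

Section moments.
Context {R : realType} {d : measure_display} {T : measurableType d}.
Variables (P : probability T R) (n : nat).
Local Notation site := 'rV[int]_n.
Local Notation leb := (@lebesgue_measure R).
Local Notation E2 := (E2 P).
Local Notation time_E2 := (time_E2 P).
Local Notation kappa := (@normal_second R).
Variable B : site -> R -> T -> R.
Local Notation F := (brownian_filtration P B).
Hypothesis HB : brownian_field P B.
Variables (Y : seq site) (tau : site -> R) (sigma : R -> R) (c0 lambda K : R).
Hypothesis tau0 : forall y, 0 <= tau y.
Hypothesis tau1 : \sum_(y <- Y) tau y <= 1.
Hypothesis K0 : 0 <= K.
Hypothesis sigma_cont : continuous sigma.
Hypothesis sigma_lip : forall a b, `|sigma a - sigma b| <= K * `|a - b|.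
Hypothesis sigma_growth : forall a, `|sigma a| <= K * `|a|.
Variables v N : site -> R -> T -> R.
Hypothesis Hv : regular_solution P B Y tau sigma c0 lambda v N.

Definition drift x (r : R) (w : T) : R :=
  generator_sum Y tau (fun z => v z r w) x.

Definition drift_integral x (s t : R) (w : T) : R :=
  \int[leb]_(r in `[s, t]) drift x r w.

(** The weights with which bounds on the second moments pass through the
generator. *)
Definition neighbour_sum (q : site -> R) x : R :=
  \sum_(y <- Y) tau y * (2 * q (x + y) + 2 * q x).

Lemma solution_jointly_measurable x : jointly_measurable (v x).
Proof.
by apply: continuous_jointly_measurable;
  [exact: (rs_measurable Hv)|exact: (rs_continuous Hv)].
Qed.

Lemma noise_jointly_measurable x :
  jointly_measurable (fun r w => sigma (v x r w)).
Proof.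
apply: (measurableT_comp _ (solution_jointly_measurable x)).
exact: continuous_measurable_fun.
Qed.

Lemma drift_jointly_measurable x : jointly_measurable (drift x).
Proof.
apply: measurable_sum => y; apply: measurable_funM => //.
by apply: measurable_funB; exact: solution_jointly_measurable.
Qed.

Lemma drift_continuous x w : continuous (drift x ^~ w).
Proof.
rewrite /drift /generator_sum; elim: Y => [|y s IH] r.
  by under eq_fun do rewrite big_nil; exact: cvg_cst.
under eq_fun do rewrite big_cons.
apply: cvgD; last exact: IH.
apply: cvgM; last exact: cvg_cst.
by apply: cvgB; exact: (rs_continuous Hv).
Qed.

Lemma drift_integral_measurable x s t : measurable_fun setT (drift_integral x s t).
Proof.
apply: measurable_time_integral; last exact: drift_jointly_measurable.
exact: measurable_itv.
Qed.

Lemma E2_ae (X Z : T -> R) : measurable_fun setT X -> measurable_fun setT Z ->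
  {ae P, forall w, X w = Z w} -> E2 X = E2 Z.
Proof.
move=> mX mZ XZ; apply: ae_eq_integral => //; [exact: measurable_EFin_sqr..|].
by apply: filterS XZ => w -> _.
Qed.

(** Jensen's inequality; the weights may have a total mass below one. *)
Lemma jensen_sum (a : site -> R) :
  (\sum_(y <- Y) a y * tau y) ^+ 2 <= \sum_(y <- Y) tau y * a y ^+ 2.
Proof.
set m := \sum_(y <- Y) a y * tau y; set q := \sum_(y <- Y) tau y * a y ^+ 2.
have : 0 <= \sum_(y <- Y) tau y * (a y - m) ^+ 2.
  by apply: sumr_ge0 => y _; rewrite mulr_ge0// sqr_ge0.
have expand (b : R) : \sum_(y <- Y) tau y * (a y - b) ^+ 2 =
    q - 2 * b * m + b ^+ 2 * \sum_(y <- Y) tau y.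
  rewrite /q /m !mulr_sumr -sumrB -big_split/=.
  by apply: eq_bigr => y _; ring.
rewrite expand.
have := sqr_ge0 m; move: tau1; set t := \sum_(y <- Y) tau y; nra.
Qed.

Lemma generator_sum_E2 (f : site -> T -> R) x :
  (forall z, measurable_fun setT (f z)) ->
  (E2 (fun w => generator_sum Y tau (fun z => f z w) x) <=
   \sum_(y <- Y) (tau y)%:E * E2 (fun w => (f (x + y)%R w - f x w)%R))%E.
Proof.
move=> mf.
have mD y : measurable_fun setT (fun w => f (x + y) w - f x w).
  exact: measurable_funB.
under eq_bigr => y _.
  rewrite -ge0_integralZl ?lee_fin//; last 2 first.
  - exact: measurable_EFin_sqr.
  - by move=> w _; rewrite lee_fin sqr_ge0.
  over.
rewrite -ge0_integral_sum//; last 2 first.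
- by move=> y; apply: emeasurable_funM => //; exact: measurable_EFin_sqr.
- by move=> y w _; rewrite -EFinM lee_fin mulr_ge0// sqr_ge0.
apply: ge0_le_integral => //.
- by move=> w _; rewrite lee_fin sqr_ge0.
- apply: measurable_EFin_sqr; apply: measurable_sum => y.
  exact: measurable_funM.
- apply: emeasurable_sum => y; apply: emeasurable_funM => //.
  exact: measurable_EFin_sqr.
- by move=> w _; under eq_bigr do rewrite -EFinM; rewrite sumEFin lee_fin jensen_sum.
Qed.

Lemma generator_sum_E2_le (f : site -> T -> R) (q : site -> R) x :
  (forall z, measurable_fun setT (f z)) -> (forall z, (E2 (f z) <= (q z)%:E)%E) ->
  (E2 (fun w => generator_sum Y tau (fun z => f z w) x) <=
   (neighbour_sum q x)%:E)%E.
Proof.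
move=> mf fq; apply: (le_trans (generator_sum_E2 x mf)).
rewrite -sumEFin; apply: lee_sum => y _.
rewrite [leRHS]EFinM lee_wpmul2l ?lee_fin//.
apply: (le_trans (E2B P (mf _) (mf _))).
by rewrite [leRHS]EFinD; apply: leeD; rewrite [leRHS]EFinM lee_pmul2l.
Qed.

Lemma drift_E2 x r : (E2 (drift x r) <=
  \sum_(y <- Y) (tau y)%:E * E2 (fun w => (v (x + y)%R r w - v x r w)%R))%E.
Proof.
by apply: generator_sum_E2 => z; exact: (rs_measurable Hv).
Qed.

Lemma drift_time_E2 x s t (q : site -> R) :
  (forall z, (time_E2 s t (v z) <= (q z)%:E)%E) ->
  (time_E2 s t (drift x) <= (neighbour_sum q x)%:E)%E.
Proof.
move=> vq.
have mD y : jointly_measurable (fun r w => v (x + y) r w - v x r w).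
  by apply: jointly_measurableB; exact: solution_jointly_measurable.
have mE y : measurable_fun (`]s, t]%classic : set (measurableTypeR R))
    (fun r => E2 (fun w => (v (x + y) r w - v x r w)%R)).
  by apply: measurable_funTS; exact: (measurable_E2 P (mD y)).
apply: (@le_trans _ _ (\int[leb]_(r in `]s, t]) (\sum_(y <- Y)
    (tau y)%:E * E2 (fun w => (v (x + y) r w - v x r w)%R)))%E).
  apply: ge0_le_integral => //.
  - by move=> r _; exact: E2_ge0.
  - by apply: measurable_funTS; apply: measurable_E2; exact: drift_jointly_measurable.
  - by apply: emeasurable_sum => y; exact: emeasurable_funM.
  - by move=> r _; exact: drift_E2.
rewrite ge0_integral_sum//; last 2 first.
- by move=> y; exact: emeasurable_funM.
- by move=> y r _; rewrite mule_ge0 ?lee_fin// E2_ge0.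
rewrite -sumEFin; apply: lee_sum => y _.
rewrite ge0_integralZl//; last 2 first.
- by move=> r _; exact: E2_ge0.
- by rewrite lee_fin.
rewrite EFinM lee_wpmul2l ?lee_fin//.
have := time_E2B P s t (solution_jointly_measurable (x + y))
  (solution_jointly_measurable x).
move=> /le_trans; apply.
have -> : (2 * q (x + y) + 2 * q x)%:E =
    (2%:E * (q (x + y))%:E + 2%:E * (q x)%:E)%E by rewrite -!EFinM -EFinD.
by apply: leeD; rewrite lee_pmul2l.
Qed.

Lemma noise_time_E2 x s t :
  (time_E2 s t (fun r w => sigma (v x r w)) <= (K ^+ 2)%:E * time_E2 s t (v x))%E.
Proof.
have mv := solution_jointly_measurable x.
rewrite /time_E2 -ge0_integralZl ?lee_fin ?sqr_ge0//; last 2 first.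
- by apply: measurable_funTS; exact: measurable_E2.
- by move=> r _; exact: E2_ge0.
apply: ge0_le_integral => //.
- by move=> r _; exact: E2_ge0.
- apply: measurable_funTS; exact: (measurable_E2 P (noise_jointly_measurable x)).
- by apply: emeasurable_funM => //; apply: measurable_funTS; exact: measurable_E2.
move=> r _; have mr := rs_measurable Hv x r.
rewrite -(E2Z P K mr); apply: le_E2.
- apply: measurableT_comp mr; exact: continuous_measurable_fun.
- exact: measurable_funM.
- by move=> w; rewrite normrM (ger0_norm K0).
Qed.

Lemma noise_increment x s t : 0 <= s -> s <= t ->
  ito_limit P B x (fun r w => sigma (v x r w)) s t (fun w => N x t w - N x s w).
Proof.
move=> s0 st; have t0 := le_trans s0 st.
apply: (ito_limitB HB) => //.
- exact: noise_jointly_measurable.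
- exact: (rs_noise_measurable Hv).
- exact: (rs_noise_measurable Hv).
- exact: (rs_noise Hv).
- exact: (rs_noise Hv).
Qed.

Lemma noise_increment_measurable x s t : 0 <= s -> s <= t ->
  measurable_fun setT (fun w => N x t w - N x s w).
Proof.
move=> s0 st; have t0 := le_trans s0 st.
by apply: measurable_funB; exact: (rs_noise_measurable Hv).
Qed.

Lemma increment_equation x s t : 0 <= s -> s <= t ->
  {ae P, forall w, v x t w - v x s w =
    drift_integral x s t w + lambda * (N x t w - N x s w)}.
Proof.
move=> s0 st; have t0 := le_trans s0 st.
apply: filterS2 (rs_equation Hv x s0) (rs_equation Hv x t0) => w -> ->.
have cD : continuous (drift x ^~ w) by exact: drift_continuous.
have i0t := continuous_integrable_itv 0 t cD.
have ist := continuous_integrable_itv s t cD.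
suff -> : drift_integral x s t w = \int[leb]_(r in `[0, t]) drift x r w -
    \int[leb]_(r in `[0, s]) drift x r w by rewrite /drift; ring.
rewrite Rintegral_itvB//.
rewrite /drift_integral Rintegral_itv_obnd_cbnd//.
by apply: integrableS ist => //; exact: subset_itv_oc_cc.
Qed.

Lemma noise_increment_E2 x s t (q : R) : 0 <= s -> s <= t ->
  (time_E2 s t (v x) <= q%:E)%E ->
  (E2 (fun w => (N x t w - N x s w)%R) <= (4 * kappa * K ^+ 2 * q)%:E)%E.
Proof.
move=> s0 st vq.
have mI := noise_increment_measurable x s0 st.
apply: (le_trans (ito_limit_le HB s0 st (noise_jointly_measurable x) mI
  (noise_increment x s0 st))).
have k0 := @normal_second_ge0 R.
rewrite -mulrA [leRHS]EFinM lee_wpmul2l ?lee_fin ?mulr_ge0//.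
apply: (le_trans (noise_time_E2 x s t)).
by rewrite [leRHS]EFinM lee_wpmul2l// lee_fin sqr_ge0.
Qed.

Lemma drift_integral_E2 x s t (q : site -> R) : s <= t ->
  (forall z, (time_E2 s t (v z) <= (q z)%:E)%E) ->
  (E2 (drift_integral x s t) <= ((t - s) * neighbour_sum q x)%:E)%E.
Proof.
move=> st vq.
apply: (le_trans (E2_time_integral P st (drift_jointly_measurable x)
  (@drift_continuous x))).
by rewrite [leRHS]EFinM lee_wpmul2l ?lee_fin ?subr_ge0// drift_time_E2.
Qed.

Lemma increment_E2 x s t (q : site -> R) : 0 <= s -> s <= t ->
  (forall z, (time_E2 s t (v z) <= (q z)%:E)%E) ->
  (E2 (fun w => (v x t w - v x s w)%R) <= (2 * (t - s) * neighbour_sum q x +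
    8 * lambda ^+ 2 * kappa * K ^+ 2 * q x)%:E)%E.
Proof.
move=> s0 st vq.
have mI := noise_increment_measurable x s0 st.
rewrite (E2_ae _ _ (increment_equation x s0 st)); last 2 first.
- by apply: measurable_funB; exact: (rs_measurable Hv).
- apply: measurable_funD; first exact: drift_integral_measurable.
  exact: measurable_funM.
apply: (le_trans (E2D P (drift_integral_measurable x s t) _)).
  exact: measurable_funM.
rewrite E2Z// [leRHS]EFinD; apply: leeD.
  by rewrite -mulrA [leRHS]EFinM lee_pmul2l// drift_integral_E2.
rewrite (_ : 8 * _ * _ * _ * _ =
  2 * (lambda ^+ 2 * (4 * kappa * K ^+ 2 * q x))); last by ring.
rewrite [leRHS]EFinM lee_pmul2l// [leRHS]EFinM lee_wpmul2l ?lee_fin ?sqr_ge0//.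
exact: noise_increment_E2.
Qed.

Lemma neighbour_sum_ge0 (q : site -> R) x : (forall z, 0 <= q z) ->
  0 <= neighbour_sum q x.
Proof.
by move=> q0; apply: sumr_ge0 => y _; rewrite mulr_ge0// addr_ge0// mulr_ge0.
Qed.

(** The partial sums over finite sets of sites are bounded. *)
Definition summable_over_sites (g : site -> R) :=
  exists C : R, forall A : seq site, uniq A -> \sum_(x <- A) g x <= C.

Lemma summable_neighbour_sum (q : site -> R) : (forall z, 0 <= q z) ->
  summable_over_sites q -> summable_over_sites (neighbour_sum q).
Proof.
move=> q0 [C HC]; exists (4 * C) => A uA.
have C0 : 0 <= C by have := HC [::] isT; rewrite big_nil.
rewrite /neighbour_sum exchange_big/=.
apply: (@le_trans _ _ (\sum_(y <- Y) tau y * (4 * C))); last first.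
  by rewrite -mulr_suml ler_piMl// mulr_ge0.
apply: ler_sum => y _; rewrite -mulr_sumr ler_wpM2l//.
rewrite big_split/= -!mulr_sumr.
have := HC A uA; have := HC (map (fun x => x + y) A).
rewrite big_map map_inj_uniq//; last by move=> a b /addIr.
by move=> /(_ uA); lra.
Qed.

(** Summability of the second moments integrated over time improves to
summability of their suprema over bounded time intervals: by the equation, the
second moment at time t is at most a combination of integrated second moments
at neighbouring sites. *)
Lemma moment_bound (tmax : R) : 0 < tmax -> exists g : site -> R,
  [/\ forall x, 0 <= g x,
      forall x (t : R), 0 <= t <= tmax -> (E2 (v x t) <= (g x)%:E)%E &
      summable_over_sites g].
Proof.
move=> tmax0.
have k0 := @normal_second_ge0 R.
pose q x := fine (time_E2 0 tmax (v x)).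
have q0 x : 0 <= q x by rewrite fine_ge0// time_E2_ge0.
have fin := rs_moment Hv tmax0.
have sumE (A : seq site) : uniq A ->
    (\sum_(x <- A) time_E2 0 tmax (v x) <=
     \esum_(x in [set: site]) time_E2 0 tmax (v x))%E.
  move=> uA; apply: esum_ge; exists [set` A].
    by split; [exact: finite_seq|].
  by rewrite fsbig_seq.
have qE x : time_E2 0 tmax (v x) = (q x)%:E.
  rewrite fineK// ge0_fin_numE ?time_E2_ge0//.
  apply: le_lt_trans fin; have := sumE [:: x] isT.
  by rewrite big_seq1.
have qsum : summable_over_sites q.
  exists (fine (\esum_(x in [set: site]) time_E2 0 tmax (v x))%E) => A uA.
  rewrite -lee_fin fineK; last first.
    by rewrite ge0_fin_numE// esum_ge0// => x _; exact: time_E2_ge0.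
  by rewrite -sumEFin; under eq_bigr do rewrite -qE; exact: sumE.
pose g x := 2 * (c0 ^+ 2 * (x == 0)%:R) + 2 * (2 * tmax * neighbour_sum q x +
    8 * lambda ^+ 2 * kappa * K ^+ 2 * q x).
have ns0 x := neighbour_sum_ge0 x q0.
have c8 : 0 <= 8 * lambda ^+ 2 * kappa * K ^+ 2.
  by rewrite mulr_ge0 ?sqr_ge0// mulr_ge0// mulr_ge0 ?sqr_ge0.
exists g; split.
- move=> x; apply: addr_ge0; apply: mulr_ge0 => //.
    by apply: mulr_ge0; rewrite ?sqr_ge0 ?ler0n.
  apply: addr_ge0; last exact: mulr_ge0.
  by apply: mulr_ge0 => //; apply: mulr_ge0 => //; exact: ltW.
- move=> x t /andP[t0 tt].
  have mI := rs_measurable Hv x.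
  have -> : v x t = (fun w => v x 0 w + (v x t w - v x 0 w)).
    by apply/funext => w; ring.
  apply: (le_trans (E2D P (mI 0) (measurable_funB (mI t) (mI 0)))).
  rewrite /g [leRHS]EFinD; apply: leeD; rewrite [leRHS]EFinM lee_pmul2l//.
    rewrite (E2_ae (mI 0) _ (rs_initial Hv x)); last exact: measurable_cst.
    rewrite E2_cst lee_fin exprMn -natrX; case: (x == 0); rewrite ?mulr1 ?lexx//.
  apply: (@le_trans _ _ (2 * (t - 0) * neighbour_sum q x +
    8 * lambda ^+ 2 * kappa * K ^+ 2 * q x)%:E).
    apply: (@increment_E2 x 0 t) => // z; rewrite -qE; apply: subset_time_E2 => //.
    exact: solution_jointly_measurable.
  rewrite lee_fin lerD2r subr0 ler_wpM2r// ler_wpM2l//.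
- have [C1 H1] := summable_neighbour_sum q0 qsum; have [C2 H2] := qsum.
  exists (2 * c0 ^+ 2 + 2 * (2 * tmax * C1 +
    8 * lambda ^+ 2 * kappa * K ^+ 2 * C2)) => A uA.
  rewrite /g big_split/= -!mulr_sumr big_split/= -!mulr_sumr.
  apply: lerD.
    rewrite ler_wpM2l// ler_piMr ?sqr_ge0//.
    have [iA|iA] := boolP (0 \in A); last first.
      rewrite big_seq big1// => x xA; case: eqP => // x0.
      by move: iA; rewrite -x0 xA.
    by rewrite (bigD1_seq 0)//= eqxx big1 ?addr0// => x /negbTE ->.
  rewrite ler_wpM2l//; apply: lerD; last by rewrite ler_wpM2l// H2.
  by rewrite ler_wpM2l ?mulr_ge0 ?(ltW tmax0)// H1.
Qed.

(** Mean square Hoelder continuity of exponent one half. *)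
Lemma continuity_bound (tmax : R) (g : site -> R) : (forall x, 0 <= g x) ->
  (forall x (t : R), 0 <= t <= tmax -> (E2 (v x t) <= (g x)%:E)%E) ->
  forall x (s t : R), 0 <= s -> s <= t -> t <= tmax ->
  (E2 (fun w => (v x t w - v x s w)%R) <= ((2 * tmax * neighbour_sum g x +
    8 * lambda ^+ 2 * kappa * K ^+ 2 * g x) * (t - s))%:E)%E.
Proof.
move=> g0 vg x s t s0 st tt.
have ts0 : 0 <= t - s by rewrite subr_ge0.
have vq z : (time_E2 s t (v z) <= (g z * (t - s))%:E)%E.
  apply: time_E2_le_cst => //; first exact: solution_jointly_measurable.
  move=> r /andP[sr rt]; apply: vg.
  by rewrite (le_trans s0 (ltW sr)) (le_trans rt tt).
apply: (le_trans (increment_E2 x s0 st vq)).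
have -> : neighbour_sum (fun z => g z * (t - s)) x = neighbour_sum g x * (t - s).
  by rewrite /neighbour_sum mulr_suml; apply: eq_bigr => y _; ring.
rewrite lee_fin [leRHS]mulrDl !mulrA lerD2r ler_wpM2r// ler_wpM2r//.
  exact: neighbour_sum_ge0.
by rewrite ler_wpM2l// lerBlDr (le_trans tt)// lerDl.
Qed.

End moments.

(** * One time step of the solution *)

Section truncation.
Context {R : realType} {d : measure_display} {T : measurableType d}.
Variable P : probability T R.
Local Notation E2 := (E2 P).

Definition truncate (M y : R) : R := y * \1_(`[- M, M]%classic) y.

Lemma truncate_measurable M : measurable_fun setT (truncate M).
Proof.
by apply: measurable_funM => //; apply: measurable_indic; exact: measurable_itv.
Qed.

Lemma truncate_le M y : `|truncate M y| <= `|y|.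
Proof.
by rewrite /truncate indicE normrM ler_piMr//; case: (_ \in _);
  rewrite ?normr1 ?normr0.
Qed.

Lemma truncate_bounded M y : 0 <= M -> `|truncate M y| <= M.
Proof.
move=> M0; rewrite /truncate indicE; case: (boolP (y \in _)) => h.
  by move: h; rewrite mem_setE in_itv/= -ler_norml mulr1.
by rewrite mulr0 normr0.
Qed.

Lemma truncate_id M y : `|y| <= M -> truncate M y = y.
Proof.
by move=> yM; rewrite /truncate indicE mem_setE in_itv/= -ler_norml yM mulr1.
Qed.

(** Step processes have bounded heights; a square integrable variable becomes one
of them after truncation, at a small cost. *)
Lemma truncate_approx (X : T -> R) (eta : R) : measurable_fun setT X ->
  (E2 X < +oo)%E -> 0 < eta -> exists2 M : R, 0 <= M &
    (E2 (fun w => (X w - truncate M (X w))%R) <= eta%:E)%E.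
Proof.
move=> mX fX eta0.
pose f k w := ((X w - truncate k%:R (X w)) ^+ 2)%:E.
have mf k : measurable_fun setT (f k).
  apply: measurable_EFin_sqr; apply: measurable_funB => //.
  exact: measurableT_comp (truncate_measurable _) mX.
have sqr_le k w : (X w - truncate k%:R (X w)) ^+ 2 <= X w ^+ 2.
  rewrite /truncate indicE; case: (_ \in _); rewrite ?mulr1 ?mulr0 ?subr0//.
  by rewrite subrr expr0n sqr_ge0.
have f0 : {ae P, forall w, setT w -> f^~ w @ \oo --> 0%E}.
  apply: aeW => w _; apply: cvg_near_cst; near=> k.
  rewrite /f truncate_id ?subrr ?expr0n//; near: k.
  exact: nbhs_infty_ger.
have fX2 : {ae P, forall w k, setT w -> (`|f k w| <= (X w ^+ 2)%:E)%E}.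
  by apply: aeW => w k _; rewrite /f lee_fin ger0_norm ?sqr_ge0.
have [_ _] := dominated_convergence measurableT mf (measurable_cst 0%E) f0
  (intg_sqr mX fX) fX2.
rewrite integral0 => cvg0.
have /cvg0 [k _ near] : nbhs 0%E [set y : \bar R | (y < eta%:E)%E].
  by apply: open_ereal_lt'; rewrite lte_fin.
exists k%:R; first exact: ler0n.
by apply: ltW; exact: (near k (leqnn k)).
Unshelve. all: by end_near.
Qed.

End truncation.

Section site_estimates.
Context {R : realType} {d : measure_display} {T : measurableType d}.
Variables (P : probability T R) (n : nat).
Local Notation site := 'rV[int]_n.
Local Notation leb := (@lebesgue_measure R).
Local Notation E2 := (E2 P).
Local Notation Ex := (Ex P).
Local Notation intg := (intg P).
Local Notation time_E2 := (time_E2 P).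
Local Notation kappa := (@normal_second R).
Variable B : site -> R -> T -> R.
Local Notation F := (brownian_filtration P B).
Local Notation dB x := (increment (B x)).
Hypothesis HB : brownian_field P B.
Variables (Y : seq site) (tau : site -> R) (sigma : R -> R) (c0 lambda K : R).
Hypothesis tau0 : forall y, 0 <= tau y.
Hypothesis tau1 : \sum_(y <- Y) tau y <= 1.
Hypothesis K0 : 0 <= K.
Hypothesis sigma_cont : continuous sigma.
Hypothesis sigma_lip : forall a b, `|sigma a - sigma b| <= K * `|a - b|.
Hypothesis sigma_growth : forall a, `|sigma a| <= K * `|a|.
Variables v N : site -> R -> T -> R.
Hypothesis Hv : regular_solution P B Y tau sigma c0 lambda v N.
Local Notation drift := (drift Y tau v).
Local Notation neighbour_sum := (neighbour_sum Y tau).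

Variables (tmax : R) (g c : site -> R).
Hypothesis g0 : forall x, 0 <= g x.
Hypothesis vg : forall x (t : R), 0 <= t <= tmax -> (E2 (v x t) <= (g x)%:E)%E.
Hypothesis cont0 : forall x, 0 <= c x.
Hypothesis vc : forall x (s t : R), 0 <= s -> s <= t -> t <= tmax ->
  (E2 (fun w => (v x t w - v x s w)%R) <= (c x * (t - s))%:E)%E.

Variables (s t : R).
Hypotheses (s0 : 0 <= s) (st : s < t) (tt : t <= tmax).
Local Notation h := (t - s).

Let h0 : 0 < h. Proof. by rewrite subr_gt0. Qed.
Let st' : s <= t. Proof. exact: ltW. Qed.
Let t0 : 0 <= t. Proof. exact: le_trans st'. Qed.

Definition step x w : R := v x t w - v x s w.

Lemma step_measurable x : measurable_fun setT (step x).
Proof. by apply: measurable_funB; exact: (rs_measurable Hv). Qed.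

Lemma step_E2_lty x : (E2 (step x) < +oo)%E.
Proof. by apply: le_lt_trans (ltry _); exact: vc. Qed.

Let noise_const x := 8 * kappa * (K ^+ 2 * c x + 1).

(** The noise coefficient is frozen at time s and truncated, which makes the
corresponding part of the step an increment of the Brownian motion times a
bounded variable of the past. The error has a second moment of order h^2: freezing
changes the coefficient by an amount with second moment of order h, which is also
the precision chosen for the truncation, and the isometry gains another factor h;
the drift contributes a time integral over a step. *)
Lemma step_approx x : exists xi : T -> R,
  [/\ sub_measurable (F s) xi,
      exists M : R, forall w, `|xi w| <= M,
      forall w, `|xi w| <= K * `|v x s w| &
      (E2 (fun w => (step x w - lambda * (xi w * dB x s t w))%R) <=
       ((4 * neighbour_sum g x + 2 * lambda ^+ 2 * noise_const x * 2) * h ^+ 2)%:E)%E].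
Proof.
have k0 := @normal_second_ge0 R.
have ms : measurable_fun setT sigma by exact: continuous_measurable_fun.
have mvs := rs_measurable Hv x s.
pose S w := sigma (v x s w).
have mS : measurable_fun setT S by exact: measurableT_comp.
have sst : 0 <= s <= tmax by rewrite s0 (le_trans st').
have fS : (E2 S < +oo)%E.
  apply: (@le_lt_trans _ _ (E2 (fun w => K * v x s w))).
    apply: le_E2 => //; first exact: measurable_funM.
    by move=> w; rewrite normrM (ger0_norm K0) sigma_growth.
  rewrite E2Z// lte_mul_pinfty ?lee_fin ?sqr_ge0//.
  exact: le_lt_trans (vg x sst) (ltry _).
have [M M0 EM] := truncate_approx mS fS h0.
pose xi w := truncate M (S w).
have Fxi : sub_measurable (F s) xi.
  move=> C mC; have mtr : measurable ((fun y => truncate M (sigma y)) @^-1` C).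
    have := measurableT_comp (truncate_measurable M) ms.
    by move=> /(_ measurableT C mC); rewrite setTI.
  exact: (rs_adapted Hv x s0 mtr).
have bxi w : `|xi w| <= M by exact: truncate_bounded.
exists xi; split => //; first by exists M.
  by move=> w; apply: (le_trans (truncate_le _ _)); exact: sigma_growth.
have mxi := sub_measurable_measurable HB Fxi.
pose Nst w := N x t w - N x s w.
have mN : measurable_fun setT Nst by exact: (noise_increment_measurable Hv).
have mdB : measurable_fun setT (dB x s t) by exact: (increment_measurable HB).
have mH := noise_jointly_measurable sigma_cont Hv x.
have tH : (time_E2 s t (fun r w => (sigma (v x r w) - xi w)%R) <=
    ((2 * (K ^+ 2 * c x) + 2) * h * h)%:E)%E.
  apply: time_E2_le_cst => //.
    by apply: jointly_measurableB => //; exact: jointly_measurable_const.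
  move=> r /andP[sr rt].
  have mvr := rs_measurable Hv x r.
  have mSr : measurable_fun setT (fun w => sigma (v x r w)) by exact: measurableT_comp.
  have -> : (fun w => sigma (v x r w) - xi w) =
      (fun w => (sigma (v x r w) - S w) + (S w - xi w)).
    by apply/funext => w; ring.
  apply: (le_trans (E2D P (measurable_funB mSr mS) (measurable_funB mS mxi))).
  rewrite mulrDl [leRHS]EFinD; apply: leeD.
    rewrite -mulrA [leRHS]EFinM lee_pmul2l//.
    apply: (@le_trans _ _ (E2 (fun w => K * (v x r w - v x s w)))).
      apply: le_E2; [exact: measurable_funB| |].
        by apply: measurable_funM => //; exact: measurable_funB.
      by move=> w; rewrite normrM (ger0_norm K0); exact: sigma_lip.
    rewrite E2Z; last exact: measurable_funB.
    rewrite -mulrA [leRHS]EFinM lee_wpmul2l ?lee_fin ?sqr_ge0//.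
    apply: (le_trans (vc x s0 (ltW sr) (le_trans rt tt))).
    by rewrite lee_fin ler_wpM2l// lerD2r.
  by rewrite [leRHS]EFinM lee_pmul2l.
have EN : (E2 (fun w => (Nst w - xi w * dB x s t w)%R) <=
    (noise_const x * h ^+ 2)%:E)%E.
  apply: (le_trans (ito_limit_increment_le HB s0 st' mH mN
    (noise_increment HB sigma_cont Hv x s0 st') Fxi bxi)).
  apply: (@le_trans _ _ ((4 * kappa)%:E *
    ((2 * (K ^+ 2 * c x) + 2) * h * h)%:E)%E).
    by rewrite lee_wpmul2l// lee_fin mulr_ge0.
  rewrite -EFinM lee_fin le_eqVlt; apply/orP; left; apply/eqP.
  by rewrite /noise_const; ring.
have mDI := drift_integral_measurable Hv x s t.
have mNx : measurable_fun setT (fun w => Nst w - xi w * dB x s t w).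
  by apply: measurable_funB => //; exact: measurable_funM.
have -> : E2 (fun w => step x w - lambda * (xi w * dB x s t w)) =
    E2 (fun w => drift_integral Y tau v x s t w +
                 lambda * (Nst w - xi w * dB x s t w)).
  apply: E2_ae.
  - apply: measurable_funB; first exact: step_measurable.
    by apply: measurable_funM => //; exact: measurable_funM.
  - by apply: measurable_funD => //; exact: measurable_funM.
  - apply: filterS (increment_equation Hv x s0 st') => w.
    by rewrite /step => ->; rewrite /Nst; ring.
apply: (le_trans (E2D P mDI (measurable_funM (measurable_cst lambda) mNx))).
have vq z : (time_E2 s t (v z) <= (g z * h)%:E)%E.
  apply: time_E2_le_cst => //; first exact: (solution_jointly_measurable Hv).
  move=> r /andP[sr rt]; apply: vg.
  by rewrite (le_trans s0 (ltW sr)) (le_trans rt tt).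
have ED := drift_integral_E2 tau0 tau1 Hv x st' vq.
have nsE : neighbour_sum (fun z => g z * h) x = neighbour_sum g x * h.
  by rewrite /neighbour_sum mulr_suml; apply: eq_bigr => y _; ring.
rewrite nsE in ED.
have EL : (E2 (fun w => (lambda * (Nst w - xi w * dB x s t w))%R) <=
   (lambda ^+ 2 * (noise_const x * h ^+ 2))%:E)%E.
  by rewrite E2Z// [leRHS]EFinM lee_wpmul2l ?lee_fin ?sqr_ge0.
apply: (@le_trans _ _ (2%:E * (h * (neighbour_sum g x * h))%:E +
   2%:E * (lambda ^+ 2 * (noise_const x * h ^+ 2))%:E)%E).
  by apply: leeD; rewrite lee_pmul2l.
rewrite -!EFinM -EFinD lee_fin.
have ns0 : 0 <= neighbour_sum g x by exact: (neighbour_sum_ge0 Y tau0).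
have nc0 : 0 <= noise_const x.
  by rewrite /noise_const; apply: mulr_ge0; [exact: mulr_ge0|
    apply: addr_ge0 => //; apply: mulr_ge0; rewrite ?sqr_ge0].
have hh : 0 <= h ^+ 2 by exact: sqr_ge0.
have a1 : 0 <= neighbour_sum g x * h ^+ 2 by exact: mulr_ge0.
have a2 : 0 <= lambda ^+ 2 * noise_const x * h ^+ 2.
  by rewrite mulr_ge0// mulr_ge0 ?sqr_ge0.
lra.
Qed.

(** The noise has mean zero against the past, and over a short step the drift is
the drift at time s to first order. The error is a first moment, bounded by
Young's inequality with the free parameter e, which is chosen later. *)
Lemma step_mean x (Z : T -> R) (M e : R) : sub_measurable (F s) Z ->
  (forall w, `|Z w| <= M) -> 0 < e ->
  intg (fun w => Z w * step x w) /\ intg (fun w => Z w * drift x s w) /\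
  `|Ex (fun w => Z w * step x w) - h * Ex (fun w => Z w * drift x s w)| <=
    M * (h * e + neighbour_sum c x * h ^+ 2 / e).
Proof.
move=> FZ bZ e0.
have mZ := sub_measurable_measurable HB FZ.
have mvz z r : measurable_fun setT (v z r) by exact: (rs_measurable Hv).
have mD0 : measurable_fun setT (drift x s).
  exact: (jointly_measurable_section s (drift_jointly_measurable Hv x)).
have mDI := drift_integral_measurable Hv x s t.
have vq z : (time_E2 s t (v z) <= (g z * h)%:E)%E.
  apply: time_E2_le_cst => //; first exact: (solution_jointly_measurable Hv).
  move=> r /andP[sr rt]; apply: vg.
  by rewrite (le_trans s0 (ltW sr)) (le_trans rt tt).
have iDI : intg (drift_integral Y tau v x s t).
  apply: intg_of_sqr => //.
  apply: (le_lt_trans (drift_integral_E2 tau0 tau1 Hv x st' vq)).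
  exact: ltry.
have iD0 : intg (drift x s).
  apply: intg_of_sqr => //; apply: (@le_lt_trans _ _ (neighbour_sum g x)%:E).
    apply: (generator_sum_E2_le tau0 tau1) => // z; apply: vg.
    by rewrite s0 (le_trans st').
  exact: ltry.
have iS : intg (step x).
  by apply: intg_of_sqr; [exact: step_measurable|exact: step_E2_lty].
have iZS := intgM_bounded mZ bZ iS; have iZD0 := intgM_bounded mZ bZ iD0.
have iZDI := intgM_bounded mZ bZ iDI.
split => //; split => //.
have mN : measurable_fun setT (fun w => N x t w - N x s w).
  exact: (noise_increment_measurable Hv).
have limN := noise_increment HB sigma_cont Hv x s0 st'.
have mH := noise_jointly_measurable sigma_cont Hv x.
have iN : intg (fun w => N x t w - N x s w).
  apply: intg_of_sqr => //.
  apply: (le_lt_trans (noise_increment_E2 HB K0 sigma_cont sigma_growth Hv s0 st' (vq x))).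
  exact: ltry.
have EN : Ex (fun w => Z w * (N x t w - N x s w)) = 0.
  exact: (ito_limit_mean HB s0 mN limN FZ bZ).
have iZN := intgM_bounded mZ bZ iN.
have ES : Ex (fun w => Z w * step x w) =
    Ex (fun w => Z w * drift_integral Y tau v x s t w).
  transitivity (Ex (fun w => Z w * drift_integral Y tau v x s t w +
     lambda * (Z w * (N x t w - N x s w)))); last first.
    by rewrite ExD ?ExZ ?EN ?mulr0 ?addr0//; exact: intgZ.
  rewrite /Ex; congr fine; apply: ae_eq_integral => //.
  - by apply/measurable_EFinP; apply: measurable_funM => //; exact: step_measurable.
  - apply/measurable_EFinP; apply: measurable_funD; first exact: measurable_funM.
    by apply: measurable_funM => //; exact: measurable_funM.
  - apply: filterS (increment_equation Hv x s0 st') => w.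
    by rewrite /step => -> _; congr EFin; ring.
pose D w := drift_integral Y tau v x s t w - h * drift x s w.
have iD : intg D by apply: intgB => //; exact: intgZ.
have mD := intg_measurable iD.
have -> : Ex (fun w => Z w * step x w) - h * Ex (fun w => Z w * drift x s w) =
    Ex (fun w => Z w * D w).
  rewrite ES -ExZ// -ExB//; last exact: intgZ.
  by congr (Ex _); apply/funext => w; rewrite /D; ring.
have DE w : D w = \int[leb]_(r in `[s, t])
    generator_sum Y tau (fun z => v z r w - v z s w) x.
  rewrite /D -[h * _]mulrC -Rintegral_itv_cst//.
  have cD : continuous (drift x ^~ w) by exact: (drift_continuous Hv).
  rewrite /drift_integral -RintegralB//; last 2 first.
  - exact: continuous_integrable_itv.
  - by apply: continuous_integrable_itv => r; exact: cvg_cst.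
  apply: eq_Rintegral => r _; rewrite /drift /generator_sum -sumrB.
  by apply: eq_bigr => y _; ring.
have ED : (E2 D <= (h * (neighbour_sum c x * h * h))%:E)%E.
  rewrite (_ : D = fun w => \int[leb]_(r in `[s, t])
    generator_sum Y tau (fun z => v z r w - v z s w) x); last exact/funext.
  have mG : jointly_measurable
      (fun r w => generator_sum Y tau (fun z => v z r w - v z s w) x).
    have mi z : jointly_measurable (fun r w => v z r w - v z s w).
      apply: jointly_measurableB; first exact: (solution_jointly_measurable Hv).
      exact: jointly_measurable_const.
    apply: measurable_sum => y; apply: measurable_funM => //.
    by apply: measurable_funB; exact: mi.
  have cG w : continuous
      ((fun r w => generator_sum Y tau (fun z => v z r w - v z s w) x) ^~ w).
    have -> : ((fun r w => generator_sum Y tau (fun z => v z r w - v z s w) x) ^~ w)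
       = (fun r => drift x r w - drift x s w).
      apply/funext => r; rewrite /drift /generator_sum -sumrB.
      by apply: eq_bigr => y _; ring.
    have cD : continuous (drift x ^~ w) by exact: (drift_continuous Hv).
    by move=> r; apply: cvgB; [exact: cD|exact: cvg_cst].
  apply: (le_trans (E2_time_integral P st' mG cG)).
  rewrite [leRHS]EFinM lee_pmul2l// time_E2_le_cst// => r /andP[sr rt].
  have -> : neighbour_sum c x * h = neighbour_sum (fun z => c z * h) x.
    by rewrite /neighbour_sum mulr_suml; apply: eq_bigr => y _; ring.
  apply: (generator_sum_E2_le tau0 tau1) => [z|z]; first exact: measurable_funB.
  apply: (le_trans (vc z s0 (ltW sr) (le_trans rt tt))).
  by rewrite lee_fin ler_wpM2l// lerD2r.
have iD2 : intg (fun w => D w ^+ 2).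
  by apply: intg_sqr => //; exact: le_lt_trans ED (ltry _).
have ED2 : Ex (fun w => D w ^+ 2) <= h * (neighbour_sum c x * h * h).
  by rewrite -lee_fin -E2E.
have iZD := intgM_bounded mZ bZ iD.
have he0 : 0 < h * e by exact: mulr_gt0.
have M0 := bound_ge0 P bZ.
pose W w := M * (h * e) + M * (h * e)^-1 * D w ^+ 2.
have iW : intg W by apply: intgD; [exact: (intg_cst P)|exact: intgZ].
have ZDW w : `|Z w * D w| <= W w.
  rewrite normrM /W -mulrA -mulrDr; apply: ler_pM => //.
  exact: young_abs.
have -> : M * (h * e + neighbour_sum c x * h ^+ 2 / e) =
    M * (h * e) + M * (h * e)^-1 * (h * (neighbour_sum c x * h * h)).
  by field; rewrite !gt_eqF.
apply: (@le_trans _ _ (Ex W)).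
  rewrite ler_norml; apply/andP; split.
    rewrite lerNl -[leLHS]mulN1r -ExZ//; apply: le_Ex => //; first exact: intgZ.
    by move=> w; rewrite mulN1r; apply: le_trans (ZDW w); rewrite -normrN ler_norm.
  by apply: le_Ex => // w; exact: le_trans (ler_norm _) (ZDW w).
rewrite /W ExD; [|exact: (intg_cst P)|exact: intgZ].
rewrite (Ex_cst P) ExZ// lerD2l ler_wpM2l// mulr_ge0// invr_ge0 ltW//.
Qed.

End site_estimates.

(** * The inverse energy under a displacement *)

Section inequalities.
Context {R : realType}.

Lemma cauchy_sum (I : Type) (s : seq I) (a b : I -> R) :
  (\sum_(i <- s) a i * b i) ^+ 2 <=
  (\sum_(i <- s) a i ^+ 2) * (\sum_(i <- s) b i ^+ 2).
Proof.
set p := \sum_(i <- s) a i * b i; set q := \sum_(i <- s) a i ^+ 2.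
set r := \sum_(i <- s) b i ^+ 2.
have quadratic m : 0 <= m ^+ 2 * q + 2 * m * p + r.
  have -> : m ^+ 2 * q + 2 * m * p + r = \sum_(i <- s) (m * a i + b i) ^+ 2.
    rewrite /p /q /r !mulr_sumr -!big_split/=.
    by apply: eq_bigr => i _; ring.
  by apply: sumr_ge0 => i _; rewrite sqr_ge0.
have q0 : 0 <= q by apply: sumr_ge0 => i _; rewrite sqr_ge0.
move: q0; rewrite le_eqVlt => /predU1P[q0|q0].
  have [->|p0] := eqVneq p 0; first by rewrite -q0 expr0n mul0r.
  have := quadratic (- (r + 1) / (2 * p)); rewrite -q0 mulr0 add0r.
  have -> : 2 * (- (r + 1) / (2 * p)) * p = - (r + 1) by field.
  by lra.
have := quadratic (- p / q).
have -> : (- p / q) ^+ 2 * q + 2 * (- p / q) * p + r = r - p ^+ 2 / q.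
  by field; rewrite gt_eqF.
by rewrite subr_ge0 ler_pdivrMr// mulrC.
Qed.

Lemma sqr_sum_le (I : Type) (s : seq I) (b : I -> R) :
  (\sum_(i <- s) b i) ^+ 2 <= (size s)%:R * \sum_(i <- s) b i ^+ 2.
Proof.
have := cauchy_sum s (fun=> 1) b.
rewrite (eq_bigr b) => [|i _]; last by rewrite mul1r.
rewrite [X in _ <= X * _](_ : _ = (size s)%:R)//.
by rewrite big_const_seq count_predT expr1n iter_addr_0.
Qed.

Lemma sum_sub_le (I : eqType) (s1 s2 : seq I) (f : I -> R) : uniq s1 ->
  {subset s1 <= s2} -> (forall i, 0 <= f i) ->
  \sum_(i <- s1) f i <= \sum_(i <- s2) f i.
Proof.
move=> + + f0; elim: s1 s2 => [|i s IH] s2 /=.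
  by move=> _ _; rewrite big_nil; exact: sumr_ge0.
move=> /andP[ni us] sub; have i2 : i \in s2 by apply: sub; rewrite mem_head.
rewrite big_cons (big_rem i i2)/= lerD2l; apply: IH => // j js.
have ji : j != i by apply: contraNneq ni => <-.
have : j \in s2 by apply: sub; rewrite inE js orbT.
by rewrite (perm_mem (perm_to_rem i2)) inE (negbTE ji).
Qed.

(** A second order Taylor bound for the inverse of eps + |a|^2 when a moves by a
vector of squared length D, with p the scalar product of a and that vector. If D
is small compared with A = eps + S, the bound comes from the expansion; otherwise
one of X and W is at least A / 64, and the crude bound 1 / eps is paid for by
X^2 or by W. *)
Lemma inverse_step (eps S p D X W : R) : 0 < eps -> 0 <= S -> 0 <= D ->
  0 <= X -> 0 <= W -> p ^+ 2 <= S * D -> D <= 2 * X + 2 * W ->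
  0 <= S + 2 * p + D ->
  (eps + (S + 2 * p + D))^-1 + 2 * p * (eps + S)^-1 ^+ 2 <=
  (eps + S)^-1 + 34 * X * (eps + S)^-1 ^+ 2 +
  4096 * eps^-1 * X ^+ 2 * (eps + S)^-1 ^+ 2 + 98 * eps^-1 ^+ 2 * W.
Proof.
move=> eps0 S0 D0 X0 W0 pS DXW B0.
have A0 : 0 < eps + S by rewrite ltr_pwDl.
have Bge : 0 < eps + (S + 2 * p + D) by rewrite ltr_pwDl.
have ik : (eps + S)^-1 <= eps^-1 by rewrite lef_pV2 ?posrE// lerDl.
have jk : (eps + (S + 2 * p + D))^-1 <= eps^-1 by rewrite lef_pV2 ?posrE// lerDl.
have Ai : (eps + S) * (eps + S)^-1 = 1 by rewrite divff// gt_eqF.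
have Bj : (eps + (S + 2 * p + D)) * (eps + (S + 2 * p + D))^-1 = 1.
  by rewrite divff// gt_eqF.
have i0 : 0 < (eps + S)^-1 by rewrite invr_gt0.
have j0 : 0 < (eps + (S + 2 * p + D))^-1 by rewrite invr_gt0.
have SA : S <= eps + S by rewrite lerDr ltW.
have BE : eps + (S + 2 * p + D) = (eps + S) + 2 * p + D by ring.
move: A0 Bge ik jk Ai Bj i0 j0 SA BE.
set A := eps + S; set Bb := eps + (S + 2 * p + D).
set i := A^-1; set j := Bb^-1; set k := eps^-1.
move=> A0 Bge ik jk Ai Bj i0 j0 SA BE.
have i20 : 0 <= i ^+ 2 by rewrite sqr_ge0.
have i2k : i ^+ 2 <= k ^+ 2 by rewrite ler_sqr ?nnegrE ?(ltW i0)// (le_trans (ltW i0)).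
have k0 : 0 < k by exact: lt_le_trans ik.
have WiWk : W * i ^+ 2 <= k ^+ 2 * W by rewrite mulrC ler_wpM2r.
have Xi : 0 <= X * i ^+ 2 by exact: mulr_ge0.
have DXWi : D * i ^+ 2 <= 2 * (X * i ^+ 2) + 2 * (k ^+ 2 * W).
  have : D * i ^+ 2 <= (2 * X + 2 * W) * i ^+ 2 by rewrite ler_wpM2r.
  by lra.
have kW : 0 <= k ^+ 2 * W by rewrite mulr_ge0// sqr_ge0.
have kX : 0 <= k * (X ^+ 2 * i ^+ 2).
  by rewrite mulr_ge0 ?(ltW k0)// mulr_ge0// sqr_ge0.
rewrite -/i -/j.
have [DA|DA] := leP (16 * D) A.
  have AD : 0 <= A * D by rewrite mulr_ge0// ltW.
  have pAD : p ^+ 2 <= A * D by apply: (le_trans pS); rewrite ler_wpM2r.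
  have pA : 4 * `|p| <= A.
    rewrite -ler_sqr ?nnegrE ?mulr_ge0// ?(ltW A0)// exprMn real_normK ?num_real//.
    by nra.
  have pn : - `|p| <= p by rewrite lerNl -normrN ler_norm.
  have key : A ^+ 2 <= Bb * (A - 2 * p + 17 * D).
    have : - (A * D) <= 4 * p * D by nra.
    by rewrite BE; nra.
  have : j <= (A - 2 * p + 17 * D) * i ^+ 2.
    rewrite -(ler_pM2l Bge) Bj mulrA.
    apply: le_trans (_ : A ^+ 2 * i ^+ 2 <= _); first by rewrite -exprMn Ai expr1n.
    by rewrite ler_wpM2r.
  have -> : (A - 2 * p + 17 * D) * i ^+ 2 =
      A * i * i - 2 * p * i ^+ 2 + 17 * (D * i ^+ 2) by ring.
  rewrite Ai mul1r; lra.
have pD : p <= 4 * D.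
  apply: (le_trans (ler_norm _)).
  rewrite -ler_sqr ?nnegrE ?mulr_ge0// real_normK ?num_real//.
  by apply: (le_trans pS); nra.
have pi2 : 2 * p * i ^+ 2 <= 8 * (D * i ^+ 2).
  have : p * i ^+ 2 <= 4 * D * i ^+ 2 by rewrite ler_wpM2r.
  by lra.
suff : k <= 4096 * (k * (X ^+ 2 * i ^+ 2)) + 64 * (k ^+ 2 * W) by lra.
have [XA|XA] := leP A (64 * X).
  have Xi1 : 1 <= 64 * (X * i).
    have : A * i <= 64 * X * i by rewrite ler_wpM2r// ltW.
    by rewrite Ai; lra.
  have : 1 <= 4096 * (X ^+ 2 * i ^+ 2) by nra.
  by rewrite -(ler_pM2l k0) mulr1; lra.
have WA : A <= 64 * W by lra.
have : 1 <= 64 * (W * i).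
  have : A * i <= 64 * W * i by rewrite ler_wpM2r// ltW.
  by rewrite Ai; lra.
have : W * i <= W * k by rewrite ler_wpM2l.
move=> a b; have : 1 <= 64 * (W * k) by lra.
by rewrite -(ler_pM2l k0) mulr1; lra.
Qed.

Lemma measurable_inv_shift (d : measure_display) (T : measurableType d)
    (eps : R) (X : T -> R) : 0 < eps -> measurable_fun setT X ->
  (forall w, 0 <= X w) -> measurable_fun setT (fun w => (eps + X w)^-1).
Proof.
move=> eps0 mX X0.
have cf : continuous (fun y : R => (eps + `|y|)^-1).
  move=> y; apply: cvgV; first by rewrite gt_eqF// ltr_pwDl.
  by apply: cvgD; [exact: cvg_cst|exact: norm_continuous].
have -> : (fun w => (eps + X w)^-1) = (fun y : R => (eps + `|y|)^-1) \o X.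
  by apply/funext => w /=; rewrite ger0_norm.
by apply: measurableT_comp mX; exact: continuous_measurable_fun.
Qed.

End inequalities.

Section drift_of_energy.
Context {R : realType} {n : nat}.
Local Notation site := 'rV[int]_n.
Variables (Y : seq site) (tau : site -> R).
Hypothesis tau0 : forall y, 0 <= tau y.
Hypothesis tau1 : \sum_(y <- Y) tau y <= 1.

(** The sites of Lam that a jump by y moves out of Lam. *)
Definition exits (Lam : seq site) (y : site) : seq site :=
  [seq x <- Lam | x + y \notin Lam].

(** The sum of q over the ends of the jumps out of Lam, weighted by tau. *)
Definition boundary_sum (Lam : seq site) (q : site -> R) : R :=
  \sum_(y <- Y) tau y * \sum_(x <- exits Lam y) q (x + y).

Lemma translate_sum_le (Lam : seq site) (q : site -> R) y : uniq Lam ->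
  (forall z, 0 <= q z) ->
  \sum_(x <- Lam) q (x + y) <=
  \sum_(x <- Lam) q x + \sum_(x <- exits Lam y) q (x + y).
Proof.
move=> uL q0; rewrite (bigID (fun x => x + y \notin Lam))/= addrC big_filter lerD2r.
rewrite -big_filter -(big_map (fun x => x + y) xpredT q); apply: sum_sub_le => //.
  by rewrite map_inj_uniq ?filter_uniq// => a b /addIr.
by move=> z /mapP[x]; rewrite mem_filter negbK => /andP[xy _] ->.
Qed.

(** By 2 |a_x a_(x+y)| <= a_x^2 + a_(x+y)^2 every jump costs at most three times
the energy at its start and once the energy at its end; the ends inside Lam are
distinct for a given y. *)
Lemma generator_energy (Lam : seq site) (a : site -> R) : uniq Lam ->
  - 2 * \sum_(x <- Lam) a x * generator_sum Y tau a x <=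
  4 * \sum_(x <- Lam) a x ^+ 2 + boundary_sum Lam (fun z => a z ^+ 2).
Proof.
move=> uL; set S := \sum_(x <- Lam) a x ^+ 2.
have S0 : 0 <= S by apply: sumr_ge0 => x _; rewrite sqr_ge0.
apply: (@le_trans _ _ (\sum_(y <- Y) tau y *
    (\sum_(x <- Lam) (3 * a x ^+ 2 + a (x + y) ^+ 2)))).
  under [leRHS]eq_bigr do rewrite mulr_sumr.
  rewrite exchange_big/= mulr_sumr; apply: ler_sum => x _.
  rewrite /generator_sum !mulr_sumr; apply: ler_sum => y _.
  have := tau0 y; have := sqr_ge0 (a x + a (x + y)); nra.
apply: (@le_trans _ _ (\sum_(y <- Y) (tau y * (4 * S) +
    tau y * \sum_(x <- exits Lam y) a (x + y) ^+ 2))).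
  apply: ler_sum => y _; rewrite -mulrDr ler_wpM2l//.
  rewrite big_split/= -mulr_sumr -/S.
  have := @translate_sum_le Lam (fun z => a z ^+ 2) y uL (fun z => sqr_ge0 _).
  by rewrite -/S; lra.
rewrite big_split/= -mulr_suml lerD2r ler_piMl// mulr_ge0//.
Qed.

End drift_of_energy.

(** * The mean inverse energy over one step *)

Lemma Ex_sum_in {R : realType} {d : measure_display} {T : measurableType d}
    (P : probability T R) (I : eqType) (s : seq I) (X : I -> T -> R) :
  (forall i, i \in s -> intg P (X i)) ->
  intg P (fun w => \sum_(i <- s) X i w) /\
  Ex P (fun w => \sum_(i <- s) X i w) = \sum_(i <- s) Ex P (X i).
Proof.
elim: s => [_|i s IH iX].
  under eq_fun do rewrite big_nil; rewrite big_nil.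
  by split; [exact: (intg_cst P 0)|exact: (Ex_cst P 0)].
have ii : intg P (X i) by apply: iX; rewrite mem_head.
have [iS Es] : intg P (fun w => \sum_(i <- s) X i w) /\
  Ex P (fun w => \sum_(i <- s) X i w) = \sum_(i <- s) Ex P (X i).
  by apply: IH => j js; apply: iX; rewrite inE js orbT.
under eq_fun do rewrite big_cons; rewrite big_cons.
by split; [exact: intgD|rewrite ExD// Es].
Qed.

Section energy.
Context {R : realType} {d : measure_display} {T : measurableType d}.
Variables (P : probability T R) (n : nat).
Local Notation site := 'rV[int]_n.
Local Notation E2 := (E2 P).
Local Notation Ex := (Ex P).
Local Notation intg := (intg P).
Local Notation kappa := (@normal_second R).
Variable B : site -> R -> T -> R.
Local Notation F := (brownian_filtration P B).
Local Notation dB x := (increment (B x)).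
Hypothesis HB : brownian_field P B.
Variables (Y : seq site) (tau : site -> R) (sigma : R -> R) (c0 lambda K : R).
Hypothesis tau0 : forall y, 0 <= tau y.
Hypothesis tau1 : \sum_(y <- Y) tau y <= 1.
Hypothesis K0 : 0 <= K.
Hypothesis sigma_cont : continuous sigma.
Hypothesis sigma_lip : forall a b, `|sigma a - sigma b| <= K * `|a - b|.
Hypothesis sigma_growth : forall a, `|sigma a| <= K * `|a|.
Variables v N : site -> R -> T -> R.
Hypothesis Hv : regular_solution P B Y tau sigma c0 lambda v N.
Local Notation drift := (drift Y tau v).
Local Notation neighbour_sum := (neighbour_sum Y tau).
Local Notation boundary_sum := (boundary_sum Y tau).

Variables (tmax : R) (g c : site -> R).
Hypothesis g0 : forall x, 0 <= g x.
Hypothesis vg : forall x (t : R), 0 <= t <= tmax -> (E2 (v x t) <= (g x)%:E)%E.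
Hypothesis cont0 : forall x, 0 <= c x.
Hypothesis vc : forall x (s t : R), 0 <= s -> s <= t -> t <= tmax ->
  (E2 (fun w => (v x t w - v x s w)%R) <= (c x * (t - s))%:E)%E.

Variables (Lam : seq site) (eps : R).
Hypotheses (uL : uniq Lam) (eps0 : 0 < eps).

Definition energy (r : R) (w : T) : R := \sum_(x <- Lam) v x r w ^+ 2.

Definition weight (r : R) (w : T) : R := (eps + energy r w)^-1.

Lemma energy_ge0 r w : 0 <= energy r w.
Proof. by apply: sumr_ge0 => x _; rewrite sqr_ge0. Qed.

Lemma sqr_le_energy x r w : x \in Lam -> v x r w ^+ 2 <= energy r w.
Proof.
move=> xL; rewrite /energy (big_rem x)//= lerDl.
by apply: sumr_ge0 => y _; rewrite sqr_ge0.
Qed.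

Lemma weight_gt0 r w : 0 < weight r w.
Proof. by rewrite invr_gt0 ltr_pwDl// energy_ge0. Qed.

Lemma weight_le r w : weight r w <= eps^-1.
Proof.
by rewrite lef_pV2 ?posrE//; [rewrite lerDl energy_ge0|
  rewrite ltr_pwDl// energy_ge0].
Qed.

Lemma weight_energy_le r w : weight r w * energy r w <= 1.
Proof.
have A0 : 0 < eps + energy r w by rewrite ltr_pwDl// energy_ge0.
by rewrite mulrC ler_pdivrMr// mul1r lerDr ltW.
Qed.

Lemma energy_measurable r : measurable_fun setT (energy r).
Proof.
by apply: measurable_sum => x; apply: measurable_funX; exact: (rs_measurable Hv).
Qed.

Lemma weight_measurable r : measurable_fun setT (weight r).
Proof.
apply: measurable_inv_shift => // [|w]; last exact: energy_ge0.
exact: energy_measurable.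
Qed.

Lemma weight_intg r : intg (weight r).
Proof.
apply: (intg_bounded P (weight_measurable r) (M := eps^-1)) => w.
by rewrite gtr0_norm ?weight_gt0// weight_le.
Qed.

Lemma weight_adapted s : 0 <= s -> sub_measurable (F s) (weight s).
Proof.
move=> s0; apply/sub_measurableP; apply: measurable_inv_shift => // [|w]; last first.
  exact: energy_ge0.
apply: measurable_sum => x; apply: measurable_funX.
by apply/sub_measurableP; exact: (rs_adapted Hv).
Qed.

Lemma site_weight_le x r w : x \in Lam -> weight r w * v x r w ^+ 2 <= 1.
Proof.
move=> xL; apply: le_trans (weight_energy_le r w).
by rewrite ler_pM2l ?weight_gt0// sqr_le_energy.
Qed.

Definition site_bound : R := eps^-1 ^+ 2 + eps^-1.

(** By |a| <= 1 + a^2 and i a^2 <= 1 for the weight i. *)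
Lemma site_coefficient_le x r w : x \in Lam ->
  `|weight r w ^+ 2 * v x r w| <= site_bound.
Proof.
move=> xL; have i0 := weight_gt0 r w; have ik := weight_le r w.
have := site_weight_le r w xL.
rewrite normrM ger0_norm ?sqr_ge0// -(real_normK (num_real (v x r w))) /site_bound.
move: i0 ik (normr_ge0 (v x r w)) (sqr_ge0 (`|v x r w| - 1)).
set i := weight r w; set k := eps^-1; set a := `|v x r w| => i0 ik a0 sq1 ia.
have : i ^+ 2 * a <= i ^+ 2 * (1 + a ^+ 2).
  by rewrite ler_wpM2l ?sqr_ge0//; nra.
have : i * (i * a ^+ 2) <= i by rewrite ler_piMr// ltW.
have : i ^+ 2 <= k ^+ 2 by rewrite ler_sqr ?nnegrE ?(ltW i0)// (le_trans (ltW i0)).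
by lra.
Qed.

Lemma weight_sqr_le r w : weight r w ^+ 2 <= eps^-1 ^+ 2.
Proof.
by rewrite ler_sqr ?nnegrE ?(ltW (weight_gt0 r w)) ?weight_le ?invr_ge0 ?ltW.
Qed.

Lemma site_weight_intg x s k : x \in Lam -> (0 < k <= 2)%N ->
  intg (fun w => weight s w ^+ 2 * v x s w ^+ k.*2) /\
  (k = 2%N -> Ex (fun w => weight s w ^+ 2 * v x s w ^+ k.*2) <= 1).
Proof.
move=> xL k12.
have mf : measurable_fun setT (fun w => weight s w ^+ 2 * v x s w ^+ k.*2).
  apply: measurable_funM; first by apply: measurable_funX; exact: weight_measurable.
  by apply: measurable_funX; exact: (rs_measurable Hv).
have k0 : 0 <= eps^-1 by rewrite invr_ge0 ltW.
have f0 w : 0 <= weight s w ^+ 2 * v x s w ^+ k.*2.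
  by rewrite mulr_ge0 ?sqr_ge0// -mul2n exprM exprn_ge0// sqr_ge0.
have [k1|k2] : k = 1%N \/ k = 2%N by move: k12; case: k {mf f0} => [|[|[|]]]//; auto.
  split; last by rewrite k1.
  apply: (intg_bounded P mf (M := eps^-1)) => w; rewrite ger0_norm//.
  have := site_weight_le s w xL; have := weight_gt0 s w; have := weight_le s w.
  rewrite k1 expr2 -mulrA => ik i0 iv.
  by apply: le_trans ik; rewrite ler_piMr// ltW.
have f1 w : weight s w ^+ 2 * v x s w ^+ k.*2 <= 1.
  rewrite k2 (exprM _ 2 2) -exprMn expr_le1// ?site_weight_le//.
  by rewrite mulr_ge0 ?sqr_ge0// ltW// weight_gt0.
have iw : intg (fun w => weight s w ^+ 2 * v x s w ^+ k.*2).
  by apply: (intg_bounded P mf (M := 1)) => w; rewrite ger0_norm.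
split => // _; rewrite -(Ex_cst P 1); apply: le_Ex => //; exact: (intg_cst P).
Qed.

(** The increment is independent of the other factors, which belong to the past,
and |xi| <= K |v|. *)
Lemma frozen_noise_moment x s t k (xi : T -> R) : 0 <= s -> s <= t -> x \in Lam ->
  (0 < k <= 2)%N -> sub_measurable (F s) xi ->
  (forall w, `|xi w| <= K * `|v x s w|) ->
  intg (fun w => weight s w ^+ 2 * (lambda * (xi w * dB x s t w)) ^+ k.*2) /\
  Ex (fun w => weight s w ^+ 2 * (lambda * (xi w * dB x s t w)) ^+ k.*2) <=
  lambda ^+ k.*2 * (fine (@normal_moment R k.*2) * (t - s) ^+ k) *
    (K ^+ k.*2 * Ex (fun w => weight s w ^+ 2 * v x s w ^+ k.*2)).
Proof.
move=> s0 st xL k12 Fxi xile.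
have [iV _] := site_weight_intg s xL k12.
have sub_measurableX (X : T -> R) j : sub_measurable (F s) X ->
    sub_measurable (F s) (fun w => X w ^+ j).
  move=> FX; apply/sub_measurableP; apply: measurable_funX.
  exact/sub_measurableP.
have evn (y : R) : 0 <= y ^+ k.*2 by rewrite -mul2n exprM exprn_ge0// sqr_ge0.
pose Z w := weight s w ^+ 2 * xi w ^+ k.*2.
have FZ : sub_measurable (F s) Z.
  apply: sub_measurableM; apply: sub_measurableX => //; exact: weight_adapted.
have Zle w : Z w <= K ^+ k.*2 * (weight s w ^+ 2 * v x s w ^+ k.*2).
  rewrite /Z mulrCA ler_wpM2l ?sqr_ge0// -exprMn.
  have nrm (y : R) : y ^+ k.*2 = `|y| ^+ k.*2.
    by rewrite -mul2n !exprM real_normK ?num_real.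
  by rewrite nrm [leRHS]nrm lerXn2r ?nnegrE// normrM (ger0_norm K0).
have Z0 w : 0 <= Z w by rewrite mulr_ge0// sqr_ge0.
have iZ : intg Z.
  apply: (le_intg _ (intgZ (K ^+ k.*2) iV)).
    exact: (sub_measurable_measurable HB FZ).
  by move=> w; rewrite ger0_norm.
have [iZB EZB] := increment_even HB x s0 st k12 FZ iZ.
have eqf : (fun w => weight s w ^+ 2 * (lambda * (xi w * dB x s t w)) ^+ k.*2) =
    (fun w => lambda ^+ k.*2 * (Z w * dB x s t w ^+ k.*2)).
  by apply/funext => w; rewrite /Z !exprMn; ring.
rewrite eqf; split; first exact: intgZ.
rewrite ExZ// EZB -[leRHS]mulrA ler_wpM2l// ler_wpM2l//.
  by rewrite mulr_ge0 ?exprn_ge0 ?subr_ge0// fine_ge0// normal_moment_ge0.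
by rewrite -ExZ//; apply: le_Ex => //; exact: intgZ.
Qed.

Lemma boundary_intg (s : R) : 0 <= s <= tmax ->
  intg (fun w => boundary_sum Lam (fun z => v z s w ^+ 2)) /\
  Ex (fun w => boundary_sum Lam (fun z => v z s w ^+ 2)) <= boundary_sum Lam g.
Proof.
move=> sr.
have mv z : measurable_fun setT (v z s) by exact: (rs_measurable Hv).
have iv z : intg (fun w => v z s w ^+ 2).
  by apply: intg_sqr => //; exact: le_lt_trans (vg z sr) (ltry _).
have iS y : intg (fun w => \sum_(x <- exits Lam y) v (x + y) s w ^+ 2).
  exact: (intg_sum (exits Lam y) (fun x => iv (x + y))).
have it y : intg (fun w => tau y * \sum_(x <- exits Lam y) v (x + y) s w ^+ 2).
  exact: intgZ.
split; first exact: (intg_sum Y it).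
rewrite /boundary_sum (Ex_sum Y it); apply: ler_sum => y _.
rewrite ExZ// ler_wpM2l// (Ex_sum (exits Lam y) (fun x => iv (x + y))).
by apply: ler_sum => x _; rewrite -lee_fin -E2E// vg.
Qed.

Lemma drift_energy_le (s : R) : 0 <= s <= tmax ->
  (forall x, x \in Lam ->
    intg (fun w => weight s w ^+ 2 * v x s w * drift x s w)) ->
  - 2 * \sum_(x <- Lam) Ex (fun w => weight s w ^+ 2 * v x s w * drift x s w) <=
  4 * Ex (weight s) + eps^-1 ^+ 2 * boundary_sum Lam g.
Proof.
move=> sr iD; have [ib Eb] := boundary_intg sr.
have [iS <-] := Ex_sum_in iD.
rewrite -(ExZ _ iS).
apply: (@le_trans _ _ (Ex (fun w => 4 * weight s w +
    eps^-1 ^+ 2 * boundary_sum Lam (fun z => v z s w ^+ 2)))).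
  apply: le_Ex; first exact: intgZ.
    by apply: intgD; apply: intgZ => //; exact: weight_intg.
  move=> w.
  have -> : \sum_(x <- Lam) weight s w ^+ 2 * v x s w * drift x s w =
      weight s w ^+ 2 * \sum_(x <- Lam) v x s w * drift x s w.
    by rewrite mulr_sumr; apply: eq_bigr => x _; rewrite mulrA.
  rewrite mulrCA.
  have := generator_energy tau0 tau1 (fun z => v z s w) uL.
  rewrite -/(energy s w) => gen.
  apply: (le_trans (ler_wpM2l (sqr_ge0 _) gen)).
  rewrite mulrDr; apply: lerD.
    rewrite mulrCA ler_pM2l// expr2 -mulrA ler_piMr ?weight_energy_le//.
    exact: ltW (weight_gt0 s w).
  rewrite ler_wpM2r ?weight_sqr_le//.
  apply: sumr_ge0 => y _; rewrite mulr_ge0//.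
  by apply: sumr_ge0 => x _; rewrite sqr_ge0.
rewrite ExD; [|by apply: intgZ; exact: weight_intg|exact: intgZ].
rewrite !ExZ//; last exact: weight_intg.
by rewrite lerD2l ler_wpM2l// sqr_ge0.
Qed.

Lemma site_energy_le s :
  \sum_(x <- Lam) Ex (fun w => weight s w ^+ 2 * v x s w ^+ 2) <= Ex (weight s).
Proof.
have iE x : x \in Lam -> intg (fun w => weight s w ^+ 2 * v x s w ^+ 2).
  by move=> xL; have [] := site_weight_intg s xL (isT : (0 < 1 <= 2)%N).
have [iS <-] := Ex_sum_in iE.
apply: le_Ex => //; first exact: weight_intg.
move=> w; rewrite -mulr_sumr -/(energy s w) expr2 -mulrA.
by rewrite ler_piMr ?weight_energy_le// ltW// weight_gt0.
Qed.

(** The expansion of the inverse energy along a step, for any decomposition of the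
displacement into a main part X and a remainder; the square of the sum of the
X_x^2 is split by Cauchy-Schwarz into fourth powers. *)
Lemma weight_step s t (X : site -> T -> R) w :
  weight t w + 2 * \sum_(x <- Lam) weight s w ^+ 2 * v x s w * step v s t x w <=
  weight s w + 34 * (\sum_(x <- Lam) weight s w ^+ 2 * X x w ^+ 2) +
  4096 * eps^-1 * (size Lam)%:R * (\sum_(x <- Lam) weight s w ^+ 2 * X x w ^+ 4) +
  98 * eps^-1 ^+ 2 * \sum_(x <- Lam) (step v s t x w - X x w) ^+ 2.
Proof.
have sq0 (f : site -> R) : 0 <= \sum_(x <- Lam) f x ^+ 2.
  by apply: sumr_ge0 => x _; rewrite sqr_ge0.
have Et : energy t w = energy s w + 2 * (\sum_(x <- Lam) v x s w * step v s t x w) +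
    \sum_(x <- Lam) step v s t x w ^+ 2.
  rewrite /energy mulr_sumr -!big_split/=; apply: eq_bigr => x _.
  by rewrite /step; ring.
have := @inverse_step R eps (energy s w) (\sum_(x <- Lam) v x s w * step v s t x w)
  (\sum_(x <- Lam) step v s t x w ^+ 2) (\sum_(x <- Lam) X x w ^+ 2)
  (\sum_(x <- Lam) (step v s t x w - X x w) ^+ 2) eps0 (sq0 _) (sq0 _) (sq0 _)
  (sq0 _) (cauchy_sum _ _ _) _ _.
rewrite -Et => H.
have {}H := H _ (energy_ge0 t w).
have /H {H} : \sum_(x <- Lam) step v s t x w ^+ 2 <=
    2 * (\sum_(x <- Lam) X x w ^+ 2) +
    2 * \sum_(x <- Lam) (step v s t x w - X x w) ^+ 2.
  rewrite !mulr_sumr -big_split/=; apply: ler_sum => x _.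
  by have := sqr_ge0 (step v s t x w - 2 * X x w); nra.
rewrite -/(weight t w) -/(weight s w) => H.
have -> : \sum_(x <- Lam) weight s w ^+ 2 * v x s w * step v s t x w =
    weight s w ^+ 2 * \sum_(x <- Lam) v x s w * step v s t x w.
  by rewrite mulr_sumr; apply: eq_bigr => x _; rewrite mulrA.
rewrite -!mulr_sumr.
have quad : (\sum_(x <- Lam) X x w ^+ 2) ^+ 2 * weight s w ^+ 2 <=
    (size Lam)%:R * (\sum_(x <- Lam) X x w ^+ 4) * weight s w ^+ 2.
  rewrite ler_wpM2r ?sqr_ge0//; apply: (le_trans (sqr_sum_le _ _)).
  by rewrite ler_wpM2l// ler_sum// => x _; rewrite -exprM.
have c0' : 0 <= 4096 * eps^-1 by rewrite mulr_ge0 ?ler0n// invr_ge0 ltW.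
have := ler_wpM2l c0' quad.
by lra.
Qed.

(** The one-step bound on the mean inverse energy. The noise enters through its
quadratic variation only, which the growth of sigma bounds by a multiple of the
energy, so that the factor in front of the mean inverse energy at time s depends
neither on Lam nor on eps. *)
Lemma one_step (eta : R) : 0 < eta -> exists2 C : R, 0 <= C &
  forall s t : R, 0 <= s -> s < t -> t <= tmax ->
  Ex (weight t) <= (1 + (4 + 34 * lambda ^+ 2 * kappa * K ^+ 2) * (t - s)) *
      Ex (weight s) + (t - s) * (eps^-1 ^+ 2 * boundary_sum Lam g + eta) +
      C * (t - s) ^+ 2.
Proof.
move=> eta0.
have k20 := @normal_second_ge0 R; have k40 := @normal_fourth_ge0 R.
have k0 : 0 <= eps^-1 by rewrite invr_ge0 ltW.
have M0 : 0 <= site_bound by rewrite addr_ge0 ?sqr_ge0.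
have [L L0 LE] : exists2 L : R, 0 <= L & (size Lam)%:R = L.
  by exists (size Lam)%:R => //; exact: ler0n.
have [c4 c40 c4E] : exists2 c4 : R, 0 <= c4 & 4096 * eps^-1 = c4.
  exists (4096 * eps^-1); last exact: erefl.
  exact: mulr_ge0 (ler0n _ 4096) k0.
have [c5 c50 c5E] : exists2 c5 : R, 0 <= c5 & 98 * eps^-1 ^+ 2 = c5.
  exists (98 * eps^-1 ^+ 2); last exact: erefl.
  exact: mulr_ge0 (ler0n _ 98) (sqr_ge0 _).
(* with this e the part of order h of the errors of step_mean is at most eta h *)
have [e e0 Le] : exists2 e, 0 < e & 2 * L * site_bound * e <= eta.
  have LM0 : 0 <= 2 * L * site_bound by rewrite mulr_ge0// mulr_ge0.
  exists (eta / (2 * L * site_bound + 1)); first by rewrite divr_gt0// ltr_wpDl.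
  rewrite mulrCA ler_piMr ?(ltW eta0)// ler_pdivrMr ?ltr_wpDl//.
  by rewrite mul1r lerDl.
pose CW (x : site) := 4 * neighbour_sum g x +
  2 * lambda ^+ 2 * (8 * kappa * (K ^+ 2 * c x + 1)) * 2.
have CW0 x : 0 <= CW x.
  have ns := neighbour_sum_ge0 Y tau0 x g0.
  have cx : 0 <= K ^+ 2 * c x + 1 by rewrite addr_ge0// mulr_ge0// sqr_ge0.
  have kc := mulr_ge0 k20 cx.
  have := mulr_ge0 (sqr_ge0 lambda) kc.
  by rewrite /CW; lra.
have l40 : 0 <= lambda ^+ 4 * normal_fourth * K ^+ 4.
  by rewrite mulr_ge0 ?exprn_ge0// mulr_ge0// (exprM lambda 2 2) sqr_ge0.
pose CS := \sum_(x <- Lam) CW x; pose CN := \sum_(x <- Lam) neighbour_sum c x.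
have CS0 : 0 <= CS by exact: sumr_ge0.
have CN0 : 0 <= CN by apply: sumr_ge0 => x _; exact: (neighbour_sum_ge0 Y tau0).
exists (c4 * L * (L * (lambda ^+ 4 * normal_fourth * K ^+ 4)) + c5 * CS +
        2 * (site_bound * CN / e)).
  apply: addr_ge0; first apply: addr_ge0.
  - exact: mulr_ge0 (mulr_ge0 c40 L0) (mulr_ge0 L0 l40).
  - exact: mulr_ge0.
  - by rewrite mulr_ge0// divr_ge0 ?(ltW e0)// mulr_ge0.
move=> s t s0 st tt; set h := t - s.
have h0 : 0 < h by rewrite subr_gt0.
have st' := ltW st.
have stm : 0 <= s <= tmax by rewrite s0 (le_trans st').
have [xi Hxi] := choice (step_approx HB tau0 tau1 K0 sigma_cont sigma_lip
  sigma_growth Hv g0 vg cont0 vc s0 st tt).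
have Fxi x : sub_measurable (F s) (xi x) by have [] := Hxi x.
have xile x w : `|xi x w| <= K * `|v x s w| by have [_ _ H _] := Hxi x; exact: H.
pose X x w := lambda * (xi x w * dB x s t w).
have mX x : measurable_fun setT (X x).
  apply: measurable_funM => //; apply: measurable_funM.
    exact: (sub_measurable_measurable HB (Fxi x)).
  exact: (increment_measurable HB).
have mW x : measurable_fun setT (fun w => step v s t x w - X x w).
  by apply: measurable_funB => //; exact: (step_measurable Hv).
have EW x : (E2 (fun w => (step v s t x w - X x w)%R) <= (CW x * h ^+ 2)%:E)%E.
  by have [_ _ _] := Hxi x.
have iW x : x \in Lam -> intg (fun w => (step v s t x w - X x w) ^+ 2).
  by move=> _; apply: intg_sqr => //; exact: le_lt_trans (EW x) (ltry _).
have iX2 x : x \in Lam -> intg (fun w => weight s w ^+ 2 * X x w ^+ 2).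
  move=> xL.
  by have [] := frozen_noise_moment (k := 1) s0 st' xL isT (Fxi x) (xile x).
have iX4 x : x \in Lam -> intg (fun w => weight s w ^+ 2 * X x w ^+ 4).
  move=> xL.
  by have [] := frozen_noise_moment (k := 2) s0 st' xL isT (Fxi x) (xile x).
have Fz x : sub_measurable (F s) (fun w => weight s w ^+ 2 * v x s w).
  apply: sub_measurableM; last exact: (rs_adapted Hv).
  by apply: sub_measurableM; exact: weight_adapted.
have mean x (xL : x \in Lam) := step_mean HB tau0 tau1 K0 sigma_cont
  sigma_growth Hv vg cont0 vc s0 st tt x (Fz x)
  (fun w => site_coefficient_le s w xL) e0.
have iD x : x \in Lam -> intg (fun w => weight s w ^+ 2 * v x s w * step v s t x w).
  by move=> xL; have [] := mean x xL.
have idr x : x \in Lam -> intg (fun w => weight s w ^+ 2 * v x s w * drift x s w).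
  by move=> xL; have [_ []] := mean x xL.
have [iDS EDS] := Ex_sum_in iD.
have [iX2S EX2S] := Ex_sum_in iX2.
have [iX4S EX4S] := Ex_sum_in iX4.
have [iWS EWS] := Ex_sum_in iW.
have iw := weight_intg.
have step_le : Ex (weight t) +
    2 * \sum_(x <- Lam) Ex (fun w => weight s w ^+ 2 * v x s w * step v s t x w) <=
    Ex (weight s) +
    34 * (\sum_(x <- Lam) Ex (fun w => weight s w ^+ 2 * X x w ^+ 2)) +
    c4 * L * (\sum_(x <- Lam) Ex (fun w => weight s w ^+ 2 * X x w ^+ 4)) +
    c5 * \sum_(x <- Lam) Ex (fun w => (step v s t x w - X x w) ^+ 2).
  have j1 := intgD (iw t) (intgZ 2 iDS).
  have j2 := intgD (iw s) (intgZ 34 iX2S).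
  have j3 := intgD j2 (intgZ (c4 * L) iX4S).
  have j4 := intgD j3 (intgZ c5 iWS).
  have := le_Ex j1 j4; rewrite -c4E -c5E -LE => /(_ (weight_step s t X)).
  rewrite c4E c5E LE.
  rewrite (ExD (iw t) (intgZ 2 iDS)) (ExD j3 (intgZ c5 iWS)).
  rewrite (ExD j2 (intgZ (c4 * L) iX4S)) (ExD (iw s) (intgZ 34 iX2S)).
  by rewrite !ExZ// EDS EX2S EX4S EWS.
have sumX2 : \sum_(x <- Lam) Ex (fun w => weight s w ^+ 2 * X x w ^+ 2) <=
    lambda ^+ 2 * (kappa * h) * (K ^+ 2 * Ex (weight s)).
  apply: (@le_trans _ _ (\sum_(x <- Lam) lambda ^+ 2 * (kappa * h) * (K ^+ 2 *
      Ex (fun w => weight s w ^+ 2 * v x s w ^+ 2)))).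
    rewrite big_seq [leRHS]big_seq; apply: ler_sum => x xL.
    by have [] := frozen_noise_moment (k := 1) s0 st' xL isT (Fxi x) (xile x).
  rewrite -!mulr_sumr; apply: ler_wpM2l.
    exact: mulr_ge0 (sqr_ge0 _) (mulr_ge0 k20 (ltW h0)).
  by rewrite ler_wpM2l ?sqr_ge0// site_energy_le.
have sumX4 : \sum_(x <- Lam) Ex (fun w => weight s w ^+ 2 * X x w ^+ 4) <=
    L * (lambda ^+ 4 * normal_fourth * K ^+ 4) * h ^+ 2.
  apply: (@le_trans _ _ (\sum_(x <- Lam)
      (lambda ^+ 4 * normal_fourth * K ^+ 4 * h ^+ 2))); last first.
    by rewrite big_const_seq count_predT iter_addr_0 -[_ *+ _]mulr_natl LE mulrA.
  rewrite big_seq [leRHS]big_seq; apply: ler_sum => x xL.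
  have [_] := frozen_noise_moment (k := 2) s0 st' xL isT (Fxi x) (xile x).
  move=> /le_trans; apply.
  have [_ /(_ erefl) le1] := site_weight_intg (k := 2) s xL isT.
  have := ler_wpM2l (mulr_ge0 l40 (sqr_ge0 h)) le1; rewrite mulr1.
  apply: le_trans; rewrite (_ : 2.*2 = 4)%N// -/normal_fourth -/h.
  by rewrite le_eqVlt; apply/orP; left; apply/eqP; ring.
have sumW : \sum_(x <- Lam) Ex (fun w => (step v s t x w - X x w) ^+ 2) <=
    CS * h ^+ 2.
  rewrite /CS mulr_suml big_seq [leRHS]big_seq; apply: ler_sum => x xL.
  by rewrite -lee_fin -E2E// iW.
have sumD : h * (\sum_(x <- Lam) Ex (fun w => weight s w ^+ 2 * v x s w * drift x s w))
    - (L * site_bound * (h * e) + site_bound * CN / e * h ^+ 2) <=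
    \sum_(x <- Lam) Ex (fun w => weight s w ^+ 2 * v x s w * step v s t x w).
  have -> : L * site_bound * (h * e) + site_bound * CN / e * h ^+ 2 =
      \sum_(x <- Lam) site_bound * (h * e + neighbour_sum c x * h ^+ 2 / e).
    rewrite -mulr_sumr big_split/= -!mulr_suml -/CN.
    rewrite big_const_seq count_predT iter_addr_0 -[_ *+ _]mulr_natl LE.
    by ring.
  rewrite mulr_sumr -sumrB big_seq [leRHS]big_seq; apply: ler_sum => x xL.
  have [_ [_]] := mean x xL; rewrite ler_norml => /andP[+ _].
  by rewrite -/h; lra.
have drift_le := ler_wpM2l (ltW h0) (drift_energy_le stm idr).
have c4L := ler_wpM2l (mulr_ge0 c40 L0) sumX4.
have c5W := ler_wpM2l c50 sumW.
have Leh := ler_wpM2l (ltW h0) Le.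
by lra.
Qed.

End energy.

(** * The energy decays at most exponentially *)

Section gronwall.
Context {R : realType}.

(** Over steps of length h a quadratic error accumulates to an error of order h,
which vanishes as the partition is refined. *)
Lemma gronwall_steps (f : R -> R) (a b C T : R) : 0 <= a -> 0 <= b -> 0 <= C ->
  0 < T -> 0 <= f 0 ->
  (forall s t, 0 <= s -> s < t -> t <= T ->
    f t <= (1 + a * (t - s)) * f s + (t - s) * b + C * (t - s) ^+ 2) ->
  f T <= expR (a * T) * (f 0 + T * b).
Proof.
move=> a0 b0 C0 T0 f0 fstep.
(* the bound obtained from m steps of length T / m *)
have steps m : (0 < m)%N -> f T <= expR (a * T) * (f 0 + T * b + C * T ^+ 2 / m%:R).
  move=> m0; have mR : 0 < m%:R :> R by rewrite ltr0n.
  pose h := T / m%:R; have h0 : 0 < h by rewrite divr_gt0.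
  have mh : m%:R * h = T by rewrite /h mulrCA divff ?mulr1// gt_eqF.
  have ind k : (k <= m)%N ->
      f (k%:R * h) <= expR (a * (k%:R * h)) * (f 0 + k%:R * (h * b + C * h ^+ 2)).
    elim: k => [|k IH] km; first by rewrite !mul0r mulr0 expR0 mul1r addr0.
    have {}IH := IH (ltnW km).
    have kh0 : 0 <= k%:R * h by rewrite mulr_ge0// ltW.
    have khk : k.+1%:R * h - k%:R * h = h by rewrite -natr1; ring.
    have := fstep _ (k.+1%:R * h) kh0.
    rewrite khk ltr_pM2r// ltr_nat ltnS leqnn => /(_ isT).
    have -> : (k.+1%:R * h <= T) = true.
      by rewrite -mh ler_pM2r// ler_nat.
    move=> /(_ isT) /le_trans; apply.
    have e1 : 1 <= expR (a * (k%:R * h)).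
      by apply: le_trans (expR_ge1Dx _); rewrite lerDl mulr_ge0.
    have e2 : expR (a * (k.+1%:R * h)) = expR (a * (k%:R * h)) * expR (a * h).
      by rewrite -expRD -natr1; congr expR; ring.
    have ah : 1 + a * h <= expR (a * h) by exact: expR_ge1Dx.
    have ah0 : 0 <= a * h by rewrite mulr_ge0// ltW.
    have q0 : 0 <= h * b + C * h ^+ 2.
      by rewrite addr_ge0// mulr_ge0// ?(ltW h0)// sqr_ge0.
    have p0 : 0 <= f 0 + k%:R * (h * b + C * h ^+ 2) by rewrite addr_ge0// mulr_ge0.
    rewrite e2 -natr1 -[leLHS]addrA [in leRHS]mulrDl mul1r [in leRHS]addrA.
    move: IH e1 ah ah0 q0 p0.
    set E := expR (a * (k%:R * h)); set E' := expR (a * h).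
    set q := h * b + C * h ^+ 2; set p := f 0 + k%:R * q.
    move=> IH e1 ah ah0 q0 p0.
    have E0 : 0 <= E by exact: expR_ge0.
    have s1 : (1 + a * h) * f (k%:R * h) <= E' * (E * p).
      apply: (@le_trans _ _ ((1 + a * h) * (E * p))).
        by rewrite ler_wpM2l// addr_ge0.
      by rewrite ler_wpM2r// mulr_ge0.
    have EE : 1 <= E * E'.
      by rewrite -[1]mulr1 ler_pM//; lra.
    have s2 : q <= E * E' * q by rewrite ler_peMl.
    by lra.
  have := ind m (leqnn m); rewrite mh => /le_trans; apply.
  rewrite ler_wpM2l ?expR_ge0// -addrA lerD2l mulrDr mulrA mh lerD2l.
  have -> : m%:R * (C * h ^+ 2) = C * T ^+ 2 / m%:R.
    by rewrite /h; field; rewrite gt_eqF.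
  exact: lexx.
apply/ler_addgt0Pr => e e0.
pose D := expR (a * T) * (C * T ^+ 2).
have D0 : 0 <= D by rewrite mulr_ge0 ?expR_ge0// mulr_ge0 ?sqr_ge0.
pose m := (Num.truncn (D / e)).+1.
have De : D / m%:R <= e.
  rewrite ler_pdivrMr ?ltr0n// mulrC -ler_pdivrMr//.
  by apply: ltW; rewrite truncnS_gt.
apply: (le_trans (steps m isT)).
by rewrite [leLHS]mulrDr lerD2l mulrA -/D.
Qed.

End gronwall.

Section boundary.
Context {R : realType} {n : nat}.
Local Notation site := 'rV[int]_n.
Variables (Y : seq site) (tau : site -> R).
Hypothesis tau0 : forall y, 0 <= tau y.
Hypothesis tau1 : \sum_(y <- Y) tau y <= 1.

(** If the sum of q over Lam is within eta of its supremum, then the ends of the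
jumps out of Lam by a given y, which are distinct and outside of Lam, carry a mass
of at most eta. *)
Lemma boundary_sum_small (q : site -> R) (eta : R) : (forall z, 0 <= q z) ->
  summable_over_sites q -> 0 < eta -> exists Lam : seq site,
  [/\ uniq Lam, 0 \in Lam & boundary_sum Y tau Lam q <= eta].
Proof.
move=> q0 [C HC] eta0.
pose S := [set r | exists2 A : seq site, uniq A & r = \sum_(x <- A) q x].
have hS : has_sup S.
  split; first by exists (\sum_(x <- [::]) q x); exists [::].
  by exists C => _ [A uA ->]; exact: HC.
have [_ [A uA ->] supA] := sup_adherent eta0 hS.
pose Lam := if 0 \in A then A else 0 :: A.
have uL : uniq Lam by rewrite /Lam; case: ifPn => //= ->.
have AL : \sum_(x <- A) q x <= \sum_(x <- Lam) q x.
  by apply: sum_sub_le => // z; rewrite /Lam; case: ifP => //; rewrite inE orbC => _ ->.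
exists Lam; split => //; first by rewrite /Lam; case: ifP => //; rewrite mem_head.
apply: (@le_trans _ _ (\sum_(y <- Y) tau y * eta)); last first.
  by rewrite -mulr_suml ler_piMl// ltW.
apply: ler_sum => y _; rewrite ler_wpM2l//.
have uE : uniq (Lam ++ map (fun x => x + y) (exits Lam y)).
  rewrite cat_uniq uL map_inj_uniq ?filter_uniq ?andbT//=; last by move=> a b /addIr.
  by apply/hasPn => z /mapP[x]; rewrite mem_filter => /andP[xy _] ->.
have : \sum_(x <- Lam ++ map (fun x => x + y) (exits Lam y)) q x <= sup S.
  by apply: ub_le_sup; [exact: (proj2 hS)|eexists; last reflexivity].
rewrite big_cat big_map/=; lra.
Qed.

End boundary.

Section inverse_energy.
Context {R : realType} {d : measure_display} {T : measurableType d}.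
Variables (P : probability T R) (n : nat).
Local Notation site := 'rV[int]_n.
Local Notation Ex := (Ex P).
Local Notation kappa := (@normal_second R).
Variable B : site -> R -> T -> R.
Hypothesis HB : brownian_field P B.
Variables (Y : seq site) (tau : site -> R) (sigma : R -> R) (c0 lambda K : R).
Hypothesis c00 : 0 < c0.
Hypothesis tau0 : forall y, 0 <= tau y.
Hypothesis tau1 : \sum_(y <- Y) tau y <= 1.
Hypothesis K0 : 0 <= K.
Hypothesis sigma_cont : continuous sigma.
Hypothesis sigma_lip : forall a b, `|sigma a - sigma b| <= K * `|a - b|.
Hypothesis sigma_growth : forall a, `|sigma a| <= K * `|a|.
Variables v N : site -> R -> T -> R.
Hypothesis Hv : regular_solution P B Y tau sigma c0 lambda v N.

(** The exponential rate in the bound on the mean inverse energy: 4 comes from the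
drift, the rest from the quadratic variation of the noise. *)
Definition rate : R := 4 + 34 * lambda ^+ 2 * kappa * K ^+ 2.

Lemma rate_ge0 : 0 <= rate.
Proof.
have := @normal_second_ge0 R; have := sqr_ge0 lambda; have := sqr_ge0 K.
rewrite /rate => a b e; have := mulr_ge0 (mulr_ge0 b e) a; lra.
Qed.

Lemma weight_initial (Lam : seq site) (eps : R) : 0 < eps -> 0 \in Lam ->
  Ex (weight v Lam eps 0) <= c0^-1 ^+ 2.
Proof.
move=> eps0 L0; have iw := weight_intg Hv Lam eps0 0.
pose f w := Num.min (weight v Lam eps 0 w) (c0^-1 ^+ 2).
have mf : measurable_fun setT f.
  by apply: measurable_minr => //; exact: (intg_measurable iw).
have bf w : `|f w| <= c0^-1 ^+ 2.
  rewrite ger0_norm; first by rewrite /f ge_min lexx orbT.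
  by rewrite /f le_min sqr_ge0 andbT ltW// weight_gt0.
have -> : Ex (weight v Lam eps 0) = Ex f.
  rewrite /Ex; congr fine; apply: ae_eq_integral => //.
  - exact: measurable_int iw.
  - exact/measurable_EFinP.
  - apply: filterS (rs_initial Hv 0) => w w0 _.
    congr EFin; rewrite /f min_l// exprVn lef_pV2 ?posrE ?exprn_gt0//; last first.
      by rewrite ltr_pwDl// energy_ge0.
    apply: (@le_trans _ _ (energy v Lam 0 w)); last by rewrite lerDr ltW.
    by have := sqr_le_energy v 0 w L0; rewrite w0 eqxx mulr1.
rewrite -(Ex_cst P (c0^-1 ^+ 2)); apply: le_Ex.
- exact: intg_bounded mf bf.
- exact: intg_cst.
- by move=> w; rewrite /f ge_min lexx orbT.
Qed.

(** The boundary term and eta are both at most c0^-2 / (2 T), so that over the time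
T they at most double the initial value c0^-2. *)
Lemma mean_weight_le (eps tend : R) : 0 < eps -> 0 < tend ->
  exists Lam : seq site, uniq Lam /\
    Ex (weight v Lam eps tend) <= expR (rate * tend) * (2 * c0^-1 ^+ 2).
Proof.
move=> eps0 T0.
have [g [g0 vg gsum]] := moment_bound HB tau0 tau1 K0 sigma_cont sigma_growth Hv T0.
have vc := continuity_bound HB tau0 tau1 K0 sigma_cont sigma_growth Hv g0 vg.
pose c x := 2 * tend * neighbour_sum Y tau g x + 8 * lambda ^+ 2 * kappa * K ^+ 2 * g x.
have cont0 x : 0 <= c x.
  have ns := neighbour_sum_ge0 Y tau0 x g0.
  have := mulr_ge0 (ltW T0) ns.
  have := mulr_ge0 (mulr_ge0 (mulr_ge0 (sqr_ge0 lambda) (@normal_second_ge0 R))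
    (sqr_ge0 K)) (g0 x).
  by rewrite /c; lra.
pose eta := c0^-1 ^+ 2 / (2 * tend).
have c20 : 0 < c0^-1 ^+ 2 by rewrite exprn_gt0// invr_gt0.
have eta0 : 0 < eta by rewrite divr_gt0// mulr_gt0.
have e20 : 0 < eps ^+ 2 by rewrite exprn_gt0.
have [Lam [uL L0 bL]] := boundary_sum_small tau0 tau1 g0 gsum (mulr_gt0 e20 eta0).
have bLe : eps^-1 ^+ 2 * boundary_sum Y tau Lam g <= eta.
  by rewrite exprVn mulrC ler_pdivrMr// mulrC.
exists Lam; split => //.
have [C C0 fstep] := one_step HB tau0 tau1 K0 sigma_cont sigma_lip sigma_growth Hv
  g0 vg cont0 vc uL eps0 eta0.
have := @gronwall_steps R (fun t => Ex (weight v Lam eps t)) rate (2 * eta) C tend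
  rate_ge0 _ C0 T0 _ _.
have w00 : 0 <= Ex (weight v Lam eps 0).
  by apply: Rintegral_ge0 => w _; rewrite ltW// weight_gt0.
move=> /(_ _ w00) H; apply: (le_trans (H _ _)).
- by rewrite mulr_ge0// ltW.
- move=> s t s0 st tt; apply: (le_trans (fstep s t s0 st tt)).
  rewrite lerD2r lerD2l ler_wpM2l ?subr_ge0 ?(ltW st)//.
  by lra.
- rewrite ler_wpM2l ?expR_ge0//.
  have -> : tend * (2 * eta) = c0^-1 ^+ 2 by rewrite /eta; field; rewrite !gt_eqF.
  by have := weight_initial eps0 L0; lra.
Qed.

(** Chebyshev's inequality with eps equal to the level: where the energy is at most
eps, the inverse of eps plus the energy is at least 1 / (2 eps). *)
Lemma energy_small_probability (tend : R) : 0 < tend ->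
  exists Lam : seq site, uniq Lam /\
  (P [set w | (energy v Lam tend w <= c0 ^+ 2 * expR (- rate * tend) / 8)%R] <=
   (2^-1)%:E)%E.
Proof.
move=> T0; have [eps eps0 epsE] : exists2 eps : R, 0 < eps &
    c0 ^+ 2 * expR (- rate * tend) / 8 = eps.
  eexists; last reflexivity.
  by rewrite divr_gt0// mulr_gt0 ?expR_gt0// exprn_gt0.
have [Lam [uL EL]] := mean_weight_le eps0 T0; exists Lam; split => //.
rewrite epsE; set A := [set w | _].
have mA : measurable A.
  rewrite [A](_ : _ = energy v Lam tend @^-1` `]-oo, eps]%classic); last first.
    by apply/seteqP; split => w /=; rewrite in_itv.
  have := energy_measurable Hv Lam tend.
  by move=> /(_ measurableT _ (measurable_itv `]-oo, eps])); rewrite setTI.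
have iw := weight_intg Hv Lam eps0 tend.
have mI : measurable_fun setT (\1_A : T -> R) by exact: measurable_indic.
have iI : intg P (\1_A : T -> R).
  apply: (intg_bounded P mI (M := 1)) => w.
  by rewrite indicE; case: (_ \in _); rewrite ?normr1 ?normr0.
have PA : P A = (Ex (\1_A : T -> R))%:E.
  by rewrite -intgE// /= integral_indic// setIT.
rewrite PA lee_fin.
have : Ex (fun w => (2 * eps)^-1 * (\1_A : T -> R) w) <= Ex (weight v Lam eps tend).
  apply: le_Ex => //; first exact: intgZ.
  move=> w; rewrite indicE; case: (boolP (w \in A)) => wA; last first.
    by rewrite mulr0 ltW// weight_gt0.
  rewrite mulr1 lef_pV2 ?posrE ?mulr_gt0//; last by rewrite ltr_pwDl// energy_ge0.
  by move: wA; rewrite inE /A/= => wA; lra.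
rewrite ExZ// ler_pdivrMl ?mulr_gt0// => /le_trans; apply.
apply: (le_trans (ler_wpM2l _ EL)); first by rewrite mulr_ge0// ltW.
have -> : 2 * eps * (expR (rate * tend) * (2 * c0^-1 ^+ 2)) =
    2^-1 * (expR (- rate * tend) * expR (rate * tend)).
  by rewrite -epsE; field; rewrite gt_eqF.
by rewrite -expRD mulNr addNr expR0 mulr1.
Qed.

End inverse_energy.

(** * From the energy to the total mass *)

Section growth.
Context {R : realType}.

Lemma sum_sqr_le (I : Type) (s : seq I) (a : I -> R) :
  \sum_(i <- s) a i ^+ 2 <= (\sum_(i <- s) `|a i|) ^+ 2.
Proof.
elim: s => [|i s IH]; first by rewrite !big_nil expr0n.
rewrite !big_cons; have S0 : 0 <= \sum_(j <- s) `|a j| by exact: sumr_ge0.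
have := mulr_ge0 (normr_ge0 (a i)) S0.
by rewrite -(real_normK (num_real (a i))); lra.
Qed.

Lemma lne_total_mass_ge {d : measure_display} {T : measurableType d} {n : nat}
    (u : 'rV[int]_n -> R -> T -> R)
    (Lam : seq 'rV[int]_n) (t y : R) (w : T) : uniq Lam ->
  expR (2 * y) < energy u Lam t w -> (y%:E <= lne (total_mass u t w))%E.
Proof.
move=> uL uy; have S0 : 0 <= \sum_(x <- Lam) `|u x t w| by exact: sumr_ge0.
have yS : expR y <= \sum_(x <- Lam) `|u x t w|.
  rewrite -ler_sqr ?nnegrE ?expR_ge0// -expRM_natl mulr_natl.
  by rewrite -mulr_natl; apply: (le_trans (ltW uy)); exact: sum_sqr_le.
have tm : ((expR y)%:E <= total_mass u t w)%E.
  apply: (@le_trans _ _ (\sum_(x <- Lam) `|u x t w|)%:E); first by rewrite lee_fin.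
  apply: esum_ge; exists [set` Lam]; first by split; [exact: finite_seq|].
  by rewrite -sumEFin fsbig_seq.
have -> : y%:E = lne (expR y)%:E by rewrite lne_EFin ?expR_gt0// expRK.
rewrite lee_lne ?in_itv/= ?andbT ?lee_fin ?expR_ge0 ?leey//.
by rewrite andbT; apply: le_trans tm; rewrite lee_fin expR_ge0.
Qed.

Lemma limf_esup_frequently (f : R -> \bar R) (b : R) :
  (forall M : R, exists2 t, M < t & (b%:E <= f t)%E) ->
  (-oo < limf_esup f (pinfty_nbhs R))%E.
Proof.
move=> fb; apply: (@lt_le_trans _ _ b%:E); first exact: ltNyr.
apply: le_ereal_inf_tmp => _ [V [M [_ MV]] <-].
have [t Mt bt] := fb M; apply: (le_trans bt).
by apply: ereal_sup_ubound; exists t => //; exact: MV.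
Qed.

(** Continuity from above, applied to the unions of the tails. *)
Lemma lim_sup_set_probability_ge (d : measure_display) (T : measurableType d)
    (P : probability T R) (A : (set T)^nat) (p : \bar R) :
  (forall k, measurable (A k)) -> (forall k, (p <= P (A k))%E) ->
  measurable (lim_sup_set A) /\ (p <= P (lim_sup_set A))%E.
Proof.
move=> mA pA.
have mU k : measurable (\bigcup_(j in [set j | (k <= j)%N]) A j).
  exact: bigcup_measurable.
split; first exact: bigcap_measurable.
have fin : (P (\bigcup_(k in [set k | (0 <= k)%N]) A k) < +oo)%E.
  by apply: (le_lt_trans (probability_le1 P (mU 0%N))); exact: ltry.
apply: (cvge_ge _ (lim_sup_set_cvg P A mA fin)).
apply: nearW => k; apply: (le_trans (pA k)); apply: le_measure; rewrite ?inE//.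
exact: (@bigcup_sup _ _ k _ A (leqnn k)).
Qed.

End growth.

Theorem mainTheorem3 (R : realType) (d : measure_display)
    (T : measurableType d) (P : probability T R)
    (n : nat) (c0 lambda : R)
    (tau : 'rV[int]_n -> R) (sigma : R -> R)
    (B u : 'rV[int]_n -> R -> T -> R)
    (n_ge1 : (1 <= n)%N) (c0_gt0 : 0 < c0) (lambda_gt0 : 0 < lambda)
    (Htau : jump_law tau) (Hsigma : noise_coefficient sigma)
    (HB : brownian_field P B)
    (Hu : is_solution P tau sigma c0 lambda B u) :
  exists E : set T, [/\ measurable E, (0 < P E)%E &
    forall w, E w ->
      (-oo < limf_esup (fun t : R => (t^-1)%:E * lne (total_mass u t w))
               (pinfty_nbhs R))%E].
Proof.
have tau0 := jump_ge0 Htau.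
have [Y [_ tau1 genE]] := jump_support Htau.
have [K K0 [lip growth]] := noise_bounds Hsigma.
have sc := noise_continuous Hsigma.
have [v [N [Hv vu]]] := regular_solution_exists HB genE sc Hu.
pose small (k : nat) := c0 ^+ 2 * expR (- rate lambda K * k.+1%:R) / 8.
have [Lam HLam] := choice (fun k : nat => energy_small_probability HB c0_gt0 tau0
  tau1 K0 sc lip growth Hv (ltr0Sn R k)).
pose A k := [set w | (small k < energy v (Lam k) k.+1%:R w)%R].
have AC k : ~` A k = [set w | (energy v (Lam k) k.+1%:R w <= small k)%R].
  apply/seteqP; split => w; rewrite /A/= leNgt; first by move/negP.
  by move=> /negP.
have mA k : measurable (A k).
  rewrite [A k](_ : _ = energy v (Lam k) k.+1%:R @^-1` `]small k, +oo[%classic); last first.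
    by apply/seteqP; split => w /=; rewrite in_itv/= andbT.
  have := energy_measurable Hv (Lam k) k.+1%:R.
  by move=> /(_ measurableT _ (measurable_itv `]small k, +oo[)); rewrite setTI.
have PA k : ((2^-1)%:E <= P (A k))%E.
  have [_] := HLam k; rewrite -/(small k) -AC probability_setC//.
  have := fin_num_measure P _ (mA k); case: (P (A k)) => // r _.
  by rewrite -EFinB !lee_fin; lra.
have [mL PL] := lim_sup_set_probability_ge mA PA.
have [Z [mZ PZ Zvu]] : {ae P, forall w, forall k x, v x k.+1%:R w = u x k.+1%:R w}.
  apply/ae_foralln => k; apply: ae_forall_countable => x.
  exact: vu.
exists (lim_sup_set A `\` Z); split; first exact: measurableD.
  have : (P (lim_sup_set A) <= P (lim_sup_set A `\` Z) + P Z)%E.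
    apply: le_trans (measureU2 _ _ mZ); last exact: measurableD.
    apply: le_measure; rewrite ?inE//; first by apply: measurableU => //; exact: measurableD.
    by move=> w Lw; have [Zw|Zw] := pselect (Z w); [right|left].
  by rewrite [P Z]PZ adde0; apply: lt_le_trans; apply: lt_le_trans PL; rewrite lte_fin.
move=> w [Lw Zw].
have vuw k x : v x k.+1%:R w = u x k.+1%:R w.
  by apply: contrapT => h; apply: Zw; apply: Zvu => /(_ k x).
pose l := ln (c0 ^+ 2 / 8).
apply: (@limf_esup_frequently _ _ (- rate lambda K / 2 - `|l| / 2)) => M.
have [k Mk Ak] : exists2 k, (Num.truncn M <= k)%N & A k w.
  by have [k] := Lw (Num.truncn M) I; exists k.
exists k.+1%:R.
  apply: (lt_le_trans (truncnS_gt M)); by rewrite ler_nat ltnS.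
have k0 : 0 < k.+1%:R :> R by rewrite ltr0n.
(* the logarithm of the square root of the level *)
pose y := (l - rate lambda K * k.+1%:R) / 2.
have yE : expR (2 * y) = small k.
  rewrite /y mulrC divfK// expRD /l lnK ?posrE ?divr_gt0 ?exprn_gt0//.
  by rewrite /small -mulNr; ring.
have ly : (y%:E <= lne (total_mass u k.+1%:R w))%E.
  apply: (lne_total_mass_ge (proj1 (HLam k))); rewrite yE.
  move: Ak; rewrite /A/= /energy.
  by rewrite (eq_bigr (fun x => u x k.+1%:R w ^+ 2))// => x _; rewrite vuw.
apply: (@le_trans _ _ ((k.+1%:R^-1)%:E * y%:E)%E); last first.
  by rewrite lee_wpmul2l// lee_fin invr_ge0 ltW.
rewrite -EFinM lee_fin [leRHS]mulrC ler_pdivlMr// /y.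
have : - `|l| <= l by rewrite lerNl -normrN ler_norm.
have : 1 <= k.+1%:R :> R by rewrite ler1n.
have := normr_ge0 l; nra.
Qed.
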